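(* Let $\mu,\nu\in\mathcal{P}_c(\mathbb{H}^n)$. If $u\in\mathrm{Lip}_1(\mathbb{H}^n,d_{SR})$ is a Kantorovich potential, then for any $\gamma\in\Pi_1(\mu,\nu)$ the vector measure $\mathbf{w}_\gamma$ is absolutely continuous with respect to $a_\gamma$, with density $-\nabla_Hu$: $$\mathbf{w}_\gamma=-(\nabla_Hu)\,a_\gamma.$$
   Context: Let $n\ge 1$. $\mathbb{H}^n$ is $\mathbb{R}^{2n+1}$ with the horizontal vector fields $X_j=\partial_{x_j}-\frac{x_{n+j}}{2}\partial_{x_{2n+1}}$, $X_{n+j}=\partial_{x_{n+j}}+\frac{x_j}{2}\partial_{x_{2n+1}}$ ($j=1,\dots,n$). $H_x\mathbb{H}^n=\mathrm{span}\{X_1(x),\dots,X_{2n}(x)\}$ carries the inner product $\langle\cdot,\cdot\rangle_H$ (norm $|\cdot|_H$) making $X_1,\dots,X_{2n}$ orthonormal. A curve $\sigma\in AC([0,1],\mathbb{R}^{2n+1})$ is horizontal if $\dot\sigma(t)\in H_{\sigma(t)}\mathbb{H}^n$ for a.e. $t$; $\ell_{SR}(\sigma)=\int_0^1|\dot\sigma|_H\,dt$; $d_{SR}(x,y)$ is the infimum of $\ell_{SR}$ over horizontal curves from $x$ to $y$. A geodesic is a horizontal curve on $[0,1]$ with $\ell_{SR}(\sigma)=d_{SR}(\sigma(0),\sigma(1))$, parametrized proportionally to arc length; $\mathrm{Geo}(\mathbb{H}^n)$ is the set of geodesics. $\mathcal{P}_c(\mathbb{H}^n)$: compactly supported Borel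 probability measures. $\Pi(\mu,\nu)$: Borel probability measures on $\mathbb{H}^n\times\mathbb{H}^n$ with marginals $\mu,\nu$; $\Pi_1(\mu,\nu)$: those minimizing $\int d_{SR}\,d\gamma$. $\mathrm{Lip}_1(\mathbb{H}^n,d_{SR})$: functions $u:\mathbb{H}^n\to\mathbb{R}$ with $|u(x)-u(y)|\le d_{SR}(x,y)$ for all $x,y$. A Kantorovich potential is a $u\in\mathrm{Lip}_1(\mathbb{H}^n,d_{SR})$ maximizing $\int u\,d(\mu-\nu)$ over $\mathrm{Lip}_1(\mathbb{H}^n,d_{SR})$. $\nabla_Hu(x)=\sum_{j=1}^{2n}X_ju(x)X_j(x)$ is taken pointwise at the points where $u$ is Pansu differentiable (the measures $a_\gamma$ and $\mathbf{w}_\gamma$ are concentrated on such points). Fix a selection of geodesics $S:\mathbb{H}^n\times\mathbb{H}^n\to\mathrm{Geo}(\mathbb{H}^n)$, $(x,y)\mapsto\sigma_{x,y}$, where $\sigma_{x,y}$ is a geodesic from $x$ to $y$, and $S$ is $\gamma$-measurable for every positive Borel measure $\gamma$. For $\gamma\in\Pi_1(\mu,\nu)$, the horizontal transport density $a_\gamma\in\mathcal{M}_+(\mathbb{H}^n)$ is defined by $\int\varphi\,da_\gamma=\int_{\mathbb{H}^n\times\mathbb{H}^n}\left(\int_0^1\varphi(\sigma_{x,y}(t))|\dot\sigma_{x,y}(t)|_Hdt\right)d\gamma(x,y)$, $\varphi\in C(\mathbb{H}^n)$, and the vector horizontal transport density $\mathbf{w}_\gamma$, an $H\mathbb{H}^n$-valued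 (i.e. $\mathbb{R}^{2n}$-valued in the frame $X_1,\dots,X_{2n}$) finite Radon measure, by $\int\phi\cdot d\mathbf{w}_\gamma=\int_{\mathbb{H}^n\times\mathbb{H}^n}\left(\int_0^1\langle\phi(\sigma_{x,y}(t)),\dot\sigma_{x,y}(t)\rangle_Hdt\right)d\gamma(x,y)$ for continuous horizontal vector fields $\phi$. *)

(* Defs.v *)
From HB Require Import structures.
From mathcomp Require Import all_boot all_order all_algebra.
From mathcomp Require Import all_classical all_reals all_analysis.

Set Implicit Arguments.
Unset Strict Implicit.
Unset Printing Implicit Defensive.

Import Order.TTheory GRing.Theory Num.Theory.
Import numFieldNormedType.Exports.

Local Open Scope classical_set_scope.
Local Open Scope ring_scope.

(* Coordinates x_1, ..., x_{2n} have index [hidx j], with j : 'I_(n + n), and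
   x_{2n+1} has index [ord_max]. In 'I_(n + n), [lshift n k] is the index of
   x_k and [rshift n k] that of x_{n+k}. *)
Notation heis R n := 'rV[R]_(n + n).+1.

Definition hidx (n : nat) (j : 'I_(n + n)) : 'I_(n + n).+1 :=
  widen_ord (leqnSn (n + n)) j.

(* Measurability on products [borelH R n * borelH R n] refers to the product
   sigma-algebra, which is the Borel one since R^(2n+1) is second countable. *)
Definition borelH (R : realType) (n : nat) :=
  g_sigma_algebraType (@open (heis R n)).

Section Heisenberg.
Context {R : realType} {n : nat}.
Local Notation H := (heis R n).
Local Notation BH := (borelH R n).
Implicit Types (x y v : H) (s t : R).

(* The group law for which the fields X_j below are left-invariant. *)
Definition hmul x y : H :=
  x + y +
  (2^-1 * \sum_(k < n) (x 0 (hidx (lshift n k)) * y 0 (hidx (rshift n k)) -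
                        x 0 (hidx (rshift n k)) * y 0 (hidx (lshift n k))))
    *: delta_mx 0 ord_max.

Definition hinv x : H := - x.

Definition dilation s x : H :=
  \row_i ((if i == ord_max then s ^+ 2 else s) * x 0 i).

Definition Xfield (j : 'I_(n + n)) x : H :=
  match fintype.split j with
  | inl k => delta_mx 0 (hidx j)
             - (x 0 (hidx (rshift n k)) / 2) *: delta_mx 0 ord_max
  | inr k => delta_mx 0 (hidx j)
             + (x 0 (hidx (lshift n k)) / 2) *: delta_mx 0 ord_max
  end.

Definition frame x : 'M[R]_(n + n, (n + n).+1) := \matrix_(j < n + n) Xfield j x.

(* The horizontal space at x is the row space of [frame x]. *)
Definition in_horizontal x v : Prop := (v <= frame x)%MS.

(* Coordinates in X_1(x), ..., X_{2n}(x) of v, meaningful when v is in the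
   horizontal space at x; see [hcoordK] and [hcoord_frame] below. *)
Definition hcoord x v : 'rV[R]_(n + n) := v *m pinvmx (frame x).

Definition hinner x v v' : R := \sum_j hcoord x v 0 j * hcoord x v' 0 j.

Definition hnorm x v : R := Num.sqrt (hinner x v v).

Lemma frame_row_free x : row_free (frame x).
Proof.
apply/row_freeP.
exists (\matrix_(i < (n + n).+1, j < n + n) (i == hidx j)%:R).
apply/matrixP => i j; rewrite !mxE (bigD1 (hidx j)) //= big1 => [|k /negPf kj].
  rewrite !mxE eqxx mulr1 addr0 /Xfield.
  have jn : (hidx j == ord_max :> 'I_(n + n).+1) = false.
    by apply/negP => /eqP/(congr1 val) /= jn; have := ltn_ord j; rewrite jn ltnn.
  have ij : (hidx j == hidx i) = (i == j).
    by rewrite eq_sym -!val_eqE.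
  by case: fintype.split => k; rewrite !mxE eqxx jn ij /= mulr0 ?subr0 ?addr0.
by rewrite !mxE kj mulr0.
Qed.

Lemma hcoord_frame x (c : 'rV[R]_(n + n)) : hcoord x (c *m frame x) = c.
Proof. by rewrite /hcoord mulmxKp ?frame_row_free. Qed.

Lemma hcoordK x v : in_horizontal x v -> hcoord x v *m frame x = v.
Proof. exact: mulmxKpV. Qed.

(* Curves on [0,1] are represented by functions on R of which only the values
   on [0,1] matter. *)

Definition abs_continuous01 (sigma : R -> H) : Prop :=
  forall e : R, 0 < e -> exists2 d : R, 0 < d &
    forall (m : nat) (a b : 'I_m -> R),
      (forall i, 0 <= a i <= b i /\ b i <= 1) ->
      trivIset [set: 'I_m] (fun i => `]a i, b i[%classic) ->
      \sum_i (b i - a i) < d ->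
      \sum_i `|sigma (b i) - sigma (a i)| < e.

Definition horizontal (sigma : R -> H) : Prop :=
  abs_continuous01 sigma /\
  {ae lebesgue_measure, forall t : R, t \in `[0, 1] ->
     derivable sigma t 1 /\ in_horizontal (sigma t) (derive1 sigma t)}.

Definition speed (sigma : R -> H) t : R := hnorm (sigma t) (derive1 sigma t).

Definition lengthSR (sigma : R -> H) : \bar R :=
  (\int[lebesgue_measure]_(t in `[0%R, 1%R]) (speed sigma t)%:E)%E.

Definition dSR x y : \bar R :=
  ereal_inf [set lengthSR sigma |
    sigma in [set sigma | [/\ horizontal sigma, sigma 0 = x & sigma 1 = y]]].

Definition geodesic (sigma : R -> H) : Prop :=
  [/\ horizontal sigma,
      lengthSR sigma = dSR (sigma 0) (sigma 1) &
      {ae lebesgue_measure, forall t : R, t \in `[0, 1] ->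
         (speed sigma t)%:E = lengthSR sigma}].

(* The set of geodesics carries the topology of uniform convergence on [0,1].
   For a Borel measure gamma, gamma-measurable sets are those in the
   Caratheodory sigma-algebra of the outer measure induced by gamma. *)
Definition geodesic_selection (S : H * H -> R -> H) : Prop :=
  (forall x y, [/\ geodesic (S (x, y)), S (x, y) 0 = x & S (x, y) 1 = y]) /\
  (forall (gamma : {measure set (BH * BH)%type -> \bar R})
          (U : set {uniform` (`[0%R, 1%R]%classic : set R) -> H}), open U ->
     (mu_ext gamma).-caratheodory (S @^-1` U)).

Definition compactly_supported (mu : probability BH R) : Prop :=
  exists K : set H, compact K /\ mu K = 1%E.

Definition transport_plan (mu nu : probability BH R)
    (gamma : probability (BH * BH)%type R) : Prop :=
  forall A : set BH, measurable A ->
    gamma (A `*` setT) = mu A /\ gamma (setT `*` A) = nu A.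

Definition transport_cost (gamma : probability (BH * BH)%type R) : \bar R :=
  (\int[gamma]_p dSR p.1 p.2)%E.

Definition optimal_plan (mu nu : probability BH R)
    (gamma : probability (BH * BH)%type R) : Prop :=
  transport_plan mu nu gamma /\
  forall gamma', transport_plan mu nu gamma' ->
    (transport_cost gamma <= transport_cost gamma')%E.

Definition Lip1 (u : H -> R) : Prop :=
  forall x y, (`|u x - u y|%:E <= dSR x y)%E.

Definition kantorovich_potential (mu nu : probability BH R) (u : H -> R) : Prop :=
  Lip1 u /\
  forall v : H -> R, Lip1 v ->
    (\int[mu]_x (v x)%:E - \int[nu]_x (v x)%:E
     <= \int[mu]_x (u x)%:E - \int[nu]_x (u x)%:E)%E.

Definition H_linear (L : H -> R) : Prop :=
  (forall x y, L (hmul x y) = L x + L y) /\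
  (forall s x, 0 < s -> L (dilation s x) = s * L x).

Definition pansu_differentiable (u : H -> R) x : Prop :=
  exists2 L : H -> R, H_linear L &
    (u y - u x - L (hmul (hinv x) y)) / fine (dSR x y) @[y --> x^'] --> (0 : R).

(* Coordinates of the horizontal gradient in the frame X_1, ..., X_{2n}. *)
Definition hgrad (u : H -> R) x : 'rV[R]_(n + n) :=
  \row_j 'D_(Xfield j x) u x.

(* Integral against a signed measure; by [Hahn_decomposition_uniq] it does not
   depend on the chosen Hahn decomposition. *)
Definition charge_integral (nu : {charge set BH -> \bar R}) (f : H -> R) : \bar R :=
  let HP := cid (Hahn_decomposition nu) in
  let HN := cid (projT2 HP) in
  let PN := projT2 HN in
  (\int[jordan_pos PN]_x (f x)%:E - \int[jordan_neg PN]_x (f x)%:E)%E.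

(* The inner integrand is phi(S p t) |d/dt S p t|_H; phi need not have compact
   support, so phi = 1 already forces a to be finite. *)
Definition transport_density (S : H * H -> R -> H)
    (gamma : probability (BH * BH)%type R)
    (a : {measure set BH -> \bar R}) : Prop :=
  forall phi : H -> R, continuous phi ->
    (\int[a]_x (phi x)%:E =
     \int[gamma]_p \int[lebesgue_measure]_(t in `[0%R, 1%R])
        (phi (S p t) * speed (S p) t)%:E)%E.

(* An R^{2n}-valued measure is given by its components in the frame; likewise
   phi lists the frame components of the vector field x |-> phi x *m frame x. *)
Definition vector_transport_density (S : H * H -> R -> H)
    (gamma : probability (BH * BH)%type R)
    (w : 'I_(n + n) -> {charge set BH -> \bar R}) : Prop :=
  forall phi : H -> 'rV[R]_(n + n), continuous phi ->
    (\sum_(j < n + n) charge_integral (w j) (fun x => phi x 0%R j) =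
     \int[gamma]_p \int[lebesgue_measure]_(t in `[0%R, 1%R])
        (hinner (S p t) (phi (S p t) *m frame (S p t)) (derive1 (S p) t))%:E)%E.

Definition has_density (w : 'I_(n + n) -> {charge set BH -> \bar R})
    (a : {measure set BH -> \bar R}) (f : H -> 'rV[R]_(n + n)) : Prop :=
  forall j, a.-integrable setT (fun x : BH => (f x 0 j)%:E) /\
    forall A : set BH, measurable A -> w j A = (\int[a]_(x in A) (f x 0%R j)%:E)%E.

End Heisenberg.

(* Main.v *)
(* An optimal plan has cyclically monotone support: otherwise a small part of it
   could be replaced by products of marginals of its restrictions to small
   neighbourhoods of the points of a bad cycle, which lowers the cost. The
   shortest-path potential then shows that u(x) - u(y) = d(x,y) gamma-almost
   everywhere, so u decreases at unit rate along gamma-almost every selected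
   geodesic.

   Let s be such a geodesic, of length l > 0. Any point y near s(0) is joined to
   s(1) by the curve s + (1 - t) h + lam f(t) E, where h is the horizontal part of
   y - s(0), f is the centred primitive of a nonconstant coordinate of s, E is
   symplectically dual to that coordinate, and lam is chosen so that the last
   coordinate matches. Hence d(y, s(1)) <= l + A(h) + O(d(s(0), y)^2) with A
   linear. Applied to the two halves of s on each side of an interior point x, and
   combined with the Lipschitz property of u, this squeezes u between two
   expansions of this kind, so u(w) - u(x) is linear in the horizontal part of
   w - x up to O(d(x,w)^2). Thus u is Pansu differentiable at x, and
   differentiating u along s identifies the velocity with -l times the horizontal
   gradient.

   The selection agrees gamma-almost everywhere with a jointly Borel map of (p, t),
   which makes the transport density a push-forward measure; testing the vector
   density against continuous functions then yields the formula. *)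

From HB Require Import structures.
From mathcomp Require Import all_boot all_order all_algebra.
From mathcomp Require Import all_classical all_reals all_analysis measurable_realfun.
From mathcomp Require Import ring lra.
Require Import Defs.
Set Implicit Arguments.
Unset Strict Implicit.
Unset Printing Implicit Defensive.
Import Order.TTheory GRing.Theory Num.Theory.
Import numFieldNormedType.Exports.
Local Open Scope classical_set_scope.
Local Open Scope ring_scope.

(** * Absolutely continuous functions on [0,1] *)

(** The obstacle in the variation is the vertical coordinate. Adding [(1 - t) h] to a geodesic
    spoils it by an amount of first order in the distance [r], and repairing that with a commutator
    would cost a length of order the square root of [r]. The term [lam f E] repairs it at a rate
    whose leading part is the variance of the chosen coordinate: the duality of [E] turns this rate
    into the integral of a square. A geodesic of positive length has a nonconstant coordinate, so
    the rate is positive, [lam] is of order [r], and the length changes linearly up to order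
    [r ^ 2]. In other words, nonconstant horizontal curves are never abnormal here.

    Only upper expansions of the distance arise, but two of them from opposite ends suffice, since u
    is affine along the ray in between. The velocity then comes from an equality case of
    Cauchy-Schwarz: its product with the gradient is [- l], its norm is [l], and the gradient has
    norm at most 1.

    A second obstacle is that neither [derive1 sigma] nor the integrands built from [S] are known to
    be measurable, so integrals are first compared off null sets. *)

Lemma real_induction01 (R : realType) (P : R -> Prop) :
  P 0 ->
  (forall t : R, 0 <= t <= 1 -> exists2 d, 0 < d & forall x y : R,
     0 <= x -> x <= t -> t <= y -> y <= 1 -> y - x < d -> P x -> P y) ->
  forall t : R, 0 <= t <= 1 -> P t.
Proof.
move=> P0 Pstep r /andP[r0 r1].
pose A := [set x | [/\ 0 <= x, x <= r & P x]].
have hA : has_sup A.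
  by split; [exists 0; split|exists r => x []].
have s0 : 0 <= sup A by apply: sup_upper_bound => //; split.
have sr : sup A <= r by apply: ge_sup; [exists 0; split|move=> x []].
have [|d d0 Pd] := Pstep (sup A); first by rewrite s0 (le_trans sr).
have [x [x0 xr Px] xs] := sup_adherent (divr_gt0 d0 (ltr0n _ 2)) hA.
have xA : x <= sup A by apply: sup_upper_bound.
(* [x] lies less than [d / 2] below the supremum and [y] at most [d / 3] above it, so the step
   hypothesis carries [P] from [x] to [y]. As [y] cannot exceed [sup A], it must be [r]. *)
pose y := Num.min r (sup A + d / 3).
have Py : P y.
  apply: (Pd x y) => //; rewrite /y.
  - by rewrite le_min sr lerDl divr_ge0 // ltW.
  - by rewrite ge_min r1.
  - have : Num.min r (sup A + d / 3) <= sup A + d / 3 by rewrite ge_min lexx orbT.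
    lra.
have /(sup_upper_bound hA) : A y.
  split => //; last by rewrite /y ge_min lexx.
  by rewrite /y le_min r0 addr_ge0 // divr_ge0 // ltW.
rewrite /y ge_min => /orP[rA|]; last by lra.
by move: Py; rewrite /y (min_idPl _) //; have := divr_ge0 (ltW d0) (ler0n R 3); lra.
Qed.

Definition ac01 (R : realType) (f : R -> R) : Prop :=
  forall e : R, 0 < e -> exists2 d : R, 0 < d &
    forall (m : nat) (a b : 'I_m -> R),
      (forall i, 0 <= a i <= b i /\ b i <= 1) ->
      trivIset [set: 'I_m] (fun i => `]a i, b i[%classic) ->
      \sum_i (b i - a i) < d ->
      \sum_i `|f (b i) - f (a i)| < e.

(** Lists suit the covering argument, which adds one interval at a time at the head. The intervals
    run from right to left, whence their disjointness. *)
Lemma ac01_seq (R : realType) (f : R -> R) : ac01 f ->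
  forall e : R, 0 < e -> exists2 d : R, 0 < d & forall s : seq (R * R),
    all (fun p => (0 <= p.1) && (p.1 <= p.2) && (p.2 <= 1)) s ->
    pairwise (fun p q => q.2 <= p.1) s ->
    \sum_(p <- s) (p.2 - p.1) < d -> \sum_(p <- s) `|f p.2 - f p.1| < e.
Proof.
move=> acf e e0; have [d d0 fd] := acf e e0; exists d => // s s01 sp.
rewrite !(big_nth (0, 0)) !big_mkord => sd.
apply: (fd _ (fun i : 'I_(size s) => (nth (0, 0) s i).1)
             (fun i : 'I_(size s) => (nth (0, 0) s i).2)) => //.
  by move=> i; have := all_nthP (0, 0) s01 i (ltn_ord i) => /andP[].
have wlg (i j : 'I_(size s)) x : (i < j)%N ->
    x \in `](nth (0, 0) s i).1, (nth (0, 0) s i).2[ ->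
    x \in `](nth (0, 0) s j).1, (nth (0, 0) s j).2[ -> False.
  move=> ij; rewrite !in_itv /= => /andP[ix _] /andP[_ xj].
  have /= := pairwiseP (0, 0) sp i j (ltn_ord i) (ltn_ord j) ij.
  by rewrite leNgt (lt_trans ix).
move=> i j _ _ [x [/= xi xj]]; apply/val_inj; apply/eqP.
by have [/wlg H|/wlg H|//] := ltngtP i j; [have := H _ xi xj|have := H _ xj xi].
Qed.

(** The one-sided straddle condition of Henstock-Kurzweil theory. A derivative at most 0 at [t]
    implies it ([straddle_derive]), and it covers intervals that contain [t] anywhere. *)
Definition straddle_le0 (R : realType) (k : R -> R) (t : R) : Prop :=
  forall e : R, 0 < e -> exists2 d : R, 0 < d & forall x y : R,
    x <= t -> t <= y -> y - x < d -> k y - k x <= e * (y - x).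

(* Cousin's covering argument: the tags in the exceptional set are absorbed by
   the absolute continuity of [f], the other ones by [straddle_le0]. *)
Lemma ac01_ae_le (R : realType) (f G : R -> R) (N : set R) :
  ac01 f -> {in `[0, 1] &, {homo G : x y / x <= y}} ->
  measurable N -> lebesgue_measure N = 0%E ->
  (forall t, t \in `[0, 1] -> ~ N t -> straddle_le0 (fun x => f x - G x) t) ->
  forall t, t \in `[0, 1] -> f t - f 0 <= G t - G 0.
Proof.
move=> acf Gnd mN N0 good r.
rewrite in_itv /= => r01.
apply/ler_addgt0Pr => e e0.
have e20 : 0 < e / 2 by rewrite divr_gt0.
have [d d0 fd] := ac01_seq acf e20.
have Nfin : (lebesgue_measure N < +oo)%E by rewrite N0.
have [U [oU NU UN]] := lebesgue_regularity_outer mN Nfin d0.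
have mU : measurable U by exact: open_measurable.
have Ud : (lebesgue_measure U < d%:E)%E.
  by rewrite -(setDUK NU) setUC measureU0//; exact: measurableD.
pose m x := fine (lebesgue_measure (U `&` `[0, x])).
have mfin x : lebesgue_measure (U `&` `[0, x]) \is a fin_num.
  rewrite ge0_fin_numE //; apply: le_lt_trans (le_measure _ _ _ _) (lt_trans Ud (ltry _)); rewrite ?inE//.
    exact: measurableI.
(* Invariant of the covering: [s] collects the intervals around exceptional tags. They are taken
   inside the open set [U] of measure less than [d], so [m x] bounds their total length; all the
   other intervals together cost at most [e / 2 * x]. *)
pose P x := exists s : seq (R * R), [/\
   all (fun p => (0 <= p.1) && (p.1 <= p.2) && (p.2 <= x)) s,
   pairwise (fun p q => q.2 <= p.1) s,
   \sum_(p <- s) (p.2 - p.1) <= m x &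
   (f x - G x) - (f 0 - G 0) <= e / 2 * x + \sum_(p <- s) `|f p.2 - f p.1|].
suff [s [s01 sp sm]] : P r.
  have /andP[r0 r1] := r01.
  have /fd : all (fun p => (0 <= p.1) && (p.1 <= p.2) && (p.2 <= 1)) s.
    apply: sub_all s01 => p /andP[-> /= p2]; exact: le_trans p2 r1.
  move=> /(_ sp) fds.
  have : \sum_(p <- s) (p.2 - p.1) < d.
    apply: le_lt_trans sm _; rewrite -lte_fin fineK//.
    apply: le_lt_trans (le_measure _ _ _ _) Ud; rewrite ?inE//.
    exact: measurableI.
  by move=> /fds; nra.
apply: (@real_induction01 R P) r01.
  by exists [::]; rewrite /= !big_nil mulr0; split => //; [exact: fine_ge0|lra].
move=> t t01; have [Nt|Nt] := pselect (N t).
  have /nbhs_ballP[d' /= d'0 tU] : nbhs t U by apply: open_nbhs_nbhs; split=> //; exact: NU.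
  exists d' => // x y x0 xt ty y1 yx [s [s01 sp sm sf]].
  have xy := le_trans xt ty.
  have xyU : `]x, y] `<=` U.
    by move=> z /=; rewrite in_itv /= => /andP[xz zy]; apply: tU; rewrite /ball /= ltr_distl; lra.
  exists ((x, y) :: s); split => /=.
  - by rewrite x0 xy lexx /=; apply: sub_all s01 => p /andP[-> /= /le_trans]; exact.
  - by rewrite sp andbT; apply: sub_all s01 => p /andP[_ ->].
  - rewrite big_cons /=.
    have -> : m y = fine (lebesgue_measure (U `&` `[0%R, x]) + lebesgue_measure `]x, y]%classic)%E.
      rewrite -measureU//; [|exact: measurableI|]; last first.
        by apply/seteqP; split=> z //= [[_]]; rewrite !in_itv /=; lra.
      congr (fine (lebesgue_measure _)); apply/seteqP; split => z /=.
        rewrite !in_itv /= => -[Uz zy].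
        by have [zx|xz] := leP z x; [left; split=> //; lra|right; lra].
      by rewrite !in_itv /= => -[[Uz zx]|zxy]; split => //; [lra|apply: xyU; rewrite /= in_itv|lra].
    rewrite fineD//; last by rewrite lebesgue_measure_itv /=; case: ifP.
    rewrite -/(m x) lebesgue_measure_itv /= lte_fin.
    by case: ltP => [_|yx'] /=; lra.
  - rewrite big_cons /=.
    have Gxy : G x <= G y by apply: Gnd; rewrite ?in_itv//=; lra.
    have := ler_norm (f y - f x); have : e / 2 * x <= e / 2 * y by rewrite ler_wpM2l// ltW.
    lra.
have [d' d'0 kd] := good t t01 Nt _ e20.
exists d' => // x y x0 xt ty y1 yx [s [s01 sp sm sf]].
have xy := le_trans xt ty.
exists s; split => //.
- by apply: sub_all s01 => p /andP[-> /= /le_trans]; exact.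
- apply: le_trans sm _; rewrite /m fine_le// le_measure// ?inE; [exact: measurableI|exact: measurableI|].
  by apply: setIS => z /=; rewrite !in_itv /=; lra.
- by have := kd x y xt ty yx; lra.
Qed.

Section AC.
Variable R : realType.
Implicit Types f g phi : R -> R.

Lemma ac01_lip f (K : R) :
  {in `[0, 1] &, forall s t : R, `|f t - f s| <= K * `|t - s|} -> ac01 f.
Proof.
move=> fK e e0; exists (e / (`|K| + 1)); first by rewrite divr_gt0// ltr_wpDl.
move=> m a b ab _ sd.
apply: (@le_lt_trans _ _ ((`|K| + 1) * \sum_i (b i - a i))); last first.
  by rewrite mulrC -ltr_pdivlMr// ltr_wpDl.
rewrite mulr_sumr; apply: ler_sum => i _.
have [/andP[a0 aib] b1] := ab i.
apply: (le_trans (fK _ _ _ _)).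
- by rewrite in_itv /= a0 (le_trans aib).
- by rewrite in_itv /= b1 (le_trans a0).
- rewrite ger0_norm ?subr_ge0// ler_wpM2r ?subr_ge0//.
  by apply: le_trans (ler_norm K) _; rewrite lerDl.
Qed.

Lemma ac01D f g : ac01 f -> ac01 g -> ac01 (fun t => f t + g t).
Proof.
move=> acf acg e e0; have e20 : 0 < e / 2 by rewrite divr_gt0.
have [d1 d10 fd] := acf _ e20; have [d2 d20 gd] := acg _ e20.
exists (Num.min d1 d2); first by rewrite lt_min d10.
move=> m a b ab tab; rewrite lt_min => /andP[sd1 sd2].
have := ltrD (fd m a b ab tab sd1) (gd m a b ab tab sd2).
rewrite -mulr2n -[_ *+ 2]mulr_natr mulfVK//; apply: le_lt_trans.
rewrite -big_split /=; apply: ler_sum => i _.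
by rewrite opprD addrACA ler_normD.
Qed.

Lemma ac01_uniform f : ac01 f -> forall e : R, 0 < e -> exists2 d : R, 0 < d &
  {in `[0, 1] &, forall s t : R, `|t - s| < d -> `|f t - f s| < e}.
Proof.
move=> acf e e0; have [d d0 fd] := acf e e0; exists d => //.
have wlg (s t : R) : s \in `[0, 1] -> t \in `[0, 1] -> s <= t -> `|t - s| < d -> `|f t - f s| < e.
  rewrite !in_itv /= => /andP[s0 s1] /andP[t0 t1] st std.
  have := fd 1%N (fun=> s) (fun=> t); rewrite !big_ord1; apply.
  - by move=> _; rewrite s0 st.
  - by move=> i j _ _ _; rewrite !ord1.
  - by rewrite ger0_norm ?subr_ge0 in std.
move=> s t s01 t01 std; have [st|ts] := leP s t; first exact: wlg.
by rewrite distrC; apply: wlg => //; [exact: ltW|rewrite distrC].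
Qed.

(** Precomposition with this retraction extends a function on [0,1] to the line by constants, so
    that continuity and Borel measurability can be used globally. *)
Definition clamp01 (t : R) : R := Num.max 0 (Num.min t 1).

Lemma clamp01_id t : t \in `[0, 1] -> clamp01 t = t.
Proof.
by rewrite in_itv /= => /andP[t0 t1]; rewrite /clamp01 (min_idPl _)// (max_idPr _).
Qed.

Lemma clamp01_in t : clamp01 t \in `[0, 1].
Proof. by rewrite in_itv /= /clamp01 le_max lexx /= ge_max ler01 ge_min lexx orbT. Qed.

Lemma clamp01_lip (s t : R) : `|clamp01 t - clamp01 s| <= `|t - s|.
Proof.
rewrite /clamp01 !maxEle !minEle.
case: (leP t 1) => t1; case: (leP s 1) => s1; do ?case: ifPn; rewrite -?ltNge;
  rewrite ler_norml; case: (ler0P (t - s)); lra.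
Qed.

Lemma ac01_clamp_continuous f : ac01 f -> continuous (f \o clamp01).
Proof.
move=> acf x; apply/cvgrPdist_lt => e e0.
have [d d0 fd] := ac01_uniform acf e0.
apply/nbhs_ballP; exists d => //= y xy; apply: fd; try exact: clamp01_in.
exact: le_lt_trans (clamp01_lip _ _) xy.
Qed.

Lemma ac01_bounded f : ac01 f ->
  exists2 M : R, 0 < M & {in `[0, 1], forall t : R, `|f t| <= M}.
Proof.
move=> acf.
have [|c _ cM] := @EVT_max R (fun t => `|(f \o clamp01) t|) 0 1 ler01.
  apply: continuous_subspaceT => x; apply: cvg_norm; exact: ac01_clamp_continuous.
exists (`|(f \o clamp01) c| + 1); first by rewrite ltr_wpDl.
by move=> t t01; rewrite -(clamp01_id t01) (le_trans (cM t t01))// lerDl.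
Qed.

Lemma ac01M f g : ac01 f -> ac01 g -> ac01 (fun t => f t * g t).
Proof.
move=> acf acg e e0.
have [M M0 fM] := ac01_bounded acf; have [N N0 gN] := ac01_bounded acg.
have eM0 : 0 < e / (2 * M) by rewrite divr_gt0// mulr_gt0.
have eN0 : 0 < e / (2 * N) by rewrite divr_gt0// mulr_gt0.
have [d1 d10 fd] := acf _ eN0; have [d2 d20 gd] := acg _ eM0.
exists (Num.min d1 d2); first by rewrite lt_min d10.
move=> m a b ab tab; rewrite lt_min => /andP[sd1 sd2].
have F := fd m a b ab tab sd1; have G := gd m a b ab tab sd2.
apply: (@le_lt_trans _ _ (N * \sum_i `|f (b i) - f (a i)| + M * \sum_i `|g (b i) - g (a i)|)).
  rewrite !mulr_sumr -big_split /=; apply: ler_sum => i _.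
  have [/andP[a0 aib] b1] := ab i.
  have -> : f (b i) * g (b i) - f (a i) * g (a i) =
    g (b i) * (f (b i) - f (a i)) + f (a i) * (g (b i) - g (a i)) by ring.
  apply: le_trans (ler_normD _ _) _; rewrite !normrM lerD// ler_wpM2r//.
    by apply: gN; rewrite in_itv /= b1 (le_trans a0).
  by apply: fM; rewrite in_itv /= a0 (le_trans aib).
rewrite (_ : e = N * (e / (2 * N)) + M * (e / (2 * M))).
  by apply: ltrD; rewrite ltr_pM2l.
by field; rewrite !gt_eqF.
Qed.

Lemma itv_oo_meet (a b c d : R) : a < b -> c < d -> a < d -> c < b ->
  `]a, b[ `&` `]c, d[ !=set0.
Proof.
move=> ab cd ad cb; exists ((Num.max a c + Num.min b d) / 2).
by split; rewrite /= in_itv /= maxEle minEle; case: ifP; case: ifP; lra.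
Qed.

(** Monotonicity of [phi] keeps the images of disjoint intervals disjoint, and the Lipschitz bound
    controls their total length. *)
Lemma ac01_comp_homo f phi (K : R) : ac01 f ->
  {in `[0, 1], forall t, phi t \in `[0, 1]} ->
  {in `[0, 1] &, {homo phi : s t / s <= t}} ->
  {in `[0, 1] &, forall s t : R, `|phi t - phi s| <= K * `|t - s|} ->
  ac01 (f \o phi).
Proof.
move=> acf phi01 ndphi phiK e e0; have [d d0 fd] := acf e e0.
exists (d / (`|K| + 1)); first by rewrite divr_gt0// ltr_wpDl.
move=> m a b ab tab sd.
have a01 i : a i \in `[0, 1].
  by have [/andP[a0 aib] b1] := ab i; rewrite in_itv /= a0 (le_trans aib).
have b01 i : b i \in `[0, 1].
  by have [/andP[a0 aib] b1] := ab i; rewrite in_itv /= b1 (le_trans a0).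
apply: (fd m (phi \o a) (phi \o b)) => /=.
- move=> i; have [/andP[a0 aib] b1] := ab i.
  have := phi01 _ (a01 i); have := phi01 _ (b01 i); rewrite !in_itv /= => /andP[_ ->] /andP[-> _].
  by split => //=; exact: ndphi.
- move=> i j _ _ [x []] /=; rewrite !in_itv /= => /andP[ai bi] /andP[aj bj].
  have lt_ab s t : s \in `[0, 1] -> t \in `[0, 1] -> phi s < x -> x < phi t -> s < t.
    move=> s01 t01 sx xt; rewrite ltNge; apply/negP => ts.
    by have := lt_trans sx xt; rewrite ltNge ndphi.
  apply: (tab i j I I); apply: itv_oo_meet.
  - exact: lt_ab (a01 i) (b01 i) ai bi.
  - exact: lt_ab (a01 j) (b01 j) aj bj.
  - exact: lt_ab (a01 i) (b01 j) ai bj.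
  - exact: lt_ab (a01 j) (b01 i) aj bi.
- apply: (@le_lt_trans _ _ ((`|K| + 1) * \sum_i (b i - a i))); last first.
    by rewrite mulrC -ltr_pdivlMr// ltr_wpDl.
  rewrite mulr_sumr; apply: ler_sum => i _; have [/andP[a0 aib] b1] := ab i.
  apply: (le_trans (ler_norm _)); apply: (le_trans (phiK _ _ _ _)) => //.
  rewrite ger0_norm ?subr_ge0// ler_wpM2r ?subr_ge0//.
  by apply: le_trans (ler_norm K) _; rewrite lerDl.
Qed.

Lemma ac01_onem f : ac01 f -> ac01 (fun t => f (1 - t)).
Proof.
move=> acf e e0; have [d d0 fd] := acf e e0; exists d => // m a b ab tab sd.
under eq_bigr do rewrite distrC.
apply: (fd m (fun i => 1 - b i) (fun i => 1 - a i)) => [i||].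
- by have [/andP[a0 aib] b1] := ab i; split; [apply/andP; split|]; lra.
- move=> i j _ _ [x []] /=; rewrite !in_itv /= => /andP[ai bi] /andP[aj bj].
  by apply: (tab i j I I); apply: itv_oo_meet; lra.
- by under eq_bigr do rewrite opprB addrC addrA subrK.
Qed.

Lemma ac01_affine f (al be : R) : ac01 f -> al \in `[0, 1] -> al + be \in `[0, 1] ->
  ac01 (fun t => f (al + be * t)).
Proof.
move=> acf; have pos g (a b : R) : ac01 g -> 0 <= b -> a \in `[0, 1] -> a + b \in `[0, 1] ->
    ac01 (fun t => g (a + b * t)).
  move=> acg b0; rewrite !in_itv /= => /andP[a0 a1] /andP[_ ab].
  apply: (@ac01_comp_homo g (fun t => a + b * t) b) => //.
  - move=> t; rewrite !in_itv /= => /andP[t0 t1]; apply/andP; split.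
      by rewrite addr_ge0// mulr_ge0.
    by apply: le_trans ab; rewrite lerD2l ler_piMr.
  - by move=> s t _ _ st; rewrite lerD2l ler_wpM2l.
  - by move=> s t _ _; rewrite opprD addrACA subrr add0r -mulrBr normrM ger0_norm.
have [b0|b0 a01 ab01] := leP 0 be; first exact: pos.
rewrite (_ : (fun t => f (al + be * t)) = (fun t => (fun s => f (al + be + - be * s)) (1 - t))).
  apply: (@ac01_onem (fun s => f (al + be + - be * s))); apply: pos => //; first by rewrite oppr_ge0 ltW.
  by rewrite addrK.
by apply/funext => t /=; congr f; ring.
Qed.

End AC.

(** * Derivatives and the integral bound for absolutely continuous functions *)

Section Derivatives.
Variable R : realType.
Implicit Types f g k : R -> R.

Lemma is_deriveP f (t df : R) : is_derive t 1 f df <->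
  forall e : R, 0 < e -> exists2 d : R, 0 < d & forall h : R, `|h| < d ->
    `|f (t + h) - f t - h * df| <= e * `|h|.
Proof.
have -> : is_derive t 1 f df <->
    (fun h => h^-1 *: (f (h *: 1 + t) - f t)) @ 0^' --> df.
  split=> [fdf|fdf]; first by rewrite -(@derive_val _ _ _ _ _ _ _ fdf); exact: ex_derive.
  have df' : derivable f t 1 by apply/cvg_ex; exists df.
  by split=> //; apply: cvg_lim.
split=> [/cvgrPdist_le fdf e e0|fdf].
  have [d /= d0 H] := fdf e e0; exists d => // h hd.
  have [->|h0] := eqVneq h 0; first by rewrite addr0 subrr mul0r subrr normr0 mulr0.
  have := H h; rewrite /= sub0r normrN => /(_ hd h0).
  rewrite [h *: 1]mulr1 [_ *: _]mulrC [h + t]addrC => H1.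
  rewrite -[X in `|X|](_ : (- h) * (df - (f (t + h) - f t) / h) = _); last by field.
  by rewrite normrM normrN mulrC ler_wpM2r.
apply/cvgrPdist_le => e e0; have [d d0 H] := fdf e e0.
exists d => //= h; rewrite /= sub0r normrN => hd h0.
rewrite [h *: 1]mulr1 [_ *: _]mulrC [h + t]addrC.
rewrite -(ler_pM2r (_ : 0 < `|h|)) ?normr_gt0// -normrM.
apply: le_trans (H h hd); rewrite -normrN le_eqVlt; apply/orP; left; apply/eqP; congr `|_|.
by field.
Qed.

Lemma straddle_derive k (t dk : R) : is_derive t 1 k dk -> dk <= 0 -> straddle_le0 k t.
Proof.
move=> /is_deriveP kdk dk0 e e0; have [d d0 H] := kdk e e0.
exists d => // x y xt ty yx.
have := H (x - t); rewrite ler0_norm ?subr_le0// opprB => /(_ _)/wrap[]; first lra.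
rewrite ler_norml => /andP[+ _].
have := H (y - t); rewrite ger0_norm ?subr_ge0// => /(_ _)/wrap[]; first lra.
rewrite ler_norml => /andP[_].
rewrite [t + (y - t)]addrC [t + (x - t)]addrC !subrK => ky kx.
have y0 : (y - t) * dk <= 0 by rewrite mulr_ge0_le0// subr_ge0.
have x0 : (t - x) * dk <= 0 by rewrite mulr_ge0_le0// subr_ge0.
have -> : e * (y - x) = e * (y - t) + e * (t - x) by ring.
rewrite (_ : (t - x) * dk = - ((x - t) * dk)) in x0; last by ring.
clear -ky kx y0 x0; lra.
Qed.


Local Notation leb := (@lebesgue_measure R).

(** Both [f] and [- f] are compared with the primitive [G] of [g], whose derivative is [g] almost
    everywhere; [ac01_ae_le] turns the pointwise bound on derivatives into a bound on increments. *)
Lemma ac01_le_integral f g : ac01 f -> measurable_fun [set: R] g ->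
  (forall t, 0 <= g t) -> leb.-integrable `[0, 1] (EFin \o g) ->
  {ae leb, forall t : R, t \in `]0, 1[ ->
     exists2 df, is_derive t 1 f df & `|df| <= g t} ->
  forall t : R, t \in `[0, 1] ->
    (`|f t - f 0|%:E <= \int[leb]_(s in `[0%R, t]) (g s)%:E)%E.
Proof.
move=> acf mg g0 ig fdf t t01.
pose g1 := g \_ `[0, 1].
have ig1 (D : set R) : measurable D -> leb.-integrable D (EFin \o g1).
  move=> mD; apply: (@integrableS _ _ _ _ setT) => //.
  by rewrite /g1 -restrict_EFin -integrable_mkcond.
pose G (x : R) := \int[leb]_(s in `[0, x]) g1 s.
have g10 x : 0 <= g1 x by rewrite /g1 patchE; case: ifP.
have dG := @FTC1 R g1 (BLeft 0) (fun y => ig1 _ (measurable_itv _)) (open_integrable_locally openT (ig1 _ measurableT)).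
have GE x : ((G x)%:E = \int[leb]_(s in `[0%R, x]) (g1 s)%:E)%E.
  rewrite /G /Rintegral fineK//; apply: integrable_fin_num => //; exact: ig1.
have Gnd : {in `[0, 1] &, {homo G : x y / x <= y}}.
  move=> x y _ _ xy; rewrite -lee_fin !GE; apply: ge0_subset_integral => //.
  - exact: (measurable_int _ (ig1 _ (measurable_itv _))).
  - by move=> s _; rewrite lee_fin.
  - by move=> s /=; rewrite !in_itv /= => /andP[-> /= /le_trans]; exact.
have G0 : G 0 = 0.
  by apply: EFin_inj; rewrite GE set_itv1 integral_set1.
have Gt : ((G t)%:E = \int[leb]_(s in `[0%R, t]) (g s)%:E)%E.
  rewrite GE; apply: eq_integral => s; rewrite inE /= in_itv /= => /andP[s0 st].
  move: t01; rewrite in_itv /= => /andP[_ t1].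
  by rewrite /g1 patchE ifT// inE /= in_itv /= s0 (le_trans st).
have n1 (x : R) : leb.-negligible [set x] by apply/negligibleP => //; exact: lebesgue_measure_set1.
pose good (s : R) : Prop := s \in `[0, 1] ->
     (s \in `]0, 1[) /\ ((exists2 df, is_derive s 1 f df & `|df| <= g s) /\
       (derivable G s 1 /\ G^`()%classic s = g1 s)).
have [N [mN N0 HN]] : leb.-negligible (~` good).
  have := negligibleU (negligibleU fdf dG) (negligibleU (n1 0) (n1 1)).
  apply: negligibleS.
    move=> x /= /not_implyP[x01 H]; apply: contrapT => /not_orP[/not_orP[/contrapT H1 /contrapT H2] /not_orP[x0 x1]].
    apply: H; have xoo : x \in `]0, 1[.
      move: x01; rewrite !in_itv /= !lt_neqAle => /andP[-> ->]; rewrite !andbT.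
      by apply/andP; split; apply/eqP => // xe; apply: x0.
    split=> //; split; first exact: H1.
    by apply: H2; rewrite lte_fin; move: xoo; rewrite in_itv => /andP[].
have key h : ac01 h -> (forall s dh : R, is_derive s 1 f dh -> exists2 dh' : R, is_derive s 1 h dh' & dh' <= `|dh|) ->
    h t - h 0 <= G t.
  move=> ach dh; rewrite (_ : G t = G t - G 0); last by rewrite G0 subr0.
  apply: (@ac01_ae_le _ h G N) => // s s01 /(contra_notP (HN s)).
  move=> /(_ s01)[s01o [[df dfs dfg] [dGs Gs]]].
  have [dh' h' hle] := dh s df dfs.
  have G' : is_derive s 1 G (g s).
    split=> //; rewrite -derive1E Gs /g1 patchE ifT//.
    by rewrite inE.
  apply: (@straddle_derive (fun x => h x - G x) s (dh' - g s) (@is_deriveB _ _ _ h G _ _ _ _ h' G')).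
  by rewrite subr_le0 (le_trans hle).
rewrite -Gt lee_fin ler_norml; apply/andP; split.
  rewrite lerNl opprB.
  have := key (fun s => - f s); rewrite opprK addrC; apply.
    have -> : (fun s => - f s) = (fun s => (-1) * f s) by apply/funext => s; rewrite mulN1r.
    apply: ac01M => //; apply: (@ac01_lip _ _ 0) => s r _ _; rewrite subrr normr0 mul0r//.
  by move=> s dh fdh; exists (- dh); [exact: (@is_deriveN _ _ _ f _ _ _ fdh)|rewrite -normrN ler_norm].
by apply: key => // s dh fdh; exists dh => //; exact: ler_norm.
Qed.

End Derivatives.

Section AlmostEverywhere.
Context d (T : measurableType d) (R : realType) (mu : {measure set T -> \bar R}).
Implicit Types P Q : T -> Prop.

Lemma aeS P Q : (forall x, P x -> Q x) -> {ae mu, forall x, P x} -> {ae mu, forall x, Q x}.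
Proof. by move=> PQ; apply: negligibleS => x /= + /PQ; exact. Qed.

Lemma aeI P Q : {ae mu, forall x, P x} -> {ae mu, forall x, Q x} ->
  {ae mu, forall x, P x /\ Q x}.
Proof.
move=> aeP aeQ; apply: negligibleS (negligibleU aeP aeQ) => x /=.
by move=> nPQ; apply: contrapT => /not_orP[/contrapT ? /contrapT ?]; exact: nPQ.
Qed.

Lemma aeW P : (forall x, P x) -> {ae mu, forall x, P x}.
Proof.
by move=> HP; apply: negligibleS (negligible_set0 mu) => x /=; apply; exact: HP.
Qed.

End AlmostEverywhere.

(** * Integrals of functions that need not be measurable *)

Section NonMeasurable.
Context d (T : measurableType d) (R : realType) (mu : {measure set T -> \bar R}).
Implicit Types (f g : T -> \bar R) (D : set T).
Local Open Scope ereal_scope.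
Import HBNNSimple.

(* The integral of a nonnegative function is a supremum over the simple functions
   below it, and restricting those to the complement of a null set does not change
   their integrals. *)
Lemma ge0_ae_le_nmintegral f g : (forall x, 0 <= f x) -> (forall x, 0 <= g x) ->
  {ae mu, forall x, f x <= g x} -> \int[mu]_x f x <= \int[mu]_x g x.
Proof.
move=> f0 g0 [N [mN N0 fgN]].
rewrite !ge0_integralTE//; apply: ge_ereal_sup => _ [h /= hf <-].
apply: ereal_sup_ubound; exists (proj_nnsfun h (measurableC mN)) => /=.
  move=> x; rewrite mindicE; have [|xN] := boolP (x \in ~` N).
    rewrite inE /= mulr1 => Nx; apply: le_trans (hf x) _.
    by apply: contrapT => /fgN.
  by rewrite mulr0.
rewrite -!integralT_nnsfun; apply: ge0_ae_eq_integral => //.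
- exact/measurable_EFinP.
- exact/measurable_EFinP.
- by move=> x _; rewrite lee_fin.
- by move=> x _; rewrite lee_fin.
- exists N; split => // x /= /not_implyP[_ H]; apply: contrapT => Nx; apply: H.
  by rewrite mindicE mem_set// mulr1.
Qed.

(** This is the tool for integrands coming from [derive1] or from a selection: they can be replaced
    by Borel ones that agree almost everywhere. *)
Lemma ae_eq_nmintegral D f g : {ae mu, forall x, D x -> f x = g x} ->
  \int[mu]_(x in D) f x = \int[mu]_(x in D) g x.
Proof.
move=> fg; rewrite integral_mkcond [RHS]integral_mkcond.
have {}fg : {ae mu, forall x, (f \_ D) x = (g \_ D) x}.
  by apply: filterS fg => x fgx; rewrite !patchE; case: ifP => // /set_mem/fgx.
rewrite [LHS]integralE [RHS]integralE; congr (_ - _);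
  by apply/eqP; rewrite eq_le; apply/andP; split; apply: ge0_ae_le_nmintegral => //;
    apply: filterS fg => x fgx; rewrite ?funeposE ?funenegE fgx.
Qed.

Lemma ge0_ae_le_nmintegral_in D f g :
  (forall x, D x -> 0 <= f x) -> (forall x, D x -> 0 <= g x) ->
  {ae mu, forall x, D x -> f x <= g x} ->
  \int[mu]_(x in D) f x <= \int[mu]_(x in D) g x.
Proof.
move=> f0 g0 fg; rewrite integral_mkcond [leRHS]integral_mkcond.
apply: ge0_ae_le_nmintegral.
- by move=> x; rewrite patchE; case: ifP => // /set_mem/f0.
- by move=> x; rewrite patchE; case: ifP => // /set_mem/g0.
- by apply: filterS fg => x fgx; rewrite !patchE; case: ifP => // /set_mem/fgx.
Qed.

End NonMeasurable.

(** * Affine changes of variable for Lebesgue measure *)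

Section AffineChange.
Variable R : realType.
Local Notation leb := (@lebesgue_measure R).
Implicit Types al be : R.

Definition affine al be : measurableTypeR R -> measurableTypeR R := fun t : R => al + be * t.

Lemma measurable_affine al be : measurable_fun setT (affine al be).
Proof. by apply: measurable_funD => //; apply: measurable_funM. Qed.

(** For a positive slope, the rescaled push-forward has the right value on half-open intervals, so
    it is Lebesgue measure by uniqueness. A negative slope is reduced to this by reflection. *)
Lemma lebesgue_measure_affine al be (A : set R) : be != 0 -> measurable A ->
  leb (affine al be @^-1` A) = (`|be|^-1%:E * leb A)%E.
Proof.
have pos a b (B : set R) : 0 < b -> measurable B ->
    leb (affine a b @^-1` B) = (b^-1%:E * leb B)%E.
  move=> b0 mB.
  have bnn : 0 <= b by exact: ltW.
  pose m0 : {measure set (measurableTypeR R) -> \bar R} :=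
    mscale (NngNum bnn) (pushforward leb (affine a b)).
  pose m := m0 (measurable_affine a b).
  have mE X : m X = (b%:E * leb (affine a b @^-1` X))%E by [].
  have := @lebesgue_measure_unique R m.
  move=> /(_ _ B mB) ->; last first.
    move=> _ [[u v] _ <-]; rewrite mE /=.
    have -> : affine a b @^-1` `]u, v] = `](u - a) / b, (v - a) / b]%classic.
      apply/seteqP; split => x /=; rewrite !in_itv /= /affine ltr_pdivrMr// ler_pdivlMr//;
        rewrite [x * b]mulrC => /andP[? ?]; apply/andP; split; lra.
    rewrite !lebesgue_measure_itv /= !lte_fin ltr_pM2r ?invr_gt0// ltrD2r.
    case: ifPn => _; last by rewrite mule0.
    by rewrite -!EFinD -EFinM; congr EFin; field; rewrite gt_eqF.
  by rewrite mE muleA -EFinM mulVf ?gt_eqF// mul1e.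
move=> be0 mA; have [b0|b0|b0] := ltgtP be 0; last by rewrite b0 eqxx in be0.
  rewrite (_ : affine al be @^-1` A = (-%R : R -> measurableTypeR R) @^-1` (affine al (- be) @^-1` A)); last first.
    by apply/seteqP; split => x; rewrite /preimage/= /affine mulrNN.
  rewrite -[LHS]/(pushforward leb (-%R : R -> measurableTypeR R) (affine al (- be) @^-1` A)).
  rewrite lebesgue_measureN ?pos ?oppr_gt0 ?ltr0_norm//.
  by rewrite -[X in measurable X]setTI; exact: measurable_affine.
by rewrite pos// gtr0_norm.
Qed.

Lemma negligible_affine al be (A : set R) : be != 0 -> leb.-negligible A ->
  leb.-negligible (affine al be @^-1` A).
Proof.
move=> be0 [N [mN N0 AN]]; exists (affine al be @^-1` N); split.
- by rewrite -[X in measurable X]setTI; exact: measurable_affine.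
- by rewrite lebesgue_measure_affine// -[X in (_ * X)%E]/(leb N) N0 mule0.
- by move=> x /AN.
Qed.

Lemma ge0_integral_affine al be (D : set R) (g : R -> R) : be != 0 ->
  measurable D -> measurable_fun setT g -> (forall t, 0 <= g t) ->
  (\int[leb]_(t in affine al be @^-1` D) (`|be| * g (affine al be t))%:E =
   \int[leb]_(t in D) (g t)%:E)%E.
Proof.
move=> be0 mD mg g0.
have mD' : measurable (affine al be @^-1` D).
  by rewrite -[X in measurable X]setTI; exact: measurable_affine.
have mge : measurable_fun D (EFin \o g) by apply/measurable_EFinP; exact: measurable_funTS.
under eq_integral do rewrite EFinM.
rewrite ge0_integralZl//; last 2 first.
- apply/measurable_EFinP; apply: measurable_funTS.
  by apply: (measurableT_comp mg); exact: measurable_affine.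
- by move=> t _; rewrite lee_fin.
have := @ge0_integral_pushforward _ _ _ _ R _ (@measurable_affine al be) leb _ _ mD mge.
move=> <-; last by move=> t _; rewrite lee_fin.
have bnn : 0 <= `|be| by [].
pose m0 : {measure set (measurableTypeR R) -> \bar R} :=
  mscale (NngNum bnn) (pushforward leb (affine al be)).
pose m := m0 (@measurable_affine al be).
transitivity (\int[m]_(t in D) (g t)%:E)%E.
  by rewrite /m /m0 ge0_integral_mscale//= => t _; rewrite lee_fin.
apply: eq_measure_integral => A mA _.
rewrite /m /m0 /= /mscale /= /pushforward lebesgue_measure_affine//.
by rewrite muleA -EFinM divff ?normr_eq0// mul1e.
Qed.

End AffineChange.

(** * Horizontal curves *)

Section Velocity.
Context {R : realType} {n : nat}.
Local Notation H := (heis R n).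
Local Notation leb := (@lebesgue_measure R).
Implicit Types (x y : H) (c e : 'rV[R]_(n + n)) (sigma : R -> H).

Lemma hidxP (i : 'I_(n + n).+1) : (exists j, i = hidx j) \/ i = ord_max.
Proof.
case: (unliftP ord_max i) => [j ->|->]; last by right.
by left; exists j; apply/val_inj; rewrite /= /bump leqNgt ltn_ord.
Qed.

Lemma hidx_neq_max (j : 'I_(n + n)) : hidx j != ord_max.
Proof. by rewrite -val_eqE /= neq_ltn ltn_ord. Qed.

Lemma hidx_inj : injective (@hidx n).
Proof. by move=> i j /(congr1 val) /= /val_inj. Qed.

Lemma heis_eq x y : (forall j, x 0 (hidx j) = y 0 (hidx j)) ->
  x 0 ord_max = y 0 ord_max -> x = y.
Proof. by move=> xy xym; apply/rowP => i; have [[j ->]|->] := hidxP i. Qed.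

Definition hor x : 'rV[R]_(n + n) := \row_j x 0 (hidx j).

Lemma horE x j : hor x 0 j = x 0 (hidx j). Proof. by rewrite mxE. Qed.

(** The standard symplectic form. Half of it is the vertical term of the group law, and also the
    vertical speed of a horizontal curve ([frame_max]). *)
Definition omega c e : R :=
  \sum_(k < n) (c 0 (lshift n k) * e 0 (rshift n k) - c 0 (rshift n k) * e 0 (lshift n k)).

Lemma omegaDl c1 c2 e : omega (c1 + c2) e = omega c1 e + omega c2 e.
Proof. by rewrite /omega -big_split; apply: eq_bigr => k _; rewrite !mxE /=; ring. Qed.

Lemma omegaZl (a : R) c e : omega (a *: c) e = a * omega c e.
Proof. by rewrite /omega mulr_sumr; apply: eq_bigr => k _; rewrite !mxE /=; ring. Qed.

Lemma omegaC c e : omega c e = - omega e c.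
Proof. by rewrite /omega -sumrN; apply: eq_bigr => k _; ring. Qed.

Lemma omegaDr c e1 e2 : omega c (e1 + e2) = omega c e1 + omega c e2.
Proof. by rewrite omegaC omegaDl opprD -!omegaC. Qed.

Lemma omegaZr (a : R) c e : omega c (a *: e) = a * omega c e.
Proof. by rewrite omegaC omegaZl -mulrN -omegaC. Qed.

Lemma omegaNl c e : omega (- c) e = - omega c e.
Proof. by rewrite -scaleN1r omegaZl mulN1r. Qed.

Lemma omegaNr c e : omega c (- e) = - omega c e.
Proof. by rewrite -scaleN1r omegaZr mulN1r. Qed.

Lemma omega_self c : omega c c = 0.
Proof. by rewrite /omega big1// => k _; ring. Qed.

Lemma frame_hidx c x (j : 'I_(n + n)) : (c *m frame x) 0 (hidx j) = c 0 j.
Proof.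
rewrite mxE (bigD1 j)//= big1 ?addr0 => [|i ij]; rewrite mxE /Xfield; last first.
  case: fintype.split => k; rewrite !mxE eqxx /= (inj_eq hidx_inj) eq_sym (negPf ij)
    (negPf (hidx_neq_max _)) /= mulr0 ?subr0 ?addr0 mulr0//.
by case: fintype.split => k; rewrite !mxE !eqxx /= (negPf (hidx_neq_max _)) mulr0 ?subr0 ?addr0 mulr1.
Qed.

Lemma frame_max c x : (c *m frame x) 0 ord_max = 2^-1 * omega (hor x) c.
Proof.
rewrite mxE big_split_ord /= /omega mulr_sumr -big_split /=; apply: eq_bigr => k _.
rewrite !mxE /Xfield.
have -> : fintype.split (lshift n k) = inl k := unsplitK (inl k).
have -> : fintype.split (rshift n k) = inr k := unsplitK (inr k).
by rewrite !mxE !eqxx /= ![ord_max == _]eq_sym !(negPf (hidx_neq_max _)) /=; lra.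
Qed.

Definition enorm c : R := Num.sqrt (\sum_j c 0 j ^+ 2).

Lemma hnorm_frame x c : hnorm x (c *m frame x) = enorm c.
Proof.
by rewrite /hnorm /hinner /enorm hcoord_frame; congr Num.sqrt; apply: eq_bigr => j _; rewrite expr2.
Qed.

(** Carrying the frame coordinates [c] of the velocity keeps the pseudo-inverse in [hcoord] out of
    the computations. *)
Definition has_vel sigma (t : R) c : Prop :=
  derivable sigma t 1 /\ derive1 sigma t = c *m frame (sigma t).

Lemma has_vel_speed sigma t c : has_vel sigma t c -> speed sigma t = enorm c.
Proof. by move=> [_ st]; rewrite /speed st hnorm_frame. Qed.

Lemma has_vel_hcoord sigma t c : has_vel sigma t c ->
  hcoord (sigma t) (derive1 sigma t) = c.
Proof. by move=> [_ ->]; rewrite hcoord_frame. Qed.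

Lemma has_vel_horizontal sigma t c : has_vel sigma t c ->
  in_horizontal (sigma t) (derive1 sigma t).
Proof. by move=> [_ ->]; rewrite /in_horizontal submxMl. Qed.

Lemma horizontal_has_vel sigma t : derivable sigma t 1 ->
  in_horizontal (sigma t) (derive1 sigma t) ->
  has_vel sigma t (hcoord (sigma t) (derive1 sigma t)).
Proof. by move=> ds hs; split => //; rewrite hcoordK. Qed.

Lemma is_derive_rowP m (f : R -> 'rV[R]_m) (t : R) (v : 'rV[R]_m) :
  (derivable f t 1 /\ derive1 f t = v) <->
  (forall i, is_derive t 1 (fun s => f s 0 i) (v 0 i)).
Proof.
split=> [[df fv] i|fv].
  split; first by have /derivable_mxP := df; exact.
  by rewrite -fv derive1E derive_mx// mxE.
have df : derivable f t 1.
  by apply/derivable_mxP => i j; rewrite ord1; case: (fv j).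
by split=> //; apply/rowP => i; rewrite derive1E derive_mx// mxE; case: (fv i).
Qed.

Lemma has_velP sigma t c : has_vel sigma t c <->
  (forall j, is_derive t 1 (fun s => sigma s 0 (hidx j)) (c 0 j)) /\
  is_derive t 1 (fun s => sigma s 0 ord_max) (2^-1 * omega (hor (sigma t)) c).
Proof.
split=> [/is_derive_rowP sc|[sc sm]].
  split=> [j|]; first by have := sc (hidx j); rewrite frame_hidx.
  by have := sc ord_max; rewrite frame_max.
apply/is_derive_rowP => i; have [[j ->]|->] := hidxP i; first by rewrite frame_hidx.
by rewrite frame_max.
Qed.

Lemma has_vel_near sigma tau t c : (\forall s \near t, sigma s = tau s) ->
  has_vel sigma t c -> has_vel tau t c.
Proof.
move=> st [ds sc]; have st' : sigma t = tau t := nbhs_singleton st.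
split; first exact: near_eq_derivable ds.
by rewrite -st' -sc !derive1E; apply/esym/near_eq_derive.
Qed.

Lemma has_vel_affine sigma (al be t : R) c : has_vel sigma (al + be * t) c ->
  has_vel (fun s => sigma (al + be * s)) t (be *: c).
Proof.
move=> /has_velP[sc sm].
have daff : is_derive t 1 (fun s : R => al + be * s) be.
  apply/is_deriveP => e e0; exists 1 => // h _.
  by rewrite (_ : _ - _ - _ = 0) ?normr0 ?mulr_ge0// ?ltW//; ring.
apply/has_velP; split=> [j|].
  by rewrite mxE [be * c 0 j]mulrC; exact: (@is_derive1_comp _ (fun s => sigma s 0 (hidx j)) (fun s => al + be * s) t _ _ (sc j) daff).
rewrite omegaZr mulrCA [be * (_ * _)]mulrC.
exact: (@is_derive1_comp _ (fun s => sigma s 0 ord_max) (fun s => al + be * s) t _ _ sm daff).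
Qed.

End Velocity.

Section HCurves.
Context {R : realType} {n : nat}.
Local Notation H := (heis R n).
Local Notation leb := (@lebesgue_measure R).
Implicit Types (x y : H) (c : R -> 'rV[R]_(n + n)) (sigma tau : R -> H).

Lemma mx_norm_sum m (v : 'rV[R]_m) : `|v| <= \sum_i `|v 0 i|.
Proof.
have -> : `|v| = mx_norm v by [].
rewrite mx_normrE; elim/big_ind : _ => [|a b ha hb|[i j] _]; first exact: sumr_ge0.
  by rewrite ge_max ha.
by rewrite (bigD1 j)//= ord1 lerDl sumr_ge0.
Qed.

Lemma ler_coord m (v : 'rV[R]_m) i : `|v 0 i| <= `|v|.
Proof.
have -> : `|v| = mx_norm v by [].
by rewrite mx_normrE; apply: (le_bigmax _ _ (0, i)).
Qed.

Lemma abs_continuous01P sigma :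
  abs_continuous01 sigma <-> forall i, ac01 (fun t => sigma t 0 i).
Proof.
split=> [acs i e e0|acs e e0].
  have [d d0 H] := acs e e0; exists d => // m a b ab tab sd.
  apply: le_lt_trans (H m a b ab tab sd); apply: ler_sum => k _.
  by have := ler_coord (sigma (b k) - sigma (a k)) i; rewrite !mxE.
pose N : R := ((n + n).+1)%:R.
have eN : 0 < e / N by rewrite divr_gt0// ltr0n.
have /choice[d dP] : forall i : 'I_(n + n).+1, exists d, 0 < d /\
    forall (m : nat) (a b : 'I_m -> R),
      (forall i, 0 <= a i <= b i /\ b i <= 1) ->
      trivIset [set: 'I_m] (fun i => `]a i, b i[%classic) ->
      \sum_i (b i - a i) < d ->
      \sum_k `|sigma (b k) 0 i - sigma (a k) 0 i| < e / N.
  by move=> i; have [d d0 H] := acs i _ eN; exists d.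
exists (\big[Num.min/1]_i d i).
  by elim/big_ind : _ => [//|a b a0 b0|i _]; [rewrite lt_min a0|case: (dP i)].
move=> m a b ab tab sd.
apply: (@le_lt_trans _ _ (\sum_i \sum_k `|sigma (b k) 0 i - sigma (a k) 0 i|)).
  rewrite exchange_big; apply: ler_sum => k _; apply: le_trans (mx_norm_sum _) _.
  by apply: ler_sum => i _; rewrite !mxE.
apply: (@lt_le_trans _ _ (\sum_(i < (n + n).+1) e / N)); last first.
  by rewrite sumr_const card_ord -[_ *+ _]mulr_natr divfK ?lt0r_neq0// ltr0n.
apply: ltr_sum => [|i _]; first by apply/hasP; exists ord0 => //; rewrite mem_index_enum.
have [_ H] := dP i; apply: H ab tab _; apply: lt_le_trans sd _.
exact: bigmin_le_cond.
Qed.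

(* Length integrals along [sigma] become integrals of Borel functions once a Borel
   velocity [c] is fixed; [derive1 sigma] itself need not be measurable. *)
Definition hcurve sigma c : Prop :=
  [/\ abs_continuous01 sigma, forall j, measurable_fun setT (fun t => c t 0 j) &
      {ae leb, forall t : R, t \in `]0, 1[ -> has_vel sigma t (c t)}].

(** Two points are negligible. At the endpoints a two-sided derivative would depend on the
    meaningless values of a curve outside [0,1], so velocities are only prescribed inside. *)
Lemma ae_itv_oo_cc (P : R -> Prop) :
  {ae leb, forall t : R, t \in `]0, 1[ -> P t} -> {ae leb, forall t : R, t \in `[0, 1] -> P t}.
Proof.
have n1 (x : R) : leb.-negligible [set x] by apply/negligibleP => //; exact: lebesgue_measure_set1.
move=> aeP; have := negligibleU aeP (negligibleU (n1 0) (n1 1)).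
apply: negligibleS => t /= /not_implyP[t01 Pt].
apply: contrapT => /not_orP[/contrapT H /not_orP[t0 t1]]; apply: Pt; apply: H.
move: t01; rewrite !in_itv /= !lt_neqAle => /andP[-> ->]; rewrite !andbT.
by apply/andP; split; apply/eqP => // te; apply: t0.
Qed.

Lemma enorm_ge0 (v : 'rV[R]_(n + n)) : 0 <= enorm v. Proof. exact: sqrtr_ge0. Qed.

Lemma enormZ (a : R) (v : 'rV[R]_(n + n)) : enorm (a *: v) = `|a| * enorm v.
Proof.
rewrite /enorm -sqrtr_sqr -sqrtrM ?sqr_ge0// mulr_sumr; congr Num.sqrt.
by apply: eq_bigr => j _; rewrite mxE exprMn.
Qed.

Lemma measurable_enorm d (T : measurableType d) (c : T -> 'rV[R]_(n + n)) :
  (forall j, measurable_fun setT (fun t => c t 0 j)) -> measurable_fun setT (fun t => enorm (c t)).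
Proof.
move=> mc; apply: measurableT_comp => //.
  by apply: continuous_measurable_fun => t; exact: sqrt_continuous.
by apply: measurable_sum => j; exact: measurable_funX.
Qed.

Lemma hcurve_length sigma c : hcurve sigma c ->
  lengthSR sigma = (\int[leb]_(t in `[0%R, 1%R]) (enorm (c t))%:E)%E.
Proof.
move=> [_ _ /ae_itv_oo_cc vc]; apply: ae_eq_nmintegral.
by apply: aeS vc => t H t01; rewrite (has_vel_speed (H t01)).
Qed.

Lemma hcurve_horizontal sigma c : hcurve sigma c -> horizontal sigma.
Proof.
move=> [acs _ /ae_itv_oo_cc vc]; split => //.
by apply: aeS vc => t H t01; split; [case: (H t01)|exact: has_vel_horizontal (H t01)].
Qed.

Lemma near_clamp01 (t : R) : t \in `]0, 1[ -> \forall s \near t, clamp01 s = s.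
Proof.
rewrite in_itv /= => /andP[t0 t1].
have : \forall s \near t, s \in `]0, 1[ by apply: near_in_itvoo; rewrite in_itv /= t0.
apply: filterS => s; rewrite in_itv /= => /andP[s0 s1]; apply: clamp01_id.
by rewrite in_itv /= !ltW.
Qed.

(** The upper limit of the difference quotients with step [k.+1%:R^-1] of the clamped function is
    Borel, since these are continuous, and it equals the derivative wherever that exists. Near an
    interior point clamping changes nothing. *)
Lemma ac01_borel_derive (f : R -> R) : ac01 f -> exists2 g : R -> R,
  measurable_fun setT g & forall t df : R, t \in `]0, 1[ -> is_derive t 1 f df -> g t = df.
Proof.
move=> acf; have cf := ac01_clamp_continuous acf.
pose q (k : nat) (t : R) : R := k.+1%:R * (f (clamp01 (t + k.+1%:R^-1)) - f (clamp01 t)).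
exists (fun t => fine (limn_esup (fun k => (q k t)%:E))).
  apply: (measurableT_comp (fine_measurable measurableT)) => //.
  apply: measurable_fun_limn_esup => k; apply/measurable_EFinP; rewrite /q.
  apply: continuous_measurable_fun => t.
  apply: cvgM; first exact: cvg_cst.
  apply: cvgB; last exact: cf.
  apply: (@continuous_comp _ _ _ (fun x : R => x + k.+1%:R^-1) (f \o @clamp01 R)); last exact: cf.
  by apply: cvgD; [exact: cvg_id|exact: cvg_cst].
move=> t df t01 fdf.
suff qdf : (q k t)%:E @[k --> \oo] --> df%:E.
  by rewrite is_cvg_limn_esupE; [rewrite (cvg_lim _ qdf)|apply/cvg_ex; exists df%:E].
apply: cvg_EFin; first by apply: nearW.
have [d /= d0 dc] := near_clamp01 t01.
have {}fdf := (is_deriveP f t df).1 fdf.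
apply/cvgrPdist_le => e e0; have [d1 d10 H] := fdf e e0.
have dd1 : 0 < Num.min d d1 by rewrite lt_min d0.
have [N _ HN] := near_infty_natSinv_lt (PosNum dd1).
exists N => // k /HN /= kd.
move: (kd); rewrite lt_min => /andP[kd0 kd1].
have k0 : 0 < k.+1%:R^-1 :> R by rewrite invr_gt0.
rewrite /q /= dc; last by rewrite /= opprD addrA subrr sub0r normrN gtr0_norm.
rewrite dc; last by rewrite /= subrr normr0.
have := H k.+1%:R^-1; rewrite gtr0_norm// => /(_ kd1).
rewrite -(ler_pM2l (_ : 0 < k.+1%:R))// -[X in X * `|_|](gtr0_norm (_ : 0 < k.+1%:R))// -normrM.
rewrite mulrCA mulfV// mulr1; apply: le_trans; rewrite -normrN le_eqVlt; apply/orP; left; apply/eqP.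
congr `|_|; have : k.+1%:R != 0 :> R by rewrite pnatr_eq0.
by move: (k.+1%:R) => K K0; field.
Qed.

(** The frame coordinates of a horizontal vector are its first 2n Cartesian coordinates, so Borel
    versions of the derivatives of these coordinates form a Borel velocity. *)
Lemma horizontal_hcurve sigma : horizontal sigma -> exists c, hcurve sigma c.
Proof.
move=> [acs hs].
have /choice[g gP] : forall j : 'I_(n + n), exists g : R -> R, measurable_fun setT g /\
    forall t df : R, t \in `]0, 1[ -> is_derive t 1 (fun s => sigma s 0 (hidx j)) df -> g t = df.
  by move=> j; have [g mg gd] := ac01_borel_derive ((abs_continuous01P sigma).1 acs (hidx j)); exists g.
exists (fun t => \row_j g j t); split => //.
  by move=> j; under eq_fun do rewrite mxE; case: (gP j).
apply: aeS hs => t H t01.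
have /H[ds hst] : t \in `[0, 1] by move: t01; rewrite !in_itv /= => /andP[/ltW-> /ltW->].
have hv := horizontal_has_vel ds hst.
have -> : \row_j g j t = hcoord (sigma t) (derive1 sigma t) => //.
apply/rowP => j; rewrite mxE; have [_ Hg] := gP j.
by apply: Hg => //; have /has_velP[] := hv.
Qed.

Lemma has_vel_enorm_horizontal sigma c : hcurve sigma c ->
  {ae leb, forall t : R, t \in `[0, 1] -> speed sigma t = enorm (c t)}.
Proof.
by move=> [_ _ /ae_itv_oo_cc]; apply: aeS => t H /H/has_vel_speed.
Qed.

End HCurves.

(** * Reparametrization and concatenation of horizontal curves *)

Section CurveOperations.
Context {R : realType} {n : nat}.
Local Notation H := (heis R n).
Local Notation leb := (@lebesgue_measure R).
Implicit Types (x y z : H) (c e : R -> 'rV[R]_(n + n)) (sigma tau : R -> H).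
Local Notation hlen c := (\int[leb]_(t in `[0%R, 1%R]) (enorm (c t))%:E)%E.

Lemma measurable_enormE c (D : set R) : (forall j, measurable_fun setT (fun t => c t 0 j)) ->
  measurable_fun D (fun t => (enorm (c t))%:E).
Proof. by move=> mc; apply/measurable_EFinP/measurable_funTS/measurable_enorm. Qed.

Lemma hcurve_affine sigma c (al be : R) : be != 0 -> al \in `[0, 1] -> al + be \in `[0, 1] ->
  hcurve sigma c -> hcurve (fun t => sigma (al + be * t)) (fun t => be *: c (al + be * t)).
Proof.
move=> be0 al01 albe01 [acs mc vc]; split.
- apply/abs_continuous01P => i.
  by apply: (@ac01_affine _ (fun t => sigma t 0 i)) => //; exact: (abs_continuous01P sigma).1.
- move=> j; under eq_fun do rewrite mxE; apply: measurable_funM => //.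
  by apply: (measurableT_comp (mc j)); exact: measurable_affine.
apply: aeS (negligible_affine al be0 vc) => t vt.
rewrite in_itv /= => /andP[t0 t1]; apply: has_vel_affine; apply: vt.
move: al01 albe01; rewrite /affine !in_itv /= => /andP[a0 a1] /andP[b0 b1].
by move/eqP: be0 => be0; apply/andP; split; nra.
Qed.

Lemma hcurve_onem sigma c : hcurve sigma c ->
  hcurve (fun t => sigma (1 + - 1 * t)) (fun t => (- 1) *: c (1 + - 1 * t)).
Proof. by apply: hcurve_affine; rewrite ?oppr_eq0 ?oner_eq0// in_itv /= ?subrr ?lexx ?ler01. Qed.

Lemma hlen_onem c : (forall j, measurable_fun setT (fun t => c t 0 j)) ->
  hlen (fun t => (- 1) *: c (1 + - 1 * t)) = hlen c.
Proof.
move=> mc; rewrite -(@ge0_integral_affine _ 1 (-1) `[0%R, 1%R]%classic (fun t => enorm (c t)))//.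
- rewrite (_ : affine 1 (-1) @^-1` `[0, 1] = `[0, 1]%classic).
    by apply: eq_integral => t _; rewrite enormZ.
  apply/seteqP; split => t; rewrite /preimage /= /affine !in_itv /= => /andP[? ?]; apply/andP; split; lra.
- exact: measurable_enorm.
- by move=> t; exact: enorm_ge0.
Qed.

Lemma row_line m (v w : 'rV[R]_m) (a : R) i : (v + a *: w) 0 i = v 0 i + a * w 0 i.
Proof. by rewrite !mxE. Qed.

(** Since [omega e e = 0], the vertical speed required by horizontality stays constant along the
    segment. *)
Lemma hcurve_line x (e : 'rV[R]_(n + n)) : hcurve (fun t => x + t *: (e *m frame x)) (fun=> e).
Proof.
split => [|//|].
  apply/abs_continuous01P => i; apply: (@ac01_lip _ _ `|(e *m frame x) 0 i|) => s t _ _.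
  by rewrite !mxE opprD addrACA subrr add0r -mulrBl normrM mulrC.
apply: aeW => t _; apply/has_velP.
have lin (i : 'I_(n + n).+1) : is_derive t 1 (fun s => (x + s *: (e *m frame x)) 0 i) ((e *m frame x) 0 i).
  apply/is_deriveP => d d0; exists 1 => // h _; rewrite !row_line.
  by rewrite (_ : _ - _ - _ = 0) ?normr0 ?mulr_ge0// ?ltW//; ring.
split=> [j|]; first by have := lin (hidx j); rewrite frame_hidx.
have := lin ord_max; rewrite frame_max.
have -> // : omega (hor (x + t *: (e *m frame x))) e = omega (hor x) e.
rewrite (_ : hor _ = hor x + t *: e) ?omegaDl ?omegaZl ?omega_self ?mulr0 ?addr0//.
by apply/rowP => j; rewrite [LHS]mxE !row_line frame_hidx mxE.
Qed.

(** A sum instead of a case distinction: absolute continuity reduces to sums and monotone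
    reparametrizations. On each half one of the first two terms is constant and cancels against
    [sigma 1] once [sigma 1 = tau 0]. *)
Definition curve_cat sigma tau (t : R) : H :=
  sigma (Num.min (2 * t) 1) + tau (Num.max (2 * t - 1) 0) - sigma 1.

Definition vel_cat c e (t : R) : 'rV[R]_(n + n) :=
  if t < 2^-1 then 2 *: c (0 + 2 * t) else 2 *: e (-1 + 2 * t).

Lemma hcurve_cat sigma tau c e : hcurve sigma c -> hcurve tau e -> sigma 1 = tau 0 ->
  hcurve (curve_cat sigma tau) (vel_cat c e).
Proof.
move=> [acs mc vc] [act me ve] st; split.
- apply/abs_continuous01P => i.
  have as1 := (abs_continuous01P sigma).1 acs i; have at1 := (abs_continuous01P tau).1 act i.
  have -> : (fun t => curve_cat sigma tau t 0 i) = (fun t =>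
      ((fun t => sigma t 0 i) \o (fun t => Num.min (2 * t) 1)) t +
      ((fun t => tau t 0 i) \o (fun t => Num.max (2 * t - 1) 0)) t + (fun=> - sigma 1 0 i) t).
    by apply/funext => t; rewrite /curve_cat !mxE.
  apply: ac01D; first apply: ac01D.
  + apply: (ac01_comp_homo (K := 2)) => //.
    * move=> t; rewrite !in_itv /= => /andP[t0 t1].
      by rewrite le_min ler01 mulr_ge0//= ge_min lexx orbT.
    * by move=> s t _ _ ts; rewrite !minEle; case: ifPn; case: ifPn; lra.
    * move=> s t _ _; rewrite -[X in X * `|_|](ger0_norm (ler0n R 2)) -normrM mulrBr !minEle.
      case: (leP (2 * s) 1); case: (leP (2 * t) 1) => h1 h2 //; rewrite ?subrr ?normr0//;
      rewrite ler_norml; have := ler_norm (2 * t - 2 * s); have := ler_norm (- (2 * t - 2 * s));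
      rewrite normrN; clear -h1 h2; lra.
  + apply: (ac01_comp_homo (K := 2)) => //.
    * move=> t; rewrite !in_itv /= => /andP[t0 t1].
      by rewrite le_max lexx orbT /= ge_max ler01 andbT; lra.
    * by move=> s t _ _ ts; rewrite !maxEle; case: ifPn; case: ifPn; lra.
    * move=> s t _ _; rewrite -[X in X * `|_|](ger0_norm (ler0n R 2)) -normrM mulrBr !maxEle.
      case: (leP (2 * s - 1) 0); case: (leP (2 * t - 1) 0) => h1 h2 //; rewrite ?subrr ?normr0//;
      rewrite ler_norml; have := ler_norm (2 * t - 2 * s); have := ler_norm (- (2 * t - 2 * s));
      rewrite normrN; clear -h1 h2; lra.
  + by apply: (@ac01_lip _ _ 0) => s t _ _; rewrite subrr normr0 mul0r.
- move=> j; rewrite (_ : (fun t => _) = (fun t => if t < 2^-1 then 2 * c (affine 0 2 t) 0 j else 2 * e (affine (-1) 2 t) 0 j)); last first.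
    by apply/funext => t; rewrite /vel_cat /affine; case: ifP; rewrite mxE.
  apply: measurable_fun_ifT.
  + exact: measurable_fun_ltr.
  + by apply: measurable_funM => //; apply: (measurableT_comp (mc j)); exact: measurable_affine.
  + by apply: measurable_funM => //; apply: (measurableT_comp (me j)); exact: measurable_affine.
have two0 : 2 != 0 :> R by rewrite pnatr_eq0.
have n1 : leb.-negligible [set 2^-1 : R] by apply/negligibleP => //; exact: lebesgue_measure_set1.
have := aeI (aeI (negligible_affine 0 two0 vc) (negligible_affine (-1) two0 ve)) (_ : {ae leb, forall t : R, t != 2^-1}).
move=> /(_ _)/wrap[].
  by apply: negligibleS n1 => t /= /negP; rewrite negbK => /eqP.
apply: aeS => t [[v1 v2]] t2; rewrite in_itv /= => /andP[t0 t1].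
rewrite /vel_cat; case: ltP => [tl|tr].
  have /v1/has_vel_affine : affine 0 2 t \in `]0, 1[ by rewrite /affine in_itv /=; apply/andP; split; lra.
  apply: has_vel_near.
  have : \forall s \near t, s \in `]0, 2^-1[ by apply: near_in_itvoo; rewrite in_itv /= t0.
  apply: filterS => s; rewrite in_itv /= => /andP[s0 s1].
  rewrite /curve_cat (min_idPl _) ?(max_idPr _); [|lra|lra].
  by rewrite -st addrK add0r.
have {}tr : 2^-1 < t by rewrite lt_neqAle eq_sym t2.
have /v2/has_vel_affine : affine (-1) 2 t \in `]0, 1[ by rewrite /affine in_itv /=; apply/andP; split; lra.
apply: has_vel_near.
have : \forall s \near t, s \in `]2^-1, 1[ by apply: near_in_itvoo; rewrite in_itv /= tr.
apply: filterS => s; rewrite in_itv /= => /andP[s0 s1].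
rewrite /curve_cat (min_idPr _) ?(max_idPl _); [|lra|lra].
by rewrite [sigma 1 + _]addrC addrK [-1 + _]addrC.
Qed.

Lemma hlen_cat c e : (forall j, measurable_fun setT (fun t => c t 0 j)) ->
  (forall j, measurable_fun setT (fun t => e t 0 j)) ->
  (forall j, measurable_fun setT (fun t => vel_cat c e t 0 j)) ->
  (hlen (vel_cat c e) <= hlen c + hlen e)%E.
Proof.
move=> mc me mce.
have two0 : 2 != 0 :> R by rewrite pnatr_eq0.
have en0 (f : R -> 'rV[R]_(n + n)) t : (0 <= (enorm (f t))%:E)%E by rewrite lee_fin enorm_ge0.
have -> : hlen (vel_cat c e) = (\int[leb]_(t in `[0%R, 2^-1%R[) (enorm (vel_cat c e t))%:E +
    \int[leb]_(t in `[2^-1%R, 1%R]) (enorm (vel_cat c e t))%:E)%E.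
  rewrite (@itv_bndbnd_setU _ _ _ (BLeft (2^-1))); [|by rewrite bnd_simp invr_ge0|by rewrite bnd_simp invf_le1 ?ler1n//ltr0n].
  rewrite ge0_integral_setU//=.
  - exact: measurable_enormE.
  - apply/disj_setPS => t []/=; rewrite !in_itv /= => /andP[_ +] /andP[+ _].
    by move=> /lt_le_trans h /h; rewrite ltxx.
apply: leeD.
  apply: (@le_trans _ _ (\int[leb]_(t in `[0%R, 1%R[) (enorm (c t))%:E)%E); last first.
    apply: ge0_subset_integral => //; first exact: measurable_enormE.
    by move=> t /=; rewrite !in_itv /= => /andP[-> /ltW].
  rewrite -(@ge0_integral_affine _ 0 2 `[0%R, 1%R[%classic (fun t => enorm (c t)))//; last 2 first.
  - exact: measurable_enorm.
  - by move=> t; exact: enorm_ge0.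
  rewrite (_ : affine 0 2 @^-1` `[0, 1[ = `[0, 2^-1[%classic); last first.
    by apply/seteqP; split => t; rewrite /preimage /= /affine !in_itv /= => /andP[? ?]; apply/andP; split; lra.
  rewrite le_eqVlt; apply/orP; left; apply/eqP; apply: eq_integral => t; rewrite inE /= in_itv /= => /andP[_ t2].
  by rewrite /vel_cat t2 enormZ.
rewrite -(@ge0_integral_affine _ (-1) 2 `[0%R, 1%R]%classic (fun t => enorm (e t)))//; last 2 first.
- exact: measurable_enorm.
- by move=> t; exact: enorm_ge0.
rewrite (_ : affine (-1) 2 @^-1` `[0, 1] = `[2^-1, 1]%classic); last first.
  by apply/seteqP; split => t; rewrite /preimage /= /affine !in_itv /= => /andP[? ?]; apply/andP; split; lra.
rewrite le_eqVlt; apply/orP; left; apply/eqP; apply: eq_integral => t; rewrite inE /= in_itv /= => /andP[t2 _].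
by rewrite /vel_cat ltNge t2 /= enormZ.
Qed.

End CurveOperations.

(** * The sub-Riemannian distance *)

Section Distance.
Context {R : realType} {n : nat}.
Local Notation H := (heis R n).
Local Notation leb := (@lebesgue_measure R).
Implicit Types (x y z : H) (sigma tau : R -> H).
Local Notation hlen c := (\int[leb]_(t in `[0%R, 1%R]) (enorm (c t))%:E)%E.

Lemma dSR_le sigma c : hcurve sigma c -> (dSR (sigma 0%R) (sigma 1%R) <= hlen c)%E.
Proof.
move=> sc; apply: ereal_inf_lbound; exists sigma; last exact: hcurve_length.
by split => //; exact: hcurve_horizontal sc.
Qed.

Lemma dSR_lt x y (e : \bar R) : (dSR x y < e)%E ->
  exists sigma c, [/\ hcurve sigma c, sigma 0 = x, sigma 1 = y & (hlen c < e)%E].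
Proof.
move=> /ereal_inf_lt[_ [sigma [hs s0 s1] <-]] se.
have [c sc] := horizontal_hcurve hs.
by exists sigma, c; split => //; rewrite -(hcurve_length sc).
Qed.

Lemma hlen_ge0 (c : R -> 'rV[R]_(n + n)) : (0 <= hlen c)%E.
Proof. by apply: integral_ge0 => t _; rewrite lee_fin enorm_ge0. Qed.

Lemma dSR_ge0 x y : (0 <= dSR x y)%E.
Proof.
rewrite leNgt; apply/negP => /dSR_lt[sigma [c [_ _ _]]].
by rewrite ltNge hlen_ge0.
Qed.

Lemma dSR_triangle y x z : (dSR x z <= dSR x y + dSR y z)%E.
Proof.
have [->|xyoo] := eqVneq (dSR x y) +oo%E.
  by rewrite addye ?leey// gt_eqF// (lt_le_trans _ (dSR_ge0 _ _)).
have [->|yzoo] := eqVneq (dSR y z) +oo%E.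
  by rewrite addey ?leey// gt_eqF// (lt_le_trans _ (dSR_ge0 _ _)).
have fxy : dSR x y \is a fin_num by rewrite ge0_fin_numE ?dSR_ge0// ltey.
have fyz : dSR y z \is a fin_num by rewrite ge0_fin_numE ?dSR_ge0// ltey.
apply/lee_addgt0Pr => e e0; have e20 : 0 < e / 2 by rewrite divr_gt0.
have /dSR_lt[sigma [c [sc s0 s1 sl]]] : (dSR x y < dSR x y + (e / 2)%:E)%E by rewrite lteDl// lte_fin.
have /dSR_lt[tau [f [tf t0 t1 tl]]] : (dSR y z < dSR y z + (e / 2)%:E)%E by rewrite lteDl// lte_fin.
have st : sigma 1 = tau 0 by rewrite s1.
have cat := hcurve_cat sc tf st.
have := dSR_le cat.
rewrite {1 2}/curve_cat mulr0 mulr1 (min_idPl _) ?ler01// (max_idPr _) ?sub0r ?lerN10//.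
rewrite (min_idPr _) ?ler1n// (max_idPl _) ?subr_ge0 ?ler1n//.
rewrite -st addrK s0 addrAC subrr add0r (_ : 2 - 1 = 1 :> R); last by ring.
rewrite t1 => /le_trans; apply.
case: sc tf cat => [_ mc _] [_ mf _] [_ mcf _].
apply: le_trans (hlen_cat mc mf mcf) _; apply: le_trans (leeD (ltW sl) (ltW tl)) _.
by rewrite addeACA -EFinD -mulr2n -[_ *+ 2]mulr_natr divfK.
Qed.

Lemma dSRC_le x y : (dSR y x <= dSR x y)%E.
Proof.
have [->|xyoo] := eqVneq (dSR x y) +oo%E; first by rewrite leey.
have fxy : dSR x y \is a fin_num by rewrite ge0_fin_numE ?dSR_ge0// ltey.
apply/lee_addgt0Pr => e e0.
have /dSR_lt[sigma [c [sc s0 s1 sl]]] : (dSR x y < dSR x y + e%:E)%E by rewrite lteDl// lte_fin.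
have := dSR_le (hcurve_onem sc).
rewrite mulr0 addr0 mulr1 subrr s0 s1; case: sc => _ mc _.
by rewrite (hlen_onem mc) => /le_trans; apply; exact: ltW.
Qed.

Lemma dSRC x y : dSR x y = dSR y x.
Proof. by apply/eqP; rewrite eq_le !dSRC_le. Qed.

(* Right translation of [x] by the horizontal element with coordinates (e, 0). *)
Definition hstep x (e : 'rV[R]_(n + n)) : H := x + e *m frame x.

Lemma dSR_hstep x e : (dSR x (hstep x e) <= (enorm e)%:E)%E.
Proof.
have := dSR_le (hcurve_line x e); rewrite scale0r addr0 scale1r => /le_trans; apply.
by rewrite integral_cst//= lebesgue_measure_itv /= lte_fin ltr01 sube0 mule1.
Qed.

Lemma hor_hstep x e : hor (hstep x e) = hor x + e.
Proof. by apply/rowP => j; rewrite !mxE /hstep -(frame_hidx e x j) !mxE. Qed.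

Lemma hstep_max x e : hstep x e 0 ord_max = x 0 ord_max + 2^-1 * omega (hor x) e.
Proof. by rewrite /hstep mxE frame_max. Qed.

(* The last coordinate of [hmul (hinv x) y]. *)
Definition vdist x y : R := y 0 ord_max - x 0 ord_max - 2^-1 * omega (hor x) (hor y).

Lemma enorm_delta (a : R) j : enorm (a *: delta_mx 0 j : 'rV[R]_(n + n)) = `|a|.
Proof.
rewrite enormZ /enorm (bigD1 j)//= big1 => [|i ij]; rewrite !mxE !eqxx.
  by rewrite expr1n addr0 sqrtr1 mulr1.
by rewrite (negPf ij) andbF expr0n.
Qed.

Lemma omega_delta (k : 'I_n) :
  omega (delta_mx 0 (lshift n k)) (delta_mx 0 (rshift n k)) = 1 :> R.
Proof.
rewrite /omega (bigD1 k)//= big1 => [|i ik]; rewrite !mxE !eqxx /= ?eq_lrshift ?eq_rlshift /=.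
  by rewrite mul1r mul0r subr0 addr0.
by rewrite (inj_eq (@lshift_inj _ _)) (negPf ik) mul0r mul0r subr0.
Qed.

(* A vertical displacement a is the commutator of two horizontal steps of length
   sqrt |a|. *)
Lemma dSR_vertical x y (n_gt0 : (0 < n)%N) : hor x = hor y ->
  (dSR x y <= (4 * Num.sqrt `|y 0%R ord_max - x 0%R ord_max|)%:E)%E.
Proof.
move=> xy; set a := y 0 ord_max - x 0 ord_max; set s := Num.sqrt `|a|.
pose k := Ordinal n_gt0.
pose e1 := s *: delta_mx 0 (lshift n k) : 'rV[R]_(n + n).
(* The sign of [a] is put into [e2], so that [omega e1 e2 = a], which is the vertical gain of the
   commutator. *)
pose e2 := (Num.sg a * s) *: delta_mx 0 (rshift n k) : 'rV[R]_(n + n).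
pose x1 := hstep x e1; pose x2 := hstep x1 e2; pose x3 := hstep x2 (- e1).
have -> : y = hstep x3 (- e2).
  apply: heis_eq.
    move=> j; rewrite -!horE -xy; congr (_ 0 j).
    by rewrite !hor_hstep addrAC addrK addrK.
  have W : omega e1 e2 = a.
    rewrite omegaZl omegaZr omega_delta mulr1 mulrCA -expr2 sqr_sqrtr//.
    by rewrite -numEsg.
  have m1 : x1 0 ord_max = _ := hstep_max x e1.
  have m2 : x2 0 ord_max = _ := hstep_max x1 e2.
  have m3 : x3 0 ord_max = _ := hstep_max x2 (- e1).
  have h1 : hor x1 = _ := hor_hstep x e1.
  have h2 : hor x2 = _ := hor_hstep x1 e2.
  have h3 : hor x3 = _ := hor_hstep x2 (- e1).
  rewrite hstep_max m3 m2 m1 h3 h2 h1.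
  rewrite !(omegaNr, omegaDl, omegaNl, omega_self) (omegaC e2 e1) W.
  have -> : y 0 ord_max = x 0 ord_max + a by rewrite /a; ring.
  by move: (omega _ _) (omega _ _) => w1 w2; field.
have e1s : enorm e1 = s by rewrite enorm_delta ger0_norm ?sqrtr_ge0.
have e2s : enorm e2 <= s.
  rewrite enorm_delta normrM [`|s|]ger0_norm ?sqrtr_ge0// normr_sg.
  by case: (a != 0); rewrite ?mul1r ?mul0r ?sqrtr_ge0.
have eN (e : 'rV[R]_(n + n)) : enorm (- e) = enorm e by rewrite -[in LHS]scaleN1r enormZ normrN1 mul1r.
have -> : 4 * s = s + (s + (s + s)) by ring.
rewrite EFinD; apply: le_trans (dSR_triangle x1 _ _) _; apply: leeD.
  by rewrite -e1s; exact: dSR_hstep.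
rewrite EFinD; apply: le_trans (dSR_triangle x2 _ _) _; apply: leeD.
  by apply: le_trans (dSR_hstep _ _) _; rewrite lee_fin.
rewrite EFinD; apply: le_trans (dSR_triangle x3 _ _) _; apply: leeD.
  by apply: le_trans (dSR_hstep _ _) _; rewrite lee_fin eN e1s.
by apply: le_trans (dSR_hstep _ _) _; rewrite lee_fin eN.
Qed.

(** One horizontal step aligns the horizontal parts; the vertical displacement that remains is
    exactly [vdist x y]. *)
Lemma dSR_upper x y : (0 < n)%N ->
  (dSR x y <= (enorm (hor y - hor x) + 4 * Num.sqrt `|vdist x y|)%:E)%E.
Proof.
move=> n0; rewrite EFinD; apply: le_trans (dSR_triangle (hstep x (hor y - hor x)) _ _) _.
apply: leeD; first exact: dSR_hstep.
have := @dSR_vertical (hstep x (hor y - hor x)) y n0.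
rewrite hor_hstep addrC subrK => /(_ erefl)/le_trans; apply.
by rewrite lee_fin hstep_max /vdist omegaDr omegaNr omega_self subr0 opprD addrA.
Qed.

Lemma coord_le_enorm (e : 'rV[R]_(n + n)) j : `|e 0 j| <= enorm e.
Proof.
rewrite -sqrtr_sqr ler_sqrt ?sumr_ge0// => [|i _]; last exact: sqr_ge0.
by rewrite (bigD1 j)//= lerDl sumr_ge0// => i _; exact: sqr_ge0.
Qed.

Lemma omega_bound (c e : 'rV[R]_(n + n)) (M : R) : (forall j, `|c 0 j| <= M) ->
  `|2^-1 * omega c e| <= n%:R * M * enorm e.
Proof.
move=> cM; rewrite normrM ger0_norm ?invr_ge0//.
apply: (@le_trans _ _ (2^-1 * \sum_(k < n) (M * enorm e + M * enorm e))).
  rewrite ler_wpM2l ?invr_ge0//; apply: le_trans (ler_norm_sum _ _ _) _.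
  apply: ler_sum => k _; apply: le_trans (ler_normB _ _) _; rewrite !normrM.
  by apply: lerD; apply: ler_pM => //; exact: coord_le_enorm.
rewrite sumr_const card_ord -mulr2n -[_ *+ n]mulr_natr -[_ *+ 2]mulr_natr.
by rewrite le_eqVlt; apply/orP; left; apply/eqP; field.
Qed.

Lemma is_derive_sum_fun (I : finType) (f : I -> R -> R) (df : I -> R) (t : R) :
  (forall i, is_derive t 1 (f i) (df i)) ->
  is_derive t 1 (fun s => \sum_i f i s) (\sum_i df i).
Proof.
move=> fdf; elim: (index_enum I) => [|i r IH].
  rewrite big_nil (_ : (fun s => _) = cst 0); first exact: is_derive_cst.
  by apply/funext => s; rewrite big_nil.
rewrite big_cons (_ : (fun s => _) = f i + (fun s => \sum_(j <- r) f j s)); first exact: is_deriveD.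
by apply/funext => s; rewrite big_cons.
Qed.

Lemma is_derive_omega x sigma t c : has_vel sigma t c ->
  is_derive t 1 (fun s => omega (hor x) (hor (sigma s))) (omega (hor x) c).
Proof.
move=> /has_velP[sc _]; apply: is_derive_sum_fun => k.
under eq_fun do rewrite !mxE; rewrite !mxE.
have d1 := @is_deriveZ _ _ _ (fun s => sigma s 0 (hidx (rshift n k))) (x 0 (hidx (lshift n k))) t 1 _ (sc _).
have d2 := @is_deriveZ _ _ _ (fun s => sigma s 0 (hidx (lshift n k))) (x 0 (hidx (rshift n k))) t 1 _ (sc _).
exact: (@is_deriveB _ _ _ _ _ _ _ _ _ d1 d2).
Qed.


Lemma ac01_cst (a : R) : ac01 (fun=> a).
Proof. by apply: (@ac01_lip _ _ 0) => s t _ _; rewrite subrr normr0 mul0r. Qed.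

Lemma ac01_sum (I : Type) (s : seq I) (f : I -> R -> R) : (forall i, ac01 (f i)) ->
  ac01 (fun t => \sum_(i <- s) f i t).
Proof.
move=> acf; elim: s => [|i s IH].
  by rewrite (_ : (fun t => _) = fun=> 0); [exact: ac01_cst|apply/funext => t; rewrite big_nil].
rewrite (_ : (fun t => _) = fun t => f i t + \sum_(j <- s) f j t); first exact: ac01D.
by apply/funext => t; rewrite big_cons.
Qed.

Lemma ac01_omega (f g : R -> 'rV[R]_(n + n)) : (forall j, ac01 (fun t => f t 0 j)) ->
  (forall j, ac01 (fun t => g t 0 j)) -> ac01 (fun t => omega (f t) (g t)).
Proof.
move=> acf acg; apply: ac01_sum => k.
rewrite (_ : (fun t => _) = fun t => f t 0 (lshift n k) * g t 0 (rshift n k) +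
  (-1) * (f t 0 (rshift n k) * g t 0 (lshift n k))); last by apply/funext => t; rewrite mulN1r.
by apply: ac01D; [exact: ac01M|apply: ac01M; [exact: ac01_cst|exact: ac01M]].
Qed.

Lemma hcurve_coord_ac sigma c (i : 'I_(n + n).+1) : hcurve sigma c -> ac01 (fun t => sigma t 0 i).
Proof. by move=> [/abs_continuous01P acs _ _]. Qed.

Lemma hlen_integrable (c : R -> 'rV[R]_(n + n)) : (forall j, measurable_fun setT (fun t => c t 0 j)) ->
  (hlen c < +oo)%E -> leb.-integrable `[0, 1] (EFin \o (fun t => enorm (c t))).
Proof.
move=> mc hc; apply/integrableP; split; first exact: measurable_enormE.
rewrite (_ : integral _ _ _ = hlen c)//; apply: eq_integral => t _ /=.
by rewrite ger0_norm ?enorm_ge0.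
Qed.

Lemma hcurve_coord_bound sigma c (L : R) : hcurve sigma c -> (hlen c <= L%:E)%E ->
  forall j t, t \in `[0, 1] -> `|sigma t 0 (hidx j) - sigma 0 0 (hidx j)| <= L.
Proof.
move=> sc hL j t t01; rewrite -lee_fin; apply: le_trans hL.
have [acs mc vc] := sc.
have [hoo|hoo] := ltP (hlen c) +oo%E; last by rewrite (le_trans _ hoo)// leey.
apply: le_trans (_ : (\int[leb]_(s in `[0%R, t]) (enorm (c s))%:E <= _)%E); last first.
  apply: ge0_subset_integral => //; first exact: measurable_enormE.
    by move=> s _; rewrite lee_fin enorm_ge0.
  move=> s /=; rewrite !in_itv /= => /andP[-> /= /le_trans]; apply.
  by move: t01; rewrite in_itv => /andP[].
apply: (@ac01_le_integral _ (fun s => sigma s 0 (hidx j)) (fun s => enorm (c s))) => //.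
- exact: hcurve_coord_ac sc.
- exact: measurable_enorm.
- by move=> s; exact: enorm_ge0.
- exact: hlen_integrable.
apply: aeS vc => s vs s01; exists (c s 0 j); last exact: coord_le_enorm.
by have /has_velP[] := vs s01.
Qed.

(** The displacement [vdist (sigma 0) (sigma t)] has derivative half of [omega (hor (sigma t) - hor
    (sigma 0)) (c t)]. Its first argument is bounded by the length [L], and integrating the speed
    gives the second factor [L]. *)
Lemma hcurve_vdist_bound sigma c (L : R) : hcurve sigma c -> (hlen c <= L%:E)%E ->
  `|vdist (sigma 0) (sigma 1)| <= n%:R * L ^+ 2.
Proof.
move=> sc hL; have [acs mc vc] := sc.
have L0 : 0 <= L by rewrite -lee_fin (le_trans _ hL)// hlen_ge0.
have hoo : (hlen c < +oo)%E by rewrite (le_lt_trans hL)// ltry.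
have ic := hlen_integrable mc hoo.
set x := sigma 0.
pose f t := sigma t 0 ord_max + - 2^-1 * omega (hor x) (hor (sigma t)).
have acf : ac01 f.
  apply: ac01D; first exact: hcurve_coord_ac sc.
  apply: ac01M; first exact: ac01_cst.
  apply: ac01_omega => j; first exact: ac01_cst.
  by under eq_fun do rewrite horE; exact: hcurve_coord_ac sc.
pose g t := (n%:R * L) * enorm (c t).
have nL0 : 0 <= n%:R * L by rewrite mulr_ge0.
have ig : leb.-integrable `[0, 1] (EFin \o g).
  by rewrite (_ : EFin \o g = fun t => ((n%:R * L)%:E * (enorm (c t))%:E)%E); [exact: integrableZl|].
have mg : measurable_fun setT g by apply: measurable_funM => //; exact: measurable_enorm.
have g0 t : 0 <= g t by rewrite mulr_ge0// enorm_ge0.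
have dfg : {ae leb, forall t : R, t \in `]0, 1[ -> exists2 df, is_derive t 1 f df & `|df| <= g t}.
  apply: aeS vc => t vt t01; have v := vt t01; have /has_velP[sc1 scm] := v.
  exists (2^-1 * omega (hor (sigma t)) (c t) + - 2^-1 * omega (hor x) (c t)).
    have d2 := @is_deriveZ _ _ _ _ (- 2^-1) _ _ _ (is_derive_omega x v).
    exact: (@is_deriveD _ _ _ _ _ _ _ _ _ scm d2).
  rewrite mulNr -mulrBr -omegaNl -omegaDl; apply: omega_bound => j.
  rewrite !mxE; apply: (hcurve_coord_bound sc hL).
  by move: t01; rewrite !in_itv /= => /andP[/ltW-> /ltW->].
have := @ac01_le_integral _ f g acf mg g0 ig dfg 1.
rewrite in_itv /= ler01 lexx => /(_ isT).
under eq_integral do rewrite /g EFinM.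
rewrite ge0_integralZl//; last 2 first.
- exact: measurable_enormE.
- by move=> t _; rewrite lee_fin enorm_ge0.
have -> : f 1 - f 0 = vdist x (sigma 1).
  by rewrite /f /vdist -/x omega_self mulr0 addr0; ring.
move=> h; rewrite -lee_fin; apply: le_trans h _.
by rewrite expr2 mulrA [leRHS]EFinM lee_wpmul2l// lee_fin.
Qed.

Definition rd x y : R := fine (dSR x y).

Hypothesis n_gt0 : (0 < n)%N.

Lemma dSRE x y : dSR x y = (rd x y)%:E.
Proof.
rewrite /rd fineK// ge0_fin_numE ?dSR_ge0//.
by apply: le_lt_trans (dSR_upper x y n_gt0) _; rewrite ltry.
Qed.

Lemma rd_ge0 x y : 0 <= rd x y. Proof. exact/fine_ge0/dSR_ge0. Qed.

Lemma rdC x y : rd x y = rd y x. Proof. by rewrite /rd dSRC. Qed.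

Lemma rd_triangle y x z : rd x z <= rd x y + rd y z.
Proof. by rewrite -lee_fin EFinD -!dSRE dSR_triangle. Qed.

Lemma rd_upper x y : rd x y <= enorm (hor y - hor x) + 4 * Num.sqrt `|vdist x y|.
Proof. by rewrite -lee_fin -dSRE dSR_upper. Qed.

Lemma rd_lower_hor x y j : `|y 0 (hidx j) - x 0 (hidx j)| <= rd x y.
Proof.
apply/ler_addgt0Pr => e e0.
have /dSR_lt[sigma [c [sc <- <- sl]]] : (dSR x y < (rd x y + e)%:E)%E by rewrite dSRE lte_fin ltrDl.
by apply: (hcurve_coord_bound sc (ltW sl)); rewrite in_itv /= ler01 lexx.
Qed.

(** Together with [rd_upper] and [rd_lower_hor], this is the ball-box comparison: horizontal
    displacements count linearly, vertical ones by their square root. *)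
Lemma rd_lower_v x y : `|vdist x y| <= n%:R * rd x y ^+ 2.
Proof.
apply/ler_addgt0Pr => e e0.
(* The excess of [n%:R * (rd x y + d) ^+ 2] is [d] times [n%:R * (2 * rd x y + d)], hence at most
   [e] for this [d]. *)
pose d := Num.min 1 (e / (n%:R * (2 * rd x y + 1))).
have nr0 : 0 < n%:R * (2 * rd x y + 1) :> R.
  by rewrite mulr_gt0 ?ltr0n// ltr_wpDl// mulr_ge0// rd_ge0.
have d0 : 0 < d by rewrite lt_min ltr01 divr_gt0.
have /dSR_lt[sigma [c [sc sx sy sl]]] : (dSR x y < (rd x y + d)%:E)%E by rewrite dSRE lte_fin ltrDl.
have := hcurve_vdist_bound sc (ltW sl); rewrite sx sy => /le_trans; apply.
have -> : n%:R * (rd x y + d) ^+ 2 = n%:R * rd x y ^+ 2 + d * (n%:R * (2 * rd x y + d)) by ring.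
rewrite lerD2l; apply: (@le_trans _ _ (d * (n%:R * (2 * rd x y + 1)))).
  by rewrite ler_wpM2l ?(ltW d0)// ler_wpM2l// lerD2l ge_min lexx.
by rewrite -ler_pdivlMr// ge_min lexx orbT.
Qed.

Lemma rd_xx x : rd x x = 0.
Proof.
apply/eqP; rewrite eq_le rd_ge0 andbT; apply: le_trans (rd_upper x x) _.
rewrite subrr /vdist omega_self mulr0 subr0 subrr normr0 sqrtr0 mulr0 addr0.
by rewrite -[X in enorm X](scale0r 0) enormZ normr0 mul0r.
Qed.

End Distance.

(** * Variation of geodesics *)

Section Primitives.
Context {R : realType}.
Local Notation leb := (@lebesgue_measure R).

Lemma exists_primitive (g : R -> R) : continuous g -> exists F : R -> R,
  [/\ F 0 = 0, forall s : R, 0 <= s <= 1 -> is_derive s 1 F (g s), ac01 F &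
      forall s t : R, 0 <= s -> s < t -> t <= 1 ->
        exists2 x, x \in `]s, t[ & F t - F s = g x * (t - s)].
Proof.
move=> cg.
(* Starting at -1 makes 0 an interior point, so that the two-sided derivative exists there as
   well. *)
pose F0 (s : R) := \int[leb]_(t in `[(-1)%R, s]) g t.
have ig (a b : R) : leb.-integrable `[a, b] (EFin \o g).
  apply: continuous_compact_integrable; first exact: segment_compact.
  exact: continuous_subspaceT.
have dF0 (s : R) : 0 <= s -> is_derive s 1 F0 (g s).
  move=> s0.
  have ss1 : s < s + 1 by rewrite ltrDl.
  have s1 : -1 < s by rewrite (lt_le_trans _ s0)// ltrN10.
  have [dF Fg] := @continuous_FTC1_closed R g (-1) s (s + 1) ss1 (ig _ _) s1 (cg s).
  by split; [exact: dF|rewrite -derive1E].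
exists (fun s => F0 s - F0 0); rewrite subrr.
have dF (s : R) : 0 <= s <= 1 -> is_derive s 1 (fun s => F0 s - F0 0) (g s).
  move=> /andP[s0 _]; have := dF0 s s0 => d1.
  by rewrite -[g s]subr0; exact: (@is_deriveB _ _ _ _ _ _ _ _ _ d1 (is_derive_cst (F0 0) s 1)).
have mvt (s t : R) : 0 <= s -> s < t -> t <= 1 ->
    exists2 x, x \in `]s, t[ & F0 t - F0 0 - (F0 s - F0 0) = g x * (t - s).
  move=> s0 st t1; apply: (@MVT R (fun s => F0 s - F0 0) g s t st).
  - move=> x; rewrite in_itv /= => /andP[sx xt]; apply: dF.
    by rewrite (le_trans s0 (ltW sx)) (le_trans (ltW xt)).
  - apply: derivable_within_continuous => x; rewrite in_itv /= => /andP[sx xt].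
    by have /dF[] : 0 <= x <= 1 by rewrite (le_trans s0 sx) (le_trans xt).
split => //.
have [|c _ cM] := @EVT_max R (fun t => `|g t|) 0 1 ler01.
  by apply: continuous_subspaceT => x; apply: cvg_norm; exact: cg.
apply: (@ac01_lip _ _ `|g c|).
have wlg (s t : R) : s \in `[0, 1] -> t \in `[0, 1] -> s < t ->
    `|F0 t - F0 0 - (F0 s - F0 0)| <= `|g c| * `|t - s|.
  rewrite !in_itv /= => /andP[s0 s1] /andP[t0 t1] st.
  have [x xst ->] := mvt s t s0 st t1.
  rewrite normrM ler_wpM2r//; apply: cM; move: xst; rewrite !in_itv /= => /andP[sx xt].
  by rewrite (le_trans s0 (ltW sx)) (le_trans (ltW xt)).
move=> s t s01 t01; case: (ltgtP s t) => [st|ts|->]; first exact: wlg.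
  by rewrite distrC [`|t - s|]distrC; exact: wlg.
by rewrite !subrr normr0 mulr0.
Qed.

Lemma is_derive_omega2 n (a b : R -> 'rV[R]_(n + n)) (da db : 'rV[R]_(n + n)) (t : R) :
  (forall j, is_derive t 1 (fun s => a s 0 j) (da 0 j)) ->
  (forall j, is_derive t 1 (fun s => b s 0 j) (db 0 j)) ->
  is_derive t 1 (fun s => omega (a s) (b s)) (omega da (b t) + omega (a t) db).
Proof.
move=> Ha Hb; rewrite /omega -big_split /=; apply: is_derive_sum_fun => k.
have d1 := @is_deriveM _ _ _ _ _ _ _ _ (Ha (lshift n k)) (Hb (rshift n k)).
have d2 := @is_deriveM _ _ _ _ _ _ _ _ (Ha (rshift n k)) (Hb (lshift n k)).
have := @is_deriveB _ _ _ _ _ _ _ _ _ d1 d2.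
rewrite (_ : _ - _ = da 0 (lshift n k) * b t 0 (rshift n k) - da 0 (rshift n k) * b t 0 (lshift n k) +
  (a t 0 (lshift n k) * db 0 (rshift n k) - a t 0 (rshift n k) * db 0 (lshift n k))) //.
by rewrite /GRing.scale /=; ring.
Qed.

End Primitives.

Lemma eq_ac01 (R : realType) (f g : R -> R) : f =1 g -> ac01 g -> ac01 f.
Proof. by move=> /funext ->. Qed.

Lemma eq_is_derive (R : realType) (f g : R -> R) (t df dg : R) : f =1 g -> df = dg ->
  is_derive t 1 g dg -> is_derive t 1 f df.
Proof. by move=> /funext -> ->. Qed.

Section Perturbation.
Context {R : realType} {n : nat}.
Local Notation H := (heis R n).
Local Notation leb := (@lebesgue_measure R).

Lemma is_derive_affine (al be t : R) : is_derive t 1 (fun s : R => al + be * s) be.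
Proof.
apply/is_deriveP => e e0; exists 1 => // h _.
by rewrite (_ : _ - _ - _ = 0) ?normr0 ?mulr_ge0// ?ltW//; ring.
Qed.

Variables (sigma : R -> H) (c : R -> 'rV[R]_(n + n)).
Hypothesis sc : hcurve sigma c.
Let gb i (s : R) := sigma (clamp01 s) 0 (hidx i).

Lemma gb_continuous i : continuous (gb i).
Proof. exact: ac01_clamp_continuous (hcurve_coord_ac (hidx i) sc). Qed.

Lemma gbE i (s : R) : s \in `[0, 1] -> gb i s = hor (sigma s) 0 i.
Proof. by move=> s01; rewrite /gb clamp01_id// horE. Qed.

Variables (j : 'I_(n + n)) (E : 'rV[R]_(n + n)).
Hypothesis omegaE : forall u, omega u E = u 0 j.
Variable Gam : 'I_(n + n) -> R -> R.
Hypothesis Gam0 : forall i, Gam i 0 = 0.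
Hypothesis dGam : forall i (s : R), 0 <= s <= 1 -> is_derive s 1 (Gam i) (gb i s).
Hypothesis acGam : forall i, ac01 (Gam i).
(** [m] is the mean of the horizontal part over [0,1]. Below, [g] is the centred j-th coordinate,
    its primitive [f] vanishes at 0 and at 1, and [K2 1] is the variance of that coordinate. *)
Let m : 'rV[R]_(n + n) := \row_i Gam i 1.
Let g (s : R) := gb j s - m 0 j.
Let f (s : R) := Gam j s + - m 0 j * s.
Variables K2 F : R -> R.
Hypothesis K20 : K2 0 = 0.
Hypothesis dK2 : forall s : R, 0 <= s <= 1 -> is_derive s 1 K2 (g s ^+ 2).
Hypothesis acK2 : ac01 K2.
Hypothesis F0 : F 0 = 0.
Hypothesis dF : forall s : R, 0 <= s <= 1 -> is_derive s 1 F (f s).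
Hypothesis acF : ac01 F.

(* The curve is sigma + (1 - s) h + lam f(s) E, lifted horizontally. Since f vanishes
   at 0 and 1, it joins y to sigma 1 as soon as the last coordinate matches, and that
   condition is affine in lam because omega (f E) (f' E) = 0. *)
Lemma perturbed_hcurve (y : H) (lam : R) :
  let h := hor y - hor (sigma 0) in
  vdist (sigma 0) y + omega (hor (sigma 0) - m) h + lam * (K2 1 + omega h E * F 1) = 0 ->
  exists tau, [/\ hcurve tau (fun t => c t - h + (lam * g t) *: E), tau 0 = y & tau 1 = sigma 1].
Proof.
move=> h; have hy : hor y = hor (sigma 0) + h by rewrite /h addrC subrK.
clearbody h => eqlam; have [acs mc vc] := sc.
pose rho (s : R) : 'rV[R]_(n + n) := (1 - s) *: h + (lam * f s) *: E.
pose drho (s : R) : 'rV[R]_(n + n) := - h + (lam * g s) *: E.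
pose GamV (s : R) : 'rV[R]_(n + n) := \row_i Gam i s.
pose K (s : R) := K2 s + m 0 j * f s.
pose w := lam * omega h E.
(* [V] is an explicit primitive of half of [omega (hor sigma + rho) (c + drho)]. Integration by
   parts produces the term [omega (rho s) (hor (sigma s))] and leaves [omega (hor sigma) drho],
   whose primitive is [P]; [Q] is the primitive of half of [omega rho drho]. The constant in [V]
   makes the curve start at [y]. *)
pose P (s : R) := - omega (GamV s) h + lam * K s.
pose Q (s : R) := 2^-1 * w * ((1 + - 1 * s) * f s + 2 * F s).
pose V (s : R) := sigma s 0 ord_max + (2^-1 * omega (rho s) (hor (sigma s)) + (P s + Q s)) +
  (y 0 ord_max - sigma 0 0 ord_max - 2^-1 * omega h (hor (sigma 0))).
pose tau (s : R) : H := \row_i if unlift ord_max i is Some k then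
   (hor (sigma s) + rho s) 0 k else V s.
have tauh s i : tau s 0 (hidx i) = hor (sigma s) 0 i + rho s 0 i.
  have hl : hidx i = lift ord_max i by apply/val_inj; rewrite /= /bump leqNgt ltn_ord.
  by rewrite mxE hl liftK mxE.
have taum s : tau s 0 ord_max = V s by rewrite mxE unlift_none.
have f0 : f 0 = 0 by rewrite /f Gam0 mulr0 addr0.
have f1 : f 1 = 0 by rewrite /f /m mxE mulr1 subrr.
have rho0 : rho 0 = h by rewrite /rho f0 mulr0 scale0r addr0 subr0 scale1r.
have rho1 : rho 1 = 0 by rewrite /rho f1 mulr0 scale0r addr0 subrr scale0r.
have df (s : R) : 0 <= s <= 1 -> is_derive s 1 f (g s).
  move=> s01; rewrite (_ : f = (fun s => Gam j s) + (fun s => 0 + - m 0 j * s)).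
    exact: (@is_deriveD _ _ _ _ _ _ _ _ _ (dGam j s01) (is_derive_affine 0 (- m 0 j) s)).
  by apply/funext => r; rewrite /f /= -[LHS]/(_ + _) -[RHS]/(_ + (0 + _)) add0r.
have acf : ac01 f.
  apply: ac01D => //; apply: ac01M; first exact: ac01_cst.
  by apply: (@ac01_lip _ _ 1) => s t _ _; rewrite mul1r.
have acid : ac01 (fun s : R => s) by apply: (@ac01_lip _ _ 1) => s t _ _; rewrite mul1r.
have ac1m : ac01 (fun s : R => 1 - s).
  by apply: (@ac01_lip _ _ 1) => s t _ _; rewrite mul1r distrC (_ : 1 - s - (1 - t) = t - s)//; ring.
have rhoE s i : rho s 0 i = (1 - s) * h 0 i + lam * f s * E 0 i by rewrite !mxE.
have acrho i : ac01 (fun s => rho s 0 i).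
  apply: (eq_ac01 (fun s => rhoE s i)); apply: ac01D.
    by apply: ac01M => //; exact: ac01_cst.
  by apply: ac01M; [apply: ac01M => //; exact: ac01_cst|exact: ac01_cst].
have acsig i : ac01 (fun s => hor (sigma s) 0 i).
  by apply: (eq_ac01 (fun s => horE _ i)); exact: hcurve_coord_ac sc.
have acGV i : ac01 (fun s => GamV s 0 i) by apply: (eq_ac01 _ (acGam i)) => s; rewrite mxE.
have drhoP (s : R) i : 0 <= s <= 1 -> is_derive s 1 (fun s => rho s 0 i) (drho s 0 i).
  move=> s01; have d1 := is_derive_affine (h 0 i) (- h 0 i) s.
  have d2 := @is_deriveZ _ _ _ f (lam * E 0 i) _ _ _ (df s s01).
  apply: (eq_is_derive _ _ (@is_deriveD _ _ _ _ _ _ _ _ _ d1 d2)).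
    by move=> r; rewrite rhoE -[RHS]/(_ + _ + _ * _); ring.
  by rewrite /drho !mxE /GRing.scale /=; ring.
exists tau; split; last 2 first.
- apply: heis_eq => [i|].
    by rewrite tauh rho0 -horE hy [RHS]mxE.
  rewrite taum /V rho0 /P /Q /K f0 K20 F0.
  rewrite (_ : GamV 0 = 0 *: h) ?omegaZl; last by apply/rowP => i; rewrite !mxE Gam0 mul0r.
  by ring.
- apply: heis_eq => [i|].
    by rewrite tauh rho1 horE mxE addr0.
  rewrite taum /V rho1 /P /Q /K f1 (_ : GamV 1 = m)// -[X in omega X (hor (sigma 1))](scale0r h) omegaZl.
  move: eqlam; rewrite /vdist omegaDl omegaNl /w.
  rewrite hy.
  rewrite omegaDr omega_self (omegaC h (hor (sigma 0))).
  move: (omega _ _) (omega _ _) (omega _ _) => w1 w2 w3 H.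
  by apply/eqP; rewrite -subr_eq0; apply/eqP; rewrite -[RHS]H; field.
split.
- apply/abs_continuous01P => i; have [[k ->]|->] := hidxP i.
    by apply: (eq_ac01 (fun s => tauh s k)); exact: ac01D.
  apply: (eq_ac01 taum).
  apply: ac01D; last exact: ac01_cst.
  apply: ac01D; first exact: hcurve_coord_ac sc.
  apply: ac01D; first by apply: ac01M; [exact: ac01_cst|exact: ac01_omega].
  apply: ac01D.
    apply: ac01D.
      apply: (eq_ac01 (fun s => esym (mulN1r _))); apply: ac01M; first exact: ac01_cst.
      by apply: ac01_omega => // k; exact: ac01_cst.
    apply: ac01M; first exact: ac01_cst.
    by apply: ac01D => //; apply: ac01M => //; exact: ac01_cst.
  apply: ac01M; first exact: ac01_cst.
  apply: ac01D; last by apply: ac01M => //; exact: ac01_cst.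
  by apply: ac01M => //; apply: (eq_ac01 _ ac1m) => s; rewrite mulN1r.
- move=> i; under eq_fun do rewrite !mxE.
  apply: measurable_funD; first by apply: measurable_funB.
  apply: measurable_funM => //; apply: measurable_funM => //.
  apply: measurable_funB => //.
  by apply: continuous_measurable_fun; exact: gb_continuous.
apply: aeS vc => t vt t01; have v := vt t01; have [sch scm] := (has_velP _ _ _).1 v.
have t01' : 0 <= t <= 1 by move: t01; rewrite in_itv /= => /andP[/ltW-> /ltW->].
have ge : g t = hor (sigma t) 0 j - m 0 j by rewrite /g gbE// in_itv.
have dsig i : is_derive t 1 (fun s => hor (sigma s) 0 i) (c t 0 i).
  by apply: (eq_is_derive (fun s => horE _ i) erefl (sch i)).
have ce : c t - h + (lam * g t) *: E = c t + drho t by rewrite /drho addrA.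
rewrite ce; apply/has_velP; split=> [i|].
  apply: (eq_is_derive (fun s => tauh s i)); first by rewrite mxE.
  exact: (@is_deriveD _ _ _ _ _ _ _ _ _ (dsig i) (drhoP t i t01')).
have -> : hor (tau t) = hor (sigma t) + rho t by apply/rowP => i; rewrite horE tauh [RHS]mxE.
have dO := is_derive_omega2 (fun i => drhoP t i t01') dsig.
have dG : is_derive t 1 (fun s => omega (GamV s) h) (omega (hor (sigma t)) h).
  have := @is_derive_omega2 _ n GamV (fun=> h) (hor (sigma t)) 0 t.
  rewrite -[X in _ + omega _ X](scale0r h) omegaZr mul0r addr0; apply.
    move=> i; rewrite -gbE ?in_itv//.
    by apply: (eq_is_derive _ erefl (dGam i t01')) => s; rewrite mxE.
  by move=> i; rewrite mxE; exact: is_derive_cst.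
have dK : is_derive t 1 K (g t ^+ 2 + m 0 j * g t).
  exact: (@is_deriveD _ _ _ _ _ _ _ _ _ (dK2 t01') (@is_deriveZ _ _ _ f (m 0 j) _ _ _ (df t t01'))).
have dP : is_derive t 1 P (- omega (hor (sigma t)) h + lam * (g t ^+ 2 + m 0 j * g t)).
  exact: (@is_deriveD _ _ _ _ _ _ _ _ _ (@is_deriveN _ _ _ _ _ _ _ dG) (@is_deriveZ _ _ _ K lam _ _ _ dK)).
have dQ : is_derive t 1 Q (2^-1 * w * (((1 + - 1 * t) * g t + f t * (- 1)) + 2 * f t)).
  have d1 := @is_deriveM _ _ _ _ _ _ _ _ (is_derive_affine 1 (- 1) t) (df t t01').
  have d2 := @is_deriveZ _ _ _ F 2 _ _ _ (dF t01').
  exact: (@is_deriveZ _ _ _ _ (2^-1 * w) _ _ _ (@is_deriveD _ _ _ _ _ _ _ _ _ d1 d2)).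
have dV := @is_deriveD _ _ _ _ _ _ _ _ _ scm (@is_deriveD _ _ _ _ _ _ _ _ _
   (@is_deriveZ _ _ _ _ 2^-1 _ _ _ dO) (@is_deriveD _ _ _ _ _ _ _ _ _ dP dQ)).
have dV' := @is_deriveD _ _ _ _ _ _ _ _ _ dV (is_derive_cst (y 0 ord_max - sigma 0 0 ord_max - 2^-1 * omega h (hor (sigma 0))) t (1 : R)).
apply: (eq_is_derive taum _ dV'); rewrite /GRing.scale /= /drho /rho.
have hE : omega E h = - omega h E by rewrite omegaC.
rewrite !(omegaDl, omegaDr, omegaNl, omegaNr, omegaZl, omegaZr) !omega_self hE.
rewrite (omegaC E (hor (sigma t))) (omegaC E (c t)) (omegaC h (hor (sigma t))) (omegaC h (c t)).
rewrite !omegaE /w ge omegaE.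
by field.
Qed.

End Perturbation.

(** * Norm and symplectic estimates for the variation *)

Section VariationTools.
Context {R : realType} {n : nat}.
Local Notation H := (heis R n).
Local Notation leb := (@lebesgue_measure R).

Definition dotp (u w : 'rV[R]_(n + n)) : R := \sum_j u 0 j * w 0 j.

Lemma enorm_sq (u : 'rV[R]_(n + n)) : enorm u ^+ 2 = dotp u u.
Proof.
rewrite sqr_sqrtr; first by apply: eq_bigr => j _; rewrite expr2.
by apply: sumr_ge0 => j _; exact: sqr_ge0.
Qed.

(** This is the tangent bound of the square root at [enorm u ^+ 2]. Its linear term survives
    integration exactly, which is what makes the first variation a linear form. *)
Lemma enorm_add_le (u w : 'rV[R]_(n + n)) : 0 < enorm u ->
  enorm (u + w) <= enorm u + (enorm u)^-1 * (dotp u w + 2^-1 * enorm w ^+ 2).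
Proof.
move=> u0; set l := enorm u.
have l0 : l != 0 by rewrite gt_eqF.
have E2 : enorm (u + w) ^+ 2 = l ^+ 2 + 2 * (dotp u w + 2^-1 * enorm w ^+ 2).
  rewrite /l !enorm_sq /dotp !mulrDr mulrA mulfV// mul1r !mulr_sumr -!big_split /=.
  by apply: eq_bigr => j _; rewrite !mxE; ring.
set X := dotp u w + _ in E2 *.
have X0 : 0 <= l ^+ 2 + 2 * X by rewrite -E2 sqr_ge0.
have pos : 0 <= l + l^-1 * X.
  have : 0 <= l^-1 * (l ^+ 2 + 2 * X) by rewrite mulr_ge0// invr_ge0 ltW.
  have -> : l^-1 * (l ^+ 2 + 2 * X) = l + 2 * (l^-1 * X) by field.
  have := ltW u0; rewrite -/l; lra.
rewrite -(@ler_pXn2r _ 2)// ?nnegrE ?enorm_ge0// E2.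
have -> : (l + l^-1 * X) ^+ 2 = l ^+ 2 + 2 * X + (l^-1 * X) ^+ 2 by field.
by rewrite lerDl sqr_ge0.
Qed.

Lemma enormD_sq (u w : 'rV[R]_(n + n)) : enorm (u + w) ^+ 2 <= 2 * enorm u ^+ 2 + 2 * enorm w ^+ 2.
Proof.
rewrite !enorm_sq /dotp !mulr_sumr -big_split /=; apply: ler_sum => j _.
by rewrite !mxE; have := sqr_ge0 (u 0 j - w 0 j); rewrite expr2; nra.
Qed.

Lemma omega_le (u w : 'rV[R]_(n + n)) : `|omega u w| <= (n + n)%:R * enorm u * enorm w.
Proof.
have := @omega_bound _ _ u w (enorm u) (coord_le_enorm u).
rewrite normrM ger0_norm ?invr_ge0// natrD => h.
have -> : `|omega u w| = 2 * (2^-1 * `|omega u w|) by field.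
by apply: le_trans (ler_wpM2l (ler0n R 2) h) _; rewrite le_eqVlt; apply/orP; left; apply/eqP; ring.
Qed.

(** This is the nondegeneracy of the symplectic form: up to sign, [E] is the basis vector conjugate
    to the j-th one. *)
Lemma omega_dual (j : 'I_(n + n)) :
  exists E : 'rV[R]_(n + n), forall u, omega u E = u 0 j.
Proof.
rewrite -(splitK j); case: (fintype.split j) => k /=.
  exists (delta_mx 0 (rshift n k)) => u; rewrite /omega (bigD1 k)//= big1 => [|i ik].
    by rewrite !mxE !eqxx eq_lrshift mulr1 mulr0 subr0 addr0.
  by rewrite !mxE !eqxx eq_lrshift (inj_eq (@rshift_inj _ _)) (negPf ik) !mulr0 subr0.
exists (- delta_mx 0 (lshift n k)) => u; rewrite omegaNr /omega (bigD1 k)//= big1 => [|i ik].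
  by rewrite !mxE !eqxx eq_rlshift mulr1 mulr0 sub0r addr0 opprK.
by rewrite !mxE !eqxx eq_rlshift (inj_eq (@lshift_inj _ _)) (negPf ik) !mulr0 subr0.
Qed.

Lemma integrable_bounded01 (f : R -> R) (M : R) : measurable_fun setT f ->
  {in `[0, 1], forall t, `|f t| <= M} -> leb.-integrable `[0, 1] (EFin \o f).
Proof.
move=> mf fM; apply/integrableP; split; first by apply/measurable_EFinP; exact: measurable_funTS.
apply: (@le_lt_trans _ _ (\int[leb]_(t in `[0%R, 1%R]) (cst M%:E t))%E).
  apply: ge0_le_integral => //.
  by apply/measurable_EFinP/measurableT_comp => //; exact: measurable_funTS.
by rewrite integral_cst//= lebesgue_measure_itv /= lte_fin ltr01 sube0 mule1 ltry.
Qed.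

Lemma integral_lincomb01 (I : finType) (a0 b : R) (a : I -> R) (phi : I -> R -> R) (psi : R -> R) :
  (forall i, leb.-integrable `[0, 1] (EFin \o phi i)) -> leb.-integrable `[0, 1] (EFin \o psi) ->
  (\int[leb]_(t in `[0%R, 1%R]) (a0 + \sum_i a i * phi i t + b * psi t)%:E)%E =
  (a0 + \sum_i a i * (\int[leb]_(t in `[0, 1]) phi i t) + b * (\int[leb]_(t in `[0, 1]) psi t))%:E.
Proof.
move=> iphi ipsi.
have fphi i : (\int[leb]_(t in `[0%R, 1%R]) (phi i t)%:E)%E \is a fin_num by apply: integrable_fin_num => //; exact: iphi.
have icst : leb.-integrable `[0, 1] (EFin \o cst a0).
  by apply: (@integrable_bounded01 _ `|a0|).
have m01 : measurable (`[0%R, 1%R]%classic : set (measurableTypeR R)) by [].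
have iZ i : leb.-integrable `[0, 1] (fun t => (a i * phi i t)%:E) := integrableZl m01 (a i) (iphi i).
have sE : (fun t => (\sum_i a i * phi i t)%:E) = (fun t => \sum_i (a i * phi i t)%:E)%E.
  by apply/funext => t; rewrite sumEFin.
have isum : leb.-integrable `[0, 1] (fun t => (\sum_i a i * phi i t)%:E).
  by rewrite sE; apply: integrable_sum.
have ib : leb.-integrable `[0, 1] (fun t => (b * psi t)%:E) := integrableZl m01 b ipsi.
have icsum : leb.-integrable `[0, 1] (fun t => (a0 + \sum_i a i * phi i t)%:E).
  exact: (integrableD m01 icst isum).
rewrite -[LHS]/(\int[leb]_(t in `[0%R, 1%R]) ((a0 + \sum_i a i * phi i t)%:E + (b * psi t)%:E))%E.
rewrite integralD//.
rewrite -[X in (X + _)%E]/(\int[leb]_(t in `[0%R, 1%R]) (a0%:E + (\sum_i a i * phi i t)%:E))%E.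
rewrite integralD//.
rewrite integral_cst//= lebesgue_measure_itv /= lte_fin ltr01 sube0 mule1.
rewrite !EFinD; congr (_ + _ + _)%E.
  rewrite sE integral_sum// -sumEFin; apply: eq_bigr => i _.
  by rewrite (integralZl m01 (iphi i)) /Rintegral EFinM fineK.
rewrite (integralZl m01 ipsi) /Rintegral EFinM fineK//.
exact: integrable_fin_num.
Qed.

Lemma exists_ae_itv (P : R -> Prop) : {ae leb, forall t : R, t \in `]0, 1[ -> P t} ->
  exists2 t : R, t \in `]0, 1[ & P t.
Proof.
move=> [N [mN N0 HN]]; apply: contrapT => nex.
have sub : `]0, 1[%classic `<=` N.
  move=> t t01; apply: HN => /= H; apply: nex; exists t => //; exact: H.
have : (leb `]0%R, 1%R[%classic <= leb N)%E by apply: le_measure; rewrite ?inE.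
by rewrite [X in (_ <= X)%E]N0 lebesgue_measure_itv /= lte_fin ltr01 sube0 lee_fin ler10.
Qed.

(** Changing the velocity on a null set, to the arbitrary vector [e] of norm [l], gives pointwise
    bounds on it without exceptional times. *)
Lemma hcurve_const_speed (sigma : R -> H) c (l : R) : (0 < n)%N -> 0 <= l ->
  hcurve sigma c -> {ae leb, forall t : R, t \in `]0, 1[ -> enorm (c t) = l} ->
  exists2 c', hcurve sigma c' & forall t, enorm (c' t) = l.
Proof.
move=> n0 l0 [acs mc vc] cl.
pose e : 'rV[R]_(n + n) := l *: delta_mx 0 (lshift n (Ordinal n0)).
have el : enorm e = l by rewrite enorm_delta ger0_norm.
exists (fun t => if enorm (c t) == l then c t else e); last first.
  by move=> t; case: eqP.
split => //.
  move=> j; rewrite (_ : (fun t => _) = fun t => if enorm (c t) == l then c t 0 j else e 0 j); last first.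
    by apply/funext => t; case: ifP.
  apply: measurable_fun_ifT => //.
  by apply: measurable_fun_eqr => //; exact: measurable_enorm.
by apply: aeS (aeI vc cl) => t [vt ct] t01; rewrite ct// eqxx; exact: vt.
Qed.

(* [K2 j 1] is the variance of the j-th coordinate; if all of them vanished the curve
   would be constant. *)
Lemma nonconstant_coord (sigma : R -> H) c (l : R) (m : 'I_(n + n) -> R)
    (K2 : 'I_(n + n) -> R -> R) : hcurve sigma c -> 0 < l -> (forall t, enorm (c t) = l) ->
  (forall j, K2 j 0 = 0) ->
  (forall j (s : R), 0 <= s <= 1 -> is_derive s 1 (K2 j) ((sigma (clamp01 s) 0 (hidx j) - m j) ^+ 2)) ->
  (forall j (s t : R), 0 <= s -> s < t -> t <= 1 -> exists2 x, x \in `]s, t[ &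
      K2 j t - K2 j s = (sigma (clamp01 x) 0 (hidx j) - m j) ^+ 2 * (t - s)) ->
  exists j, 0 < K2 j 1.
Proof.
move=> [_ _ vc] l0 cl K0 dK mvt; apply: contrapT => nex.
have [t t01 /has_velP[vt _]] := exists_ae_itv vc.
(* [K2 j] increases from 0 to a nonpositive value, so it vanishes. Its derivative then shows that
   each coordinate equals its mean, which contradicts the positive speed at [t]. *)
suff c0 j : c t 0 j = 0.
  have : enorm (c t) = 0.
    by rewrite /enorm big1 ?sqrtr0// => j _; rewrite c0 expr0n.
  by rewrite cl => l00; rewrite l00 ltxx in l0.
have Kle s r : 0 <= s -> s < r -> r <= 1 -> K2 j s <= K2 j r.
  move=> s0 sr r1; have [x _ e] := mvt j s r s0 sr r1.
  by rewrite -subr_ge0 e mulr_ge0 ?sqr_ge0// subr_ge0 ltW.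
have K10 : K2 j 1 <= 0 by rewrite leNgt; apply/negP => K1; apply: nex; exists j.
have Kz s : s \in `]0, 1[ -> K2 j s = 0.
  rewrite in_itv /= => /andP[s0 s1]; apply/eqP; rewrite eq_le.
  by rewrite (le_trans (Kle s 1 (ltW s0) s1 (lexx _)))//= -(K0 j) Kle// ltW.
have near01 (s : R) : s \in `]0, 1[ -> \forall r \near s, r \in `]0, 1[ by exact: near_in_itvoo.
have sz s : s \in `]0, 1[ -> sigma s 0 (hidx j) = m j.
  move=> s01; have s01' : 0 <= s <= 1 by move: s01; rewrite in_itv /= => /andP[/ltW-> /ltW->].
  have d1 := dK j s s01'.
  have d2 : is_derive s 1 (K2 j) 0.
    apply: (near_eq_is_derive _ (is_derive_cst (0 : R) s (1 : R))).
    by apply: filterS (near01 s s01) => r /Kz ->.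
  have : (sigma (clamp01 s) 0 (hidx j) - m j) ^+ 2 = 0.
    by case: d1 => _ <-; case: d2 => _ ->.
  rewrite clamp01_id ?in_itv// => /eqP; rewrite sqrf_eq0 subr_eq0 => /eqP//.
have d3 : is_derive t 1 (fun s => sigma s 0 (hidx j)) 0.
  apply: (near_eq_is_derive _ (is_derive_cst (m j) t (1 : R))).
  by apply: filterS (near01 t t01) => r /sz ->.
by case: (vt j) => _ <-; case: d3 => _ ->.
Qed.

End VariationTools.

(** * First variation of the distance *)

Section Variation.
Context {R : realType} {n : nat}.
Local Notation H := (heis R n).
Local Notation leb := (@lebesgue_measure R).
Hypothesis n_gt0 : (0 < n)%N.

Definition linear_form (A : 'rV[R]_(n + n) -> R) : Prop :=
  (forall u w, A (u + w) = A u + A w) /\ (forall a u, A (a *: u) = a * A u).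

Lemma enorm_le_rd (x y : H) : enorm (hor y - hor x) <= (n + n)%:R * rd x y.
Proof.
have N0 : 0 <= (n + n)%:R * rd x y by rewrite mulr_ge0// rd_ge0.
rewrite -(@ler_pXn2r _ 2)// ?nnegrE ?enorm_ge0// enorm_sq /dotp.
apply: (@le_trans _ _ (\sum_(j < n + n) rd x y ^+ 2)).
  apply: ler_sum => j _; rewrite !mxE -expr2 -[leLHS]ger0_norm ?sqr_ge0// normrX.
  by rewrite ler_pXn2r// ?nnegrE ?rd_ge0//; exact: rd_lower_hor.
rewrite sumr_const card_ord exprMn -[_ *+ _]mulr_natl ler_wpM2r ?sqr_ge0//.
by rewrite expr2 -natrM ler_nat leq_pmulr// addn_gt0 n_gt0.
Qed.

(** [lam] solves the affine equation for the last coordinate. With [v] of order [r ^ 2] and [w0],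
    [b] of order [r], it is [- w0 / K] up to order [r ^ 2], and this main part is linear in the
    horizontal displacement. The condition [B * r <= K / 2] keeps the slope [K + b] away from 0. *)
Lemma root_estimate (K b v w0 N W B r : R) : 0 < K -> `|b| <= B * r -> B * r <= K / 2 ->
  `|v| <= N * r ^+ 2 -> `|w0| <= W * r -> 0 <= r -> r <= 1 -> 0 <= N -> 0 <= W -> 0 <= B ->
  exists lam, [/\ v + w0 + lam * (K + b) = 0, `|lam| <= 2 * (N + W) / K * r &
    `|lam + w0 / K| <= 2 * (N * K + B * W) / K ^+ 2 * r ^+ 2].
Proof.
move=> K0 bB Br vN wW r0 r1 N0 W0 B0.
have bK : `|b| <= K / 2 := le_trans bB Br.
have Kb : K / 2 <= K + b.
  have := ler_norm (- b); rewrite normrN; lra.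
have Kb0 : 0 < K + b by apply: lt_le_trans Kb; rewrite divr_gt0.
have iKb : (K + b)^-1 <= 2 / K.
  by rewrite -[leRHS]invrK invf_div lef_pV2// posrE divr_gt0.
have K2 : 0 <= 2 / K by rewrite divr_ge0// ltW.
exists (- (v + w0) / (K + b)); split.
- by field; rewrite gt_eqF.
- rewrite normrM normrN normfV (gtr0_norm Kb0).
  apply: (@le_trans _ _ (((N + W) * r) * (2 / K))); last first.
    by rewrite le_eqVlt; apply/orP; left; apply/eqP; ring.
  apply: ler_pM => //; first by rewrite invr_ge0 ltW.
  apply: le_trans (ler_normD _ _) _; rewrite mulrDl; apply: lerD => //.
  apply: (le_trans vN); rewrite ler_wpM2l// expr2 ler_piMl//.
- have -> : - (v + w0) / (K + b) + w0 / K = ((w0 * b - v * K) / K) / (K + b).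
    by field; rewrite !gt_eqF.
  rewrite normrM normfV (gtr0_norm Kb0) normrM normfV (gtr0_norm K0).
  apply: (@le_trans _ _ (((N * K + B * W) * r ^+ 2 / K) * (2 / K))); last first.
    by rewrite le_eqVlt; apply/orP; left; apply/eqP; field; rewrite gt_eqF.
  apply: ler_pM => //.
  + by rewrite mulr_ge0// invr_ge0 ltW.
  + by rewrite invr_ge0 ltW.
  rewrite ler_wpM2r ?invr_ge0 ?(ltW K0)//.
  apply: le_trans (ler_normB _ _) _; rewrite !normrM (gtr0_norm K0) addrC mulrDl; apply: lerD.
    by rewrite mulrAC ler_wpM2r// ltW.
  rewrite (_ : B * W * r ^+ 2 = (W * r) * (B * r)); last by ring.
  by apply: ler_pM.
Qed.

(** The distance is at most the length of the perturbed curve, which is estimated by integrating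
    [enorm_add_le] with the change of velocity [- h + lam g E]. *)
Lemma rd_variation (sigma : R -> H) c (l : R) : hcurve sigma c -> 0 < l ->
  (forall t, enorm (c t) = l) ->
  exists A C d, [/\ linear_form A, 0 < d & forall y, rd (sigma 0) y < d ->
    rd y (sigma 1) <= l + A (hor y - hor (sigma 0)) + C * rd (sigma 0) y ^+ 2].
Proof.
move=> sc l0 cl; have [acs mc vc] := sc.
pose gb i (s : R) : R := sigma (clamp01 s) 0 (hidx i).
have cgb i : continuous (gb i) by exact: ac01_clamp_continuous (hcurve_coord_ac (hidx i) sc).
have /choice[Gam GamP] i := exists_primitive (cgb i).
have Gam0 i : Gam i 0 = 0 by have [] := GamP i.
have dGam i (s : R) : 0 <= s <= 1 -> is_derive s 1 (Gam i) (gb i s) by have [_ + _ _] := GamP i; exact.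
have acGam i : ac01 (Gam i) by have [] := GamP i.
pose m : 'rV[R]_(n + n) := \row_i Gam i 1.
have cg2 i : continuous (fun s => (gb i s - m 0 i) ^+ 2).
  move=> s; apply: (@continuous_comp _ _ _ (fun s => gb i s - m 0 i) (fun x => x ^+ 2)); last exact: exprn_continuous.
  by apply: cvgB; [exact: cgb|exact: cvg_cst].
have /choice[K2 K2P] i := exists_primitive (cg2 i).
have [j Kj0] : exists j, 0 < K2 j 1.
  apply: (@nonconstant_coord _ _ sigma c l (fun i => m 0 i) K2) => // i.
  - by have [] := K2P i.
  - by have [_ + _ _] := K2P i.
  - by have [_ _ _] := K2P i.
have [K20 dK2 acK2 _] := K2P j.
have [E omE] := @omega_dual R n j.
pose g (s : R) := gb j s - m 0 j.
pose f (s : R) := Gam j s + - m 0 j * s.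
have acf : ac01 f.
  by apply: ac01D => //; apply: ac01M; [exact: ac01_cst|apply: (@ac01_lip _ _ 1) => s t _ _; rewrite mul1r].
have [F [F0 dF acF _]] := exists_primitive (ac01_clamp_continuous acf).
have dF' (s : R) : 0 <= s <= 1 -> is_derive s 1 F (f s).
  by move=> s01; have := dF s s01; rewrite /= clamp01_id// in_itv.
have acg : ac01 (fun s => gb j s - m 0 j).
  apply: (@ac01D _ (gb j) (fun=> - m 0 j)); last exact: ac01_cst.
  apply: (@ac01_comp_homo _ (fun s => sigma s 0 (hidx j)) (@clamp01 R) 1).
  - exact: hcurve_coord_ac sc.
  - by move=> t _; exact: clamp01_in.
  - by move=> s t /clamp01_id -> /clamp01_id ->.
  - by move=> s t _ _; rewrite mul1r clamp01_lip.
have [G G0 gG] := ac01_bounded acg.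
have mg : measurable_fun setT g.
  by apply: continuous_measurable_fun => s; apply: cvgB; [exact: cgb|exact: cvg_cst].
pose psi (t : R) := g t * dotp (c t) E.
have mpsi : measurable_fun setT psi.
  by apply: measurable_funM => //; apply: measurable_sum => i; exact: measurable_funM.
have ipsi : leb.-integrable `[0, 1] (EFin \o psi).
  apply: (@integrable_bounded01 _ _ (G * \sum_i l * `|E 0 i|)) => // t t01.
  rewrite normrM; apply: ler_pM => //; first exact: gG.
  apply: le_trans (ler_norm_sum _ _ _) _; apply: ler_sum => i _.
  by rewrite normrM ler_wpM2r// -(cl t) coord_le_enorm.
have ic i : leb.-integrable `[0, 1] (EFin \o (fun t => c t 0 i)).
  by apply: (@integrable_bounded01 _ _ l) => // t _; rewrite -(cl t) coord_le_enorm.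
pose I i : R := \int[leb]_(t in `[0, 1]) c t 0 i.
pose J : R := \int[leb]_(t in `[0, 1]) psi t.
pose K := K2 j 1.
pose w0 u := omega (hor (sigma 0) - m) u.
pose N : R := (n + n)%:R.
pose W : R := N * enorm (hor (sigma 0) - m) * N.
pose B : R := N * N * enorm E * `|F 1|.
have N0 : 0 <= N by [].
have W0 : 0 <= W by rewrite !mulr_ge0// enorm_ge0.
have B0 : 0 <= B by rewrite !mulr_ge0// enorm_ge0.
(* The first-order change of length: [- u] is paired with the mean velocity [I], and [lam] times [J]
   enters with [lam] replaced by its main part [- w0 u / K]. *)
pose A (u : 'rV[R]_(n + n)) : R := l^-1 * (\sum_i - u 0 i * I i - (J / K) * w0 u).
pose L1 := 2 * (N + W) / K.
pose C1 := 2 * (N * K + B * W) / K ^+ 2.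
(* [C2 * r ^+ 2] bounds the squared change of velocity, and [C1 * r ^+ 2] bounds the error made in
   [lam]. *)
pose C2 := 2 * N ^+ 2 + 2 * (L1 * G * enorm E) ^+ 2.
pose C := l^-1 * (`|J| * C1 + 2^-1 * C2).
(* The radius gives the two smallness conditions of [root_estimate], namely [r <= 1] and
   [B * r <= K / 2]. *)
exists A, C, (Num.min 1 (K / (2 * (B + 1)))); split.
- split=> [u w|a u]; rewrite /A /w0.
    rewrite omegaDr (eq_bigr (fun i => - u 0 i * I i + - w 0 i * I i)).
      by rewrite big_split /=; ring.
    by move=> i _; rewrite mxE; ring.
  rewrite omegaZr (eq_bigr (fun i => a * (- u 0 i * I i))).
    by rewrite -mulr_sumr; ring.
  by move=> i _; rewrite mxE; ring.
- by rewrite lt_min ltr01 divr_gt0// mulr_gt0// ltr_wpDl.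
move=> y; rewrite lt_min => /andP[r1 rB].
set r := rd (sigma 0) y in r1 rB *; set h := hor y - hor (sigma 0); set v := vdist (sigma 0) y.
have r0 : 0 <= r := rd_ge0 _ _.
have hr : enorm h <= N * r := enorm_le_rd _ _.
have vr : `|v| <= N * r ^+ 2.
  apply: le_trans (rd_lower_v n_gt0 _ _) _; rewrite ler_wpM2r ?sqr_ge0//.
  by rewrite /N ler_nat leq_addr.
have wr : `|w0 h| <= W * r.
  apply: le_trans (omega_le _ _) _; rewrite /W -!mulrA ler_wpM2l// ler_wpM2l ?enorm_ge0//.
have br : `|omega h E * F 1| <= B * r.
  rewrite normrM /B [leRHS]mulrAC ler_wpM2r//; apply: le_trans (omega_le _ _) _.
  rewrite [leRHS]mulrAC ler_wpM2r ?enorm_ge0// -mulrA ler_wpM2l//.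
have Br : B * r <= K / 2.
  have : r * (2 * (B + 1)) < K by rewrite -ltr_pdivlMr// mulr_gt0// ltr_wpDl.
  by move: r0; clear; nra.
have [lam [eqlam lamL lamw]] := root_estimate Kj0 br Br vr wr r0 (ltW r1) N0 W0 B0.
have [tau [tc tau0 tau1]] := perturbed_hcurve sc omE Gam0 dGam acGam K20 dK2 acK2 F0 dF' acF eqlam.
rewrite -lee_fin -dSRE// -tau0 -tau1; apply: le_trans (dSR_le tc) _.
pose D := 2^-1 * (C2 * r ^+ 2).
have wle (t : R) : t \in `[0, 1] -> enorm (- h + (lam * g t) *: E) ^+ 2 <= C2 * r ^+ 2.
  move=> t01; apply: le_trans (enormD_sq _ _) _; rewrite /C2 [leRHS]mulrDl; apply: lerD.
    rewrite -scaleN1r enormZ normrN1 mul1r -mulrA -exprMn ler_pM2l// ler_pXn2r// ?nnegrE ?enorm_ge0//.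
    by rewrite mulr_ge0.
  rewrite -mulrA -exprMn ler_pM2l// ler_pXn2r// ?nnegrE ?enorm_ge0//; last first.
    by rewrite !mulr_ge0 ?enorm_ge0 ?(ltW G0) ?invr_ge0 ?(ltW Kj0)// addr_ge0.
  rewrite enormZ (_ : L1 * G * enorm E * r = (L1 * r) * G * enorm E); last by ring.
  rewrite ler_wpM2r ?enorm_ge0// normrM; apply: ler_pM => //; exact: gG.
have key (t : R) : t \in `[0, 1] -> enorm (c t - h + (lam * g t) *: E) <=
    (l + l^-1 * D) + \sum_i (l^-1 * - h 0 i) * c t 0 i + (l^-1 * lam) * psi t.
  move=> t01; rewrite -addrA.
  have ct0 : 0 < enorm (c t) by rewrite cl.
  apply: le_trans (enorm_add_le _ ct0) _; rewrite cl.
  have -> : dotp (c t) (- h + (lam * g t) *: E) = \sum_i - h 0 i * c t 0 i + lam * psi t.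
    rewrite /psi /dotp !mulr_sumr -big_split /=; apply: eq_bigr => i _.
    by rewrite !mxE; ring.
  have -> : \sum_i l^-1 * - h 0 i * c t 0 i = l^-1 * \sum_i - h 0 i * c t 0 i.
    by rewrite mulr_sumr; apply: eq_bigr => i _; rewrite mulrA.
  rewrite -!addrA lerD2l -mulrA -!mulrDr ler_wpM2l ?invr_ge0 ?(ltW l0)//.
  rewrite [D + _]addrC [leRHS]addrC addrA [leRHS]addrC lerD2l.
  by rewrite /D ler_wpM2l ?invr_ge0// wle.
apply: (@le_trans _ _ (\int[leb]_(t in `[0%R, 1%R])
   ((l + l^-1 * D) + \sum_i (l^-1 * - h 0 i) * c t 0 i + (l^-1 * lam) * psi t)%:E)%E).
  apply: ge0_ae_le_nmintegral_in.
  - by move=> t _; rewrite lee_fin enorm_ge0.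
  - by move=> t t01; rewrite lee_fin (le_trans _ (key t t01))// enorm_ge0.
  - by apply: aeW => t t01; rewrite lee_fin key.
rewrite integral_lincomb01// lee_fin -/J.
have -> : \sum_i l^-1 * - h 0 i * (\int[leb]_(t in `[0, 1]) c t 0 i) = l^-1 * \sum_i - h 0 i * I i.
  by rewrite mulr_sumr; apply: eq_bigr => i _; rewrite mulrA.
have JC : (lam + w0 h / K) * J <= `|J| * C1 * r ^+ 2.
  apply: le_trans (ler_norm _) _; rewrite normrM mulrC -mulrA ler_wpM2l//.
rewrite /A /C /D -!addrA lerD2l -!mulrA -!mulrDr ler_wpM2l ?invr_ge0 ?(ltW l0)//.
rewrite mulrDl in JC; rewrite -subr_ge0.
have -> : \sum_i - h 0 i * I i - J * (K^-1 * w0 h) + (`|J| * C1 + 2^-1 * C2) * r ^+ 2 -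
   (2^-1 * (C2 * r ^+ 2) + (\sum_i - h 0 i * I i + lam * J)) =
   `|J| * C1 * r ^+ 2 - (lam * J + w0 h / K * J) by ring.
by rewrite subr_ge0.
Qed.

End Variation.

(** * Potentials along transport rays *)

Section Rays.
Context {R : realType} {n : nat}.
Local Notation H := (heis R n).
Local Notation leb := (@lebesgue_measure R).
Hypothesis n_gt0 : (0 < n)%N.
Implicit Types (x y z w : H) (sigma : R -> H).

Lemma Lip1_rd (u : H -> R) x y : Lip1 u -> `|u x - u y| <= rd x y.
Proof. by move=> /(_ x y); rewrite dSRE// lee_fin. Qed.

Lemma geodesic_hcurve sigma : geodesic sigma -> exists2 c, hcurve sigma c &
  forall t, enorm (c t) = rd (sigma 0) (sigma 1).
Proof.
move=> [hs sl sp]; have [c sc] := horizontal_hcurve hs.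
apply: (hcurve_const_speed n_gt0 (rd_ge0 _ _) sc).
apply: aeS (aeI sp (has_vel_enorm_horizontal sc)) => t [st ct] t01.
have t01' : t \in `[0, 1] by move: t01; rewrite !in_itv /= => /andP[/ltW-> /ltW->].
by apply/EFin_inj; rewrite -dSRE// -sl -(st t01') ct.
Qed.

Lemma hlen_const (c : R -> 'rV[R]_(n + n)) (l : R) : (forall t, enorm (c t) = l) ->
  (\int[leb]_(t in `[0%R, 1%R]) (enorm (c t))%:E)%E = l%:E.
Proof.
move=> cl; under eq_integral do rewrite cl.
by rewrite integral_cst//= lebesgue_measure_itv /= lte_fin ltr01 sube0 mule1.
Qed.

Lemma hcurve_sub_rd sigma c (l s t : R) : hcurve sigma c -> (forall t, enorm (c t) = l) ->
  s \in `[0, 1] -> t \in `[0, 1] -> rd (sigma s) (sigma t) <= `|t - s| * l.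
Proof.
move=> sc cl s01 t01; have [->|st] := eqVneq s t; first by rewrite rd_xx// subrr normr0 mul0r.
have ts0 : t - s != 0 by rewrite subr_eq0 eq_sym.
have t01' : s + (t - s) \in `[0, 1] by rewrite addrC subrK.
have := dSR_le (hcurve_affine ts0 s01 t01' sc).
rewrite mulr0 mulr1 addr0 [s + _]addrC subrK dSRE//.
by rewrite (@hlen_const _ (`|t - s| * l)) ?lee_fin// => r; rewrite enormZ cl.
Qed.

(** The Lipschitz bounds on the two pieces of the curve at [t] add up to the total drop [l], so both
    are equalities. *)
Lemma ray_values (u : H -> R) sigma c (l t : R) : Lip1 u -> hcurve sigma c ->
  (forall t, enorm (c t) = l) -> u (sigma 0) - u (sigma 1) = l -> t \in `[0, 1] ->
  u (sigma t) = u (sigma 0) - t * l.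
Proof.
move=> Lu sc cl ul t01; move: (t01); rewrite in_itv /= => /andP[t0 t1].
have i0 : 0 \in (`[0, 1] : interval R) by rewrite in_itv /= lexx ler01.
have i1 : 1 \in (`[0, 1] : interval R) by rewrite in_itv /= lexx ler01.
have h1 := le_trans (Lip1_rd (sigma 0) (sigma t) Lu) (hcurve_sub_rd sc cl i0 t01).
have h2 := le_trans (Lip1_rd (sigma t) (sigma 1) Lu) (hcurve_sub_rd sc cl t01 i1).
rewrite subr0 [`|t|]ger0_norm// in h1; rewrite [`|1 - t|]ger0_norm ?subr_ge0// in h2.
have := le_trans (ler_norm _) h1; have := le_trans (ler_norm _) h2.
by clear -ul; lra.
Qed.

Lemma hor_hstepB z (e : 'rV[R]_(n + n)) : hor (hstep z e) - hor z = e.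
Proof. by rewrite hor_hstep addrC addKr. Qed.

Lemma rd_hstep z (e : 'rV[R]_(n + n)) : rd z (hstep z e) <= enorm e.
Proof. by rewrite -lee_fin -dSRE// dSR_hstep. Qed.

Lemma linear_form_sum (A : 'rV[R]_(n + n) -> R) (w : 'rV[R]_(n + n)) : linear_form A ->
  A w = dotp (\row_j A (delta_mx 0 j)) w.
Proof.
move=> [AD AZ]; have A0 : A 0 = 0 by rewrite -(scale0r 0) AZ mul0r.
rewrite {1}(row_sum_delta w) (big_morph A AD A0); apply: eq_bigr => j _.
by rewrite AZ mxE mulrC.
Qed.

(** If [B e < 0], scaling [e] by a small [s] makes the quadratic bound negligible against the linear
    term. The opposite sign follows by applying this to [- e]. *)
Lemma linear_form_small (B : 'rV[R]_(n + n) -> R) (C d : R) : linear_form B -> 0 < d ->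
  (forall e, enorm e < d -> - (C * enorm e ^+ 2) <= B e) -> forall e, B e = 0.
Proof.
move=> [BD BZ] d0 HB.
suff B0 e : 0 <= B e.
  move=> e; apply/eqP; rewrite eq_le B0 andbT -oppr_ge0 -mulN1r -BZ; exact: B0.
rewrite leNgt; apply/negP => Be.
have N0 := enorm_ge0 e.
pose s := Num.min (d / (enorm e + 1) / 2) (- B e / (`|C| * enorm e ^+ 2 + 1) / 2).
have s1 : 0 < enorm e + 1 by rewrite ltr_wpDl.
have s2 : 0 < `|C| * enorm e ^+ 2 + 1 by rewrite ltr_wpDl// mulr_ge0// sqr_ge0.
have s0 : 0 < s by rewrite lt_min !divr_gt0// oppr_gt0.
have sd : enorm (s *: e) < d.
  rewrite enormZ gtr0_norm//.
  have : s <= d / (enorm e + 1) / 2 by rewrite ge_min lexx.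
  rewrite -(ler_pM2r s1) mulrAC divfK ?gt_eqF// => h.
  by move: N0 s0 d0 h; clear; nra.
have := HB _ sd; rewrite BZ enormZ (gtr0_norm s0) exprMn.
have -> : C * (s ^+ 2 * enorm e ^+ 2) = s * (s * (C * enorm e ^+ 2)) by ring.
rewrite -mulrN ler_pM2l// lerNl => h.
have : s <= - B e / (`|C| * enorm e ^+ 2 + 1) / 2 by rewrite ge_min lexx orbT.
rewrite -(ler_pM2r s2) mulrAC divfK ?gt_eqF// => h2.
have h3 : s * (C * enorm e ^+ 2) <= s * (`|C| * enorm e ^+ 2).
  by rewrite ler_pM2l// ler_wpM2r ?sqr_ge0// ler_norm.
move: h h2 h3 Be s0; clear; nra.
Qed.

(* The expansions of the distances to both endpoints bound u from above and from
   below; the two linear parts agree because they touch at sigma t. *)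
Lemma ray_first_order (u : H -> R) sigma c (l t : R) : Lip1 u -> hcurve sigma c -> 0 < l ->
  (forall t, enorm (c t) = l) -> u (sigma 0) - u (sigma 1) = l -> t \in `]0, 1[ ->
  exists A C d, [/\ linear_form A, 0 <= C, 0 < d & forall w, rd (sigma t) w < d ->
    `|u w - u (sigma t) - A (hor w - hor (sigma t))| <= C * rd (sigma t) w ^+ 2].
Proof.
move=> Lu sc l0 cl ul t01.
have t01' : t \in `[0, 1] by move: t01; rewrite !in_itv /= => /andP[/ltW-> /ltW->].
have ut := ray_values Lu sc cl ul t01'.
move: (t01); rewrite in_itv /= => /andP[t0 t1].
have i0 : t + - t \in (`[0, 1] : interval R) by rewrite subrr in_itv /= lexx ler01.
have i1 : t + (1 - t) \in (`[0, 1] : interval R) by rewrite addrC subrK in_itv /= lexx ler01.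
have tn0 : - t != 0 by rewrite oppr_eq0 gt_eqF.
have t1n0 : 1 - t != 0 by rewrite gt_eqF// subr_gt0.
(* Both pieces start at [sigma t]: [sc1] runs forward to [sigma 1] and [sc2] backward to [sigma 0],
   so that each variation moves the common point. *)
have sc1 := hcurve_affine t1n0 t01' i1 sc.
have sc2 := hcurve_affine tn0 t01' i0 sc.
have l1 : 0 < (1 - t) * l by rewrite mulr_gt0// subr_gt0.
have l2 : 0 < t * l by rewrite mulr_gt0.
have [A1 [C1 [d1 [LA1 d10 H1]]]] : exists A C d, [/\ linear_form A, 0 < d & forall y, rd (sigma t) y < d ->
    rd y (sigma 1) <= (1 - t) * l + A (hor y - hor (sigma t)) + C * rd (sigma t) y ^+ 2].
  have := rd_variation n_gt0 sc1 l1; rewrite mulr0 mulr1 addr0 [t + _]addrC subrK; apply.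
  by move=> s; rewrite enormZ cl gtr0_norm// subr_gt0.
have [A2 [C2 [d2 [LA2 d20 H2]]]] : exists A C d, [/\ linear_form A, 0 < d & forall y, rd (sigma t) y < d ->
    rd y (sigma 0) <= t * l + A (hor y - hor (sigma t)) + C * rd (sigma t) y ^+ 2].
  have := rd_variation n_gt0 sc2 l2; rewrite mulr0 mulr1 addr0 subrr; apply.
  by move=> s; rewrite enormZ cl normrN gtr0_norm.
have up w : rd (sigma t) w < d1 -> u w - u (sigma t) <= A1 (hor w - hor (sigma t)) + C1 * rd (sigma t) w ^+ 2.
  move=> /H1 h; have := le_trans (ler_norm _) (Lip1_rd w (sigma 1) Lu).
  by move: h ul ut; clear; lra.
have lo w : rd (sigma t) w < d2 -> - A2 (hor w - hor (sigma t)) - C2 * rd (sigma t) w ^+ 2 <= u w - u (sigma t).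
  move=> /H2 h; have := le_trans (ler_norm _) (Lip1_rd (sigma 0) w Lu); rewrite rdC//.
  by move: h ul ut; clear; lra.
(* Horizontal steps from [sigma t] realize every direction [e] at distance at most [enorm e].
   Comparing the upper and the lower bound there leaves a linear form bounded below by a quadratic
   one. *)
have A12 e : A1 e + A2 e = 0.
  apply: (@linear_form_small (fun e => A1 e + A2 e) (`|C1| + `|C2|) (Num.min d1 d2)).
  - case: LA1 LA2 => [D1 Z1] [D2 Z2]; split=> [v w|a v]; first by rewrite D1 D2; ring.
    by rewrite Z1 Z2; ring.
  - by rewrite lt_min d10.
  move=> {}e; rewrite lt_min => /andP[ed1 ed2].
  have r1 := rd_hstep (sigma t) e.
  have := le_trans (lo _ (le_lt_trans r1 ed2)) (up _ (le_lt_trans r1 ed1)).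
  rewrite hor_hstepB => h.
  have re : rd (sigma t) (hstep (sigma t) e) ^+ 2 <= enorm e ^+ 2.
    by rewrite ler_pXn2r// ?nnegrE ?enorm_ge0 ?rd_ge0.
  have h1 : C1 * rd (sigma t) (hstep (sigma t) e) ^+ 2 <= `|C1| * enorm e ^+ 2.
    by apply: le_trans (ler_norm _) _; rewrite normrM ler_wpM2l// ger0_norm ?sqr_ge0.
  have h2 : C2 * rd (sigma t) (hstep (sigma t) e) ^+ 2 <= `|C2| * enorm e ^+ 2.
    by apply: le_trans (ler_norm _) _; rewrite normrM ler_wpM2l// ger0_norm ?sqr_ge0.
  by move: h h1 h2; clear; lra.
exists A1, (`|C1| + `|C2|), (Num.min d1 d2); split => //.
  by rewrite lt_min d10.
move=> w; rewrite lt_min => /andP[wd1 wd2].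
have := up w wd1; have := lo w wd2; have := A12 (hor w - hor (sigma t)).
have r2 := sqr_ge0 (rd (sigma t) w).
have h1 : C1 * rd (sigma t) w ^+ 2 <= `|C1| * rd (sigma t) w ^+ 2 by rewrite ler_wpM2r// ler_norm.
have h2 : C2 * rd (sigma t) w ^+ 2 <= `|C2| * rd (sigma t) w ^+ 2 by rewrite ler_wpM2r// ler_norm.
have h3 : 0 <= `|C1| * rd (sigma t) w ^+ 2 by rewrite mulr_ge0.
have h4 : 0 <= `|C2| * rd (sigma t) w ^+ 2 by rewrite mulr_ge0.
by move=> a b e; rewrite ler_norml mulrDl; move: a b e h1 h2 h3 h4; clear; lra.
Qed.

(* The same parameter bounds the remainder and the size of the neighbourhood, so that
   the points admitting such an expansion form a countable union over k. *)
Definition taylor2 (u : H -> R) x (k : R) : Prop := forall w, rd x w < k^-1 ->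
  `|u w - u x - dotp (hgrad u x) (hor w - hor x)| <= k * rd x w ^+ 2.

Lemma XfieldE z (j : 'I_(n + n)) (s : R) : s *: Xfield j z + z = hstep z (s *: delta_mx 0 j).
Proof. by rewrite /hstep addrC -scalemxAl -rowE rowK. Qed.

(** A step [s] along [Xfield j z] changes the horizontal part by exactly [s] times a basis vector
    and covers a distance at most [|s|], so the quadratic remainder disappears from the difference
    quotients. *)
Lemma first_order_hgrad (u : H -> R) z (A : 'rV[R]_(n + n) -> R) (C d : R) :
  linear_form A -> 0 <= C -> 0 < d ->
  (forall w, rd z w < d -> `|u w - u z - A (hor w - hor z)| <= C * rd z w ^+ 2) ->
  (forall j, derivable u z (Xfield j z)) /\ (forall e, A e = dotp (hgrad u z) e).
Proof.
move=> LA C0 d0 HA.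
have dA j : (fun s : R => s^-1 *: (u (s *: Xfield j z + z) - u z)) @ 0^' --> A (delta_mx 0 j).
  apply/cvgrPdist_le => e e0.
  exists (Num.min d (e / (C + 1))) => /=; first by rewrite lt_min d0 divr_gt0// ltr_wpDl.
  move=> s /=; rewrite sub0r normrN lt_min => /andP[sd se] s0.
  have s0' : 0 < `|s| by rewrite normr_gt0.
  rewrite XfieldE; set w := hstep _ _.
  have rw : rd z w <= `|s| by rewrite -[leRHS](enorm_delta s j); exact: rd_hstep.
  have := HA w (le_lt_trans rw sd); rewrite hor_hstepB.
  case: LA => _ ->; rewrite [_ *: _]mulrC => h.
  rewrite -(ler_pM2r s0') -normrM.
  have -> : (A (delta_mx 0 j) - (u w - u z) / s) * s = - (u w - u z - s * A (delta_mx 0 j)) by field.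
  rewrite normrN; apply: le_trans h _; apply: (@le_trans _ _ (C * `|s| ^+ 2)).
    by rewrite ler_wpM2l// ler_pXn2r// ?nnegrE ?rd_ge0.
  rewrite expr2 mulrA ler_wpM2r//.
  have : `|s| * (C + 1) < e by rewrite -ltr_pdivlMr// ltr_wpDl.
  by move: s0'; clear; nra.
split=> [j|e]; first by apply/cvg_ex; exists (A (delta_mx 0 j)); exact: dA.
rewrite (linear_form_sum _ LA); congr dotp; apply/rowP => j; rewrite !mxE.
by apply/esym/cvg_lim => //; exact: dA.
Qed.

Lemma ray_taylor2 (u : H -> R) sigma c (l t : R) : Lip1 u -> hcurve sigma c -> 0 < l ->
  (forall t, enorm (c t) = l) -> u (sigma 0) - u (sigma 1) = l -> t \in `]0, 1[ ->
  exists k : nat, taylor2 u (sigma t) k.+1%:R.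
Proof.
move=> Lu sc l0 cl ul t01.
have [A [C [d [LA C0 d0 HA]]]] := ray_first_order Lu sc l0 cl ul t01.
have [_ Ae] := first_order_hgrad LA C0 d0 HA.
pose k := Num.truncn (Num.max C d^-1).
exists k => w; have kM : Num.max C d^-1 < k.+1%:R by rewrite truncnS_gt.
move: kM; rewrite gt_max => /andP[kC kd] wk.
rewrite -Ae; apply: le_trans (HA w _) _.
  by apply: lt_trans wk _; rewrite -[ltRHS]invrK ltf_pV2 ?posrE ?invr_gt0 ?ltr0n.
by rewrite ler_wpM2r ?sqr_ge0// ltW.
Qed.

(** With [a] the gradient at [sigma t], the linear decay of u gives [dotp a (c t) = - l]. Together
    with [enorm (c t) = l] and [enorm a <= 1], expanding the square shows that the norm of
    [c t + l *: a] vanishes. *)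
Lemma ray_velocity (u : H -> R) sigma c (l : R) : Lip1 u -> hcurve sigma c -> 0 < l ->
  (forall t, enorm (c t) = l) -> u (sigma 0) - u (sigma 1) = l ->
  {ae leb, forall t : R, t \in `]0, 1[ -> c t = - (l *: hgrad u (sigma t))}.
Proof.
move=> Lu sc l0 cl ul; have [_ _ vc] := sc.
apply: aeS vc => t vt t01; have /has_velP[sch _] := vt t01.
have [A [C [d [LA C0 d0 HA]]]] := ray_first_order Lu sc l0 cl ul t01.
have [_ Ae] := first_order_hgrad LA C0 d0 HA.
set a := hgrad u (sigma t) in Ae *.
have d1 : is_derive t 1 (fun s => dotp a (hor (sigma s))) (dotp a (c t)).
  apply: is_derive_sum_fun => j.
  apply: (@is_deriveZ _ _ _ (fun s => hor (sigma s) 0 j) (a 0 j)).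
  exact: (eq_is_derive (fun s => horE _ j) erefl (sch j)).
have d2 : is_derive t 1 (fun s => dotp a (hor (sigma s))) (- l).
  apply/is_deriveP => e e0.
  move: (t01); rewrite in_itv /= => /andP[t0 t1].
  exists (Num.min (Num.min t (1 - t)) (Num.min (d / l) (e / (C * l ^+ 2 + 1)))).
    by rewrite !lt_min t0 subr_gt0 t1 !divr_gt0// ltr_wpDl// mulr_ge0// sqr_ge0.
  move=> s; rewrite !lt_min => /andP[/andP[st s1t] /andP[sd se]].
  have tin : t \in `[0, 1] by rewrite in_itv /= !ltW.
  have sin : t + s \in `[0, 1].
    rewrite in_itv /=; have := ler_norm s; have := ler_norm (- s); rewrite normrN.
    by move: st s1t; clear; lra.
  have rs := hcurve_sub_rd sc cl tin sin; rewrite addrAC subrr add0r in rs.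
  have := HA (sigma (t + s)) (le_lt_trans rs _).
  rewrite -ltr_pdivlMr// => /(_ sd).
  rewrite (ray_values Lu sc cl ul sin) (ray_values Lu sc cl ul tin) Ae => h.
  have dotB (v w : 'rV[R]_(n + n)) : dotp a (v - w) = dotp a v - dotp a w.
    by rewrite /dotp -sumrB; apply: eq_bigr => j _; rewrite !mxE mulrBr.
  rewrite -dotB -normrN (_ : - (dotp a (hor (sigma (t + s)) - hor (sigma t)) - s * - l) = u (sigma 0) - (t + s) * l - (u (sigma 0) - t * l) -
      dotp a (hor (sigma (t + s)) - hor (sigma t))); last by ring.
  apply: le_trans h _; apply: (@le_trans _ _ (C * (`|s| * l) ^+ 2)).
    by rewrite ler_wpM2l// ler_pXn2r// ?nnegrE ?rd_ge0// mulr_ge0// ltW.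
  rewrite exprMn (_ : C * (`|s| ^+ 2 * l ^+ 2) = (C * l ^+ 2 * `|s|) * `|s|); last by ring.
  rewrite ler_wpM2r//.
  have : `|s| * (C * l ^+ 2 + 1) < e by rewrite -ltr_pdivlMr// ltr_wpDl// mulr_ge0// sqr_ge0.
  by have := normr_ge0 s; clear; nra.
have ac : dotp a (c t) = - l.
  by case: d1 => _ <-; case: d2 => _ ->.
(* A step [s *: a] raises u by about [s * enorm a ^+ 2] over a distance at most [s * enorm a]. If
   [enorm a > 1], this breaks the Lipschitz bound as soon as [s] makes the remainder small. *)
have a1 : enorm a <= 1.
  rewrite leNgt; apply/negP => a1.
  have a0 : 0 < enorm a by rewrite (lt_trans _ a1).
  pose s := Num.min (d / enorm a / 2) ((enorm a - 1) / (C * enorm a + 1) / 2).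
  have p1 : 0 < C * enorm a + 1 by rewrite ltr_wpDl// mulr_ge0// ltW.
  have s0 : 0 < s by rewrite lt_min !divr_gt0// subr_gt0.
  have es : enorm (s *: a) = s * enorm a by rewrite enormZ gtr0_norm.
  have rs := rd_hstep (sigma t) (s *: a); rewrite es in rs.
  have sd : s * enorm a < d.
    have : s <= d / enorm a / 2 by rewrite ge_min lexx.
    rewrite -(ler_pM2r a0) mulrAC divfK ?gt_eqF//.
    by move: d0; clear; lra.
  have := HA _ (le_lt_trans rs sd); rewrite hor_hstepB.
  case: LA => _ ->; rewrite Ae -enorm_sq.
  have Lr := le_trans (Lip1_rd (hstep (sigma t) (s *: a)) (sigma t) Lu) _.
  have {}Lr : `|u (hstep (sigma t) (s *: a)) - u (sigma t)| <= s * enorm a by apply: Lr; rewrite rdC.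
  have := le_trans (ler_norm _) Lr.
  have r2 : C * rd (sigma t) (hstep (sigma t) (s *: a)) ^+ 2 <= C * (s * enorm a) ^+ 2.
    by rewrite ler_wpM2l// ler_pXn2r// ?nnegrE ?rd_ge0// mulr_ge0// ltW.
  move=> q1; rewrite ler_norml => /andP[q2 _].
  have : s * (C * enorm a + 1) <= (enorm a - 1) / 2.
    have : s <= (enorm a - 1) / (C * enorm a + 1) / 2 by rewrite ge_min lexx orbT.
    by rewrite -(ler_pM2r p1) mulrAC divfK ?gt_eqF.
  have : s * enorm a ^+ 2 <= s * enorm a + C * (s * enorm a) ^+ 2.
    by move: q1 q2 r2; clear; lra.
  rewrite exprMn (_ : s * enorm a + C * (s ^+ 2 * enorm a ^+ 2) = s * (enorm a * (1 + s * (C * enorm a)))); last by ring.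
  rewrite ler_pM2l// expr2 ler_pM2l//.
  by move: s0 a1; clear; lra.
have z0 : enorm (c t + l *: a) ^+ 2 <= 0.
  have -> : enorm (c t + l *: a) ^+ 2 = enorm (c t) ^+ 2 + 2 * l * dotp a (c t) + l ^+ 2 * enorm a ^+ 2.
    rewrite !enorm_sq /dotp !mulr_sumr -!big_split /=; apply: eq_bigr => j _.
    by rewrite !mxE; ring.
  rewrite cl ac.
  have : l ^+ 2 * enorm a ^+ 2 <= l ^+ 2 * 1 by rewrite ler_wpM2l ?sqr_ge0// expr_le1// enorm_ge0.
  by rewrite mulr1 expr2; lra.
have {}z0 : enorm (c t + l *: a) = 0.
  by apply/eqP; rewrite -sqrf_eq0 eq_le z0 sqr_ge0.
apply/eqP; rewrite -addr_eq0; apply/eqP/rowP => j; rewrite [RHS]mxE.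
by apply/eqP; rewrite -normr_eq0 eq_le normr_ge0 andbT -z0 coord_le_enorm.
Qed.

End Rays.

(** * Borel structure *)

Section HeisTopology.
Context {R : realType} {n : nat}.
Local Notation H := (heis R n).
Local Notation BH := (borelH R n).
Hypothesis n_gt0 : (0 < n)%N.
Implicit Types (x y z w : H) (u : H -> R).

Section RealContinuity.
Variable T : topologicalType.
Implicit Types f g : T -> R.

Lemma contD f g : continuous f -> continuous g -> continuous (fun t => f t + g t).
Proof. by move=> cf cg x; apply: cvgD; [exact: cf|exact: cg]. Qed.

Lemma contB f g : continuous f -> continuous g -> continuous (fun t => f t - g t).
Proof. by move=> cf cg x; apply: cvgB; [exact: cf|exact: cg]. Qed.

Lemma contM f g : continuous f -> continuous g -> continuous (fun t => f t * g t).
Proof. by move=> cf cg x; apply: cvgM; [exact: cf|exact: cg]. Qed.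

Lemma cont_cst (r : R) : continuous (fun _ : T => r).
Proof. by move=> x; exact: cvg_cst. Qed.

Lemma cont_norm f : continuous f -> continuous (fun t => `|f t|).
Proof. by move=> cf x; apply: cvg_norm; exact: cf. Qed.

Lemma cont_sqrt f : continuous f -> continuous (fun t => Num.sqrt (f t)).
Proof.
by move=> cf x; apply: (@continuous_comp _ _ _ f Num.sqrt); [exact: cf|exact: sqrt_continuous].
Qed.

Lemma continuous_sum (I : Type) (s : seq I) (f : I -> T -> R) :
  (forall i, continuous (f i)) -> continuous (fun t => \sum_(i <- s) f i t).
Proof.
move=> cf; elim: s => [|i s IH].
  by rewrite (_ : (fun t => _) = fun=> 0); [exact: cont_cst|apply/funext => t; rewrite big_nil].
rewrite (_ : (fun t => _) = fun t => f i t + \sum_(j <- s) f j t); first by apply: contD.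
by apply/funext => t; rewrite big_cons.
Qed.

Lemma continuous_enorm (f : T -> 'rV[R]_(n + n)) :
  (forall i, continuous (fun t => f t 0 i)) -> continuous (fun t => enorm (f t)).
Proof. by move=> cf; apply: cont_sqrt; apply: continuous_sum => i; exact: contM. Qed.

Lemma continuous_omega (f g : T -> 'rV[R]_(n + n)) :
  (forall i, continuous (fun t => f t 0 i)) -> (forall i, continuous (fun t => g t 0 i)) ->
  continuous (fun t => omega (f t) (g t)).
Proof. by move=> cf cg; apply: continuous_sum => k; apply: contB; apply: contM. Qed.

Lemma continuous_rV m (f : T -> 'rV[R]_m) :
  (forall i, continuous (fun t => f t 0 i)) -> continuous f.
Proof.
move=> cf x; apply/cvg_ballP => e e0.
have : \forall y \near x, forall i, ball (f x 0 i) e (f y 0 i).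
  by apply: filter_forall => i; apply: (cf i x); exact: nbhsx_ballx.
by apply: filterS => y yH; split => // i j; rewrite ord1.
Qed.

Lemma continuous_near_dist f :
  (forall (t : T) (e : R), 0 < e -> nbhs t [set t' | `|f t - f t'| < e]) -> continuous f.
Proof. by move=> fe x; apply/cvgrPdist_lt => e e0; exact: fe. Qed.

End RealContinuity.

Lemma hor_coord_continuous j : continuous (fun x : H => hor x 0 j).
Proof.
rewrite (_ : (fun x => _) = fun x : H => x 0 (hidx j)); first exact: coord_continuous.
by apply/funext => x; rewrite horE.
Qed.

Lemma rd_near x (e : R) : 0 < e -> nbhs x [set y | rd x y < e].
Proof.
move=> e0; pose N (y : H) := enorm (hor y - hor x) + 4 * Num.sqrt `|vdist x y|.
have cN : continuous N.
  apply: contD.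
    apply: continuous_enorm => i; rewrite (_ : (fun t => _) = fun t : H => hor t 0 i - hor x 0 i).
      by apply: contB; [exact: hor_coord_continuous|exact: cont_cst].
    by apply/funext => t; rewrite !mxE.
  apply: contM; first exact: cont_cst.
  apply: cont_sqrt; apply: cont_norm; apply: contB.
    by apply: contB; [exact: coord_continuous|exact: cont_cst].
  apply: contM; first exact: cont_cst.
  by apply: continuous_omega => i; [exact: cont_cst|exact: hor_coord_continuous].
have Nx : N x = 0.
  rewrite /N subrr /vdist omega_self mulr0 subr0 subrr normr0 sqrtr0 mulr0 addr0.
  by rewrite -[X in enorm X](scale0r 0) enormZ normr0 mul0r.
have oN : open (N @^-1` [set r | r < e]).
  by move/continuousP: cN; apply; exact: open_lt.
have xN : nbhs x (N @^-1` [set r | r < e]).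
  by apply: open_nbhs_nbhs; split => //; rewrite /preimage /= Nx.
apply: (@filterS H (nbhs x) (nbhs_filter x)) xN => y; rewrite /preimage /=; apply: le_lt_trans; exact: rd_upper.
Qed.

Lemma continuous_rd_lip u : (forall x y, `|u x - u y| <= rd x y) -> continuous u.
Proof.
move=> Lu; apply: continuous_near_dist => x e e0.
apply: (@filterS H (nbhs x) (nbhs_filter x)) (rd_near x e0) => y /=; exact: le_lt_trans.
Qed.

Lemma rd_diff x y z : `|rd x z - rd y z| <= rd x y.
Proof.
have h1 := rd_triangle n_gt0 y x z; have h2 := rd_triangle n_gt0 x y z.
by rewrite ler_norml; move: h1 h2; rewrite (rdC y x); clear; lra.
Qed.

Lemma rd_continuousl z : continuous (fun x => rd x z).
Proof. by apply: continuous_rd_lip => x y; exact: rd_diff. Qed.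

(** With [rd_near], this says that the distance induces the Euclidean topology. The last coordinate
    changes by [vdist x y] plus half of [omega (hor x) (hor y - hor x)], both at most linear in the
    distance within radius 1; [M] collects the constants. *)
Lemma nbhs_rd x (V : set H) : nbhs x V -> exists2 e : R, 0 < e & forall y, rd x y < e -> V y.
Proof.
move=> /nbhs_ballP[d /= d0 dV].
pose M := n%:R + n%:R * enorm (hor x) * (n + n)%:R + 1.
have M0 : 0 < M by rewrite ltr_wpDl// addr_ge0// !mulr_ge0// enorm_ge0.
have M1 : 1 <= M by rewrite lerDr addr_ge0// !mulr_ge0// enorm_ge0.
exists (Num.min 1 (d / M)); first by rewrite lt_min ltr01 divr_gt0.
move=> y; rewrite lt_min => /andP[r1 rd']; apply: dV.
have r0 := rd_ge0 x y.
have rM : rd x y * M < d by rewrite -ltr_pdivlMr.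
split => // i k; rewrite ord1 /ball /= distrC.
apply: le_lt_trans rM; have [[j ->]|->] := hidxP k.
  by apply: le_trans (rd_lower_hor n_gt0 x y j) _; rewrite ler_peMr.
have -> : y 0 ord_max - x 0 ord_max = vdist x y + 2^-1 * omega (hor x) (hor y - hor x).
  by rewrite /vdist omegaDr omegaNr omega_self; ring.
apply: le_trans (ler_normD _ _) _.
have h1 : `|vdist x y| <= n%:R * rd x y.
  apply: le_trans (rd_lower_v n_gt0 x y) _; rewrite ler_wpM2l// expr2 ler_piMl//; exact: ltW.
have h2 := @omega_bound _ _ (hor x) (hor y - hor x) _ (coord_le_enorm (hor x)).
have h3 : n%:R * enorm (hor x) * enorm (hor y - hor x) <= n%:R * enorm (hor x) * ((n + n)%:R * rd x y).
  by rewrite ler_wpM2l ?mulr_ge0 ?enorm_ge0//; exact: enorm_le_rd.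
rewrite /M; have -> : rd x y * (n%:R + n%:R * enorm (hor x) * (n + n)%:R + 1) =
  n%:R * rd x y + n%:R * enorm (hor x) * ((n + n)%:R * rd x y) + rd x y by ring.
by move: h1 h2 h3 r0; clear; lra.
Qed.

Lemma hor_hmul_hinv x y : hor (hmul (hinv x) y) = hor y - hor x.
Proof.
apply/rowP => j; rewrite horE /hmul /hinv !mxE (negPf (hidx_neq_max _)) /= ?andbF mulr0 addr0.
by rewrite addrC.
Qed.

Lemma hor_hmul x y : hor (hmul x y) = hor x + hor y.
Proof.
by apply/rowP => j; rewrite horE /hmul !mxE (negPf (hidx_neq_max _)) /= ?andbF mulr0 addr0.
Qed.

(** The horizontal part of [hmul (hinv x) y] is [hor y - hor x], and a linear form of the horizontal
    part is a homogeneous homomorphism. Dividing the quadratic remainder by the distance leaves a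
    quantity tending to 0. *)
Lemma taylor2_pansu u x (k : nat) : taylor2 u x k.+1%:R -> pansu_differentiable u x.
Proof.
move=> T; exists (fun y => dotp (hgrad u x) (hor y)).
  split=> [y z|s y _].
    by rewrite hor_hmul /dotp -big_split; apply: eq_bigr => j _; rewrite !mxE mulrDr.
  rewrite /dotp mulr_sumr; apply: eq_bigr => j _.
  by rewrite !horE /dilation !mxE (negPf (hidx_neq_max _)); ring.
apply/cvgrPdist_lt => e e0; rewrite near_withinE.
have d0 : 0 < Num.min (k.+1%:R^-1) (e / k.+1%:R) by rewrite lt_min invr_gt0 ltr0n divr_gt0// ltr0n.
apply: (@filterS H (nbhs x) (nbhs_filter x)) (rd_near x d0) => y /=; rewrite lt_min => /andP[/T Ty ye] _.
rewrite sub0r normrN hor_hmul_hinv -/(rd x y) normrM normfV [`|rd x y|]ger0_norm ?rd_ge0//.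
have [->|r0] := eqVneq (rd x y) 0; first by rewrite invr0 mulr0.
have r0' : 0 < rd x y by rewrite lt_neqAle eq_sym r0 rd_ge0.
rewrite ltr_pdivrMr//; apply: le_lt_trans Ty _; rewrite expr2 mulrA ltr_pM2r//.
by rewrite mulrC -ltr_pdivlMr// ltr0n.
Qed.

Definition qseq (m : nat) (k : nat) : 'rV[R]_m :=
  if (unpickle k : option 'rV[rat]_m) is Some q then map_mx ratr q else 0.

Lemma qseq_near (m : nat) (x : 'rV[R]_m) (V : set 'rV[R]_m) : nbhs x V -> exists k, V (qseq m k).
Proof.
move=> /nbhs_ballP[d /= d0 dV].
have /choice[q qP] : forall i, exists q : rat, `|x 0 i - ratr q| < d.
  move=> i; have := @rat_in_itvoo R (x 0 i) (x 0 i + d); rewrite ltrDl => /(_ d0)[q].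
  by rewrite in_itv /= => /andP[q1 q2]; exists q; rewrite ltr_norml; move: q1 q2; clear -d0; lra.
exists (pickle (\row_i q i)); rewrite /qseq pickleK; apply: dV; split=> // i j.
by rewrite ord1 !mxE; exact: qP.
Qed.

Lemma qseq_rd x (e : R) : 0 < e -> exists k, rd x (qseq _ k) < e.
Proof. by move=> e0; exact: qseq_near (rd_near x e0). Qed.

Lemma open_borelH (V : set H) : open V -> measurable (V : set BH).
Proof. by move=> oV; exact: sub_sigma_algebra. Qed.

Lemma continuous_borelH (f : H -> R) : continuous f -> measurable_fun setT (f : BH -> R).
Proof.
move=> /continuousP cf; apply: (measurability _ (RGenOpens.measurableE R)).
move=> _ [_ [a [b ->] <-]]; rewrite setTI; apply: open_borelH.
by apply: cf; exact: interval_open.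
Qed.

(** The sublevel set is written as a countable union of products of balls with a common rational
    centre, which places it in the product sigma-algebra. *)
Lemma measurable_rd : measurable_fun setT (fun p : BH * BH => rd p.1 p.2).
Proof.
apply: (measurability _ (RGenInftyO.measurableE R)) => _ [_ [c ->] <-]; rewrite setTI.
pose F k q : set (BH * BH) := [set x : BH | rd x (qseq _ k) < ratr q] `*` [set y : BH | rd (qseq _ k) y < c - ratr q].
rewrite (_ : _ @^-1` _ = \bigcup_k \bigcup_q F k q).
  apply: bigcupT_measurable => k; apply: bigcupT_measurable_rat => q; apply: measurableX.
    have := continuous_borelH (@rd_continuousl (qseq _ k)) measurableT (measurable_itv `]-oo, (ratr q)[).
    by rewrite setTI; congr measurable; apply/seteqP; split => x; rewrite /preimage /= in_itv.
  have := continuous_borelH (@rd_continuousl (qseq _ k)) measurableT (measurable_itv `]-oo, (c - ratr q)[).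
  by rewrite setTI; congr measurable; apply/seteqP; split => x; rewrite /preimage /= in_itv /= rdC.
apply/seteqP; split=> [[x y]|[x y] [k _ [q _ []]]]; rewrite /preimage /= in_itv /=; last first.
  move=> h1 h2; apply: le_lt_trans (rd_triangle n_gt0 (qseq _ k) x y) _.
  by move: h1 h2; clear; lra.
move=> xyc; have e0 : 0 < (c - rd x y) / 4 by rewrite divr_gt0// subr_gt0.
have [k kx] := qseq_rd x e0.
have [q] := @rat_in_itvoo R _ _ kx; rewrite in_itv /= => /andP[q1 q2].
exists k => //; exists q => //; split => //=.
have := rd_triangle n_gt0 x (qseq _ k) y; rewrite (rdC _ x).
by move: xyc q1 q2 kx; clear; lra.
Qed.

End HeisTopology.

(** * Borel measurability of the horizontal gradient and of the Taylor points *)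

Section BorelGradient.
Context {R : realType} {n : nat}.
Local Notation H := (heis R n).
Local Notation BH := (borelH R n).
Hypothesis n_gt0 : (0 < n)%N.
Variable u : H -> R.
Hypothesis cu : continuous u.
Implicit Types (x y z w : H).

Definition rseq (i : nat) : R := ratr (odflt 0 (unpickle i : option rat)).

Lemma rseq_near (r : R) (V : set R) : nbhs r V -> exists i, V (rseq i).
Proof.
move=> /nbhs_ballP[d /= d0 dV].
have := @rat_in_itvoo R r (r + d); rewrite ltrDl => /(_ d0)[q].
rewrite in_itv /= => /andP[q1 q2]; exists (pickle q); rewrite /rseq pickleK /=.
by apply: dV; rewrite /ball /= ltr_norml; move: q1 q2; clear -d0; lra.
Qed.

Lemma measurable_fun_ge0 (f : BH -> R) : measurable_fun setT f -> measurable [set x | 0 <= f x].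
Proof.
move=> mf; have := mf measurableT `[0, +oo[%classic (measurable_itv _).
by rewrite setTI; congr measurable; apply/seteqP; split => x; rewrite /preimage /= in_itv /= andbT.
Qed.

Section DifferenceQuotient.
Variable j : 'I_(n + n).

Definition quot (s : R) x : R := s^-1 *: (u (s *: Xfield j x + x) - u x).

Lemma continuous_Xfield i : continuous (fun x : H => Xfield j x 0 i).
Proof.
rewrite /Xfield; case: (fintype.split j) => k.
  rewrite (_ : (fun x => _) = fun x : H => (delta_mx 0 (hidx j) : H) 0 i - x 0 (hidx (rshift n k)) / 2 * (delta_mx 0 ord_max : H) 0 i); last by apply/funext => x; rewrite !mxE.
  apply: contB; first exact: cont_cst.
  by apply: contM; [apply: contM; [exact: coord_continuous|exact: cont_cst]|exact: cont_cst].
rewrite (_ : (fun x => _) = fun x : H => (delta_mx 0 (hidx j) : H) 0 i + x 0 (hidx (lshift n k)) / 2 * (delta_mx 0 ord_max : H) 0 i); last by apply/funext => x; rewrite !mxE.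
apply: contD; first exact: cont_cst.
by apply: contM; [apply: contM; [exact: coord_continuous|exact: cont_cst]|exact: cont_cst].
Qed.

Lemma quot_continuous (s : R) : continuous (quot s).
Proof.
apply: contM; first exact: cont_cst.
apply: contB; last exact: cu.
have cg : continuous (fun x : H => s *: Xfield j x + x).
  apply: continuous_rV => i.
  rewrite (_ : (fun x => _) = fun x : H => s * Xfield j x 0 i + x 0 i); last by apply/funext => x; rewrite !mxE.
  by apply: contD; [apply: contM; [exact: cont_cst|exact: continuous_Xfield]|exact: coord_continuous].
by move=> x; apply: (@continuous_comp _ _ _ (fun x : H => s *: Xfield j x + x) u); [exact: cg|exact: cu].
Qed.

Lemma quot_near x (s e : R) : s != 0 -> 0 < e -> \forall s' \near s, `|quot s x - quot s' x| < e.
Proof.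
move=> s0 e0; suff : {for s, continuous (fun s => quot s x)} by move=> /cvgrPdist_lt/(_ _ e0).
apply: cvgM; first exact: cvgV.
apply: cvgB; last exact: cvg_cst.
have cg : continuous (fun s : R => s *: Xfield j x + x).
  apply: continuous_rV => i.
  rewrite (_ : (fun t => _) = fun s : R => s * Xfield j x 0 i + x 0 i); last by apply/funext => ?; rewrite !mxE.
  by apply: contD; [apply: contM; [move=> ?; exact: cvg_id|exact: cont_cst]|exact: cont_cst].
by apply: (@continuous_comp _ _ _ (fun s : R => s *: Xfield j x + x) u); [exact: cg|exact: cu].
Qed.

Let close (m : nat) (s : R) := 0 < `|s| < m.+1%:R^-1.

(** The Cauchy criterion for the difference quotients, restricted to rational steps to make it
    countable; continuity of the quotients in the step recovers all steps. *)
Definition Cauchy_quot : set BH :=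
  \bigcap_k \bigcup_m \bigcap_i \bigcap_l
    [set x | close m (rseq i) -> close m (rseq l) ->
       0 <= k.+1%:R^-1 - `|quot (rseq i) x - quot (rseq l) x|].

Lemma measurable_Cauchy_quot : measurable Cauchy_quot.
Proof.
apply: bigcapT_measurable => k; apply: bigcupT_measurable => m.
apply: bigcapT_measurable => i; apply: bigcapT_measurable => l.
have [ci|ci] := boolP (close m (rseq i)); last first.
  by rewrite (_ : [set _ | _] = setT)//; apply/seteqP; split.
have [cl|cl] := boolP (close m (rseq l)); last first.
  by rewrite (_ : [set _ | _] = setT)//; apply/seteqP; split.
have := @measurable_fun_ge0 (fun x => k.+1%:R^-1 - `|quot (rseq i) x - quot (rseq l) x|).
have -> : [set x | true -> true -> 0 <= k.+1%:R^-1 - `|quot (rseq i) x - quot (rseq l) x|] =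
  [set x | 0 <= k.+1%:R^-1 - `|quot (rseq i) x - quot (rseq l) x|].
  by apply/seteqP; split => x //=; apply.
apply; apply: continuous_borelH; apply: contB; first exact: cont_cst.
by apply: cont_norm; apply: contB; exact: quot_continuous.
Qed.

Lemma Cauchy_quotP x : Cauchy_quot x <-> derivable u x (Xfield j x).
Proof.
split=> [Cx|].
  apply/cauchy_cvgP; apply: cauchy_exP => e e0.
  have [k ke] : exists k : nat, k.+1%:R^-1 < e / 2.
    have e2 : 0 < e / 2 by rewrite divr_gt0.
    by have [k kP] := ltr_add_invr e2; exists k; rewrite add0r in kP.
  have [m _ mP] := Cx k I.
  pose s0 : R := m.+2%:R^-1.
  have s00 : 0 < s0 by rewrite invr_gt0 ltr0n.
  have s0m : s0 < m.+1%:R^-1 by rewrite ltf_pV2 ?posrE ?ltr0n// ltr_nat.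
  have key s s' : close m s -> close m s' -> `|quot s x - quot s' x| < e.
    have near_s t : close m t -> exists i, close m (rseq i) /\ `|quot t x - quot (rseq i) x| < e / 4.
      move=> /andP[t0 tm]; have t1 : t != 0 by rewrite -normr_gt0.
      apply: (@rseq_near t (close m `&` [set s | `|quot t x - quot s x| < e / 4])); apply: filterI; last by apply: quot_near => //; rewrite divr_gt0.
      have cn : {for t, continuous (fun t : R => `|t|)} by exact: norm_continuous.
      have := cn [set r | 0 < r < m.+1%:R^-1]; apply.
      apply: (@filterS _ (nbhs `|t|) _ `]0, m.+1%:R^-1[%classic); first by move=> r; rewrite /= in_itv.
      by apply: near_in_itvoo; rewrite in_itv /= t0.
    move=> /near_s[i [ci iP]] /near_s[l [cl lP]].
    have := mP i I l I ci cl; rewrite subr_ge0 => h.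
    have -> : quot s x - quot s' x = (quot s x - quot (rseq i) x) + (quot (rseq i) x - quot (rseq l) x) - (quot s' x - quot (rseq l) x) by ring.
    apply: le_lt_trans (ler_normB _ _) _; have := ler_normD (quot s x - quot (rseq i) x) (quot (rseq i) x - quot (rseq l) x).
    by move: (k.+1%:R^-1) h ke iP lP => r; clear; lra.
  exists (quot s0 x); rewrite /fmap /=; near=> s.
  rewrite /ball /=; apply: key; first by rewrite /close gtr0_norm ?s00.
  apply/andP; split; first by rewrite normr_gt0; near: s; exact: nbhs_dnbhs_neq.
  by near: s; apply: dnbhs0_lt; rewrite invr_gt0 ltr0n.
rewrite /derivable => /cvg_ex[l0 xl] k _; pose l : R := l0; rewrite -/l in xl; clearbody l.
have k0 : 0 < k.+1%:R^-1 / 2 :> R by rewrite divr_gt0// invr_gt0 ltr0n.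
move/cvgrPdist_lt: xl => /(_ _ k0); rewrite near_withinE => /nbhs_ballP[d /= d0 dP].
have [m mP] := ltr_add_invr d0; rewrite add0r in mP.
exists m => // i _ i' _; rewrite /close /= => /andP[i0 im] /andP[i'0 i'm].
have h (s : R) : 0 < `|s| -> `|s| < m.+1%:R^-1 -> `|l - quot s x| < k.+1%:R^-1 / 2.
  move=> s0 sm; apply: dP; last by rewrite -normr_gt0.
  by rewrite /ball /= sub0r normrN; exact: lt_trans sm mP.
have -> : quot (rseq i) x - quot (rseq i') x = (l - quot (rseq i') x) - (l - quot (rseq i) x) by ring.
rewrite subr_ge0; apply: le_trans (ler_normB _ _) _.
move: (k.+1%:R^-1) (h _ i0 im) (h _ i'0 i'm) => r; clear; lra.
Unshelve. all: by end_near. Qed.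

(** On the Borel set where the derivative exists it is a limit of continuous quotients. Elsewhere
    the derivative has the default value [point], a constant. *)
Lemma measurable_hgrad_coord : measurable_fun setT (fun x : BH => hgrad u x 0 j).
Proof.
have -> : (fun x : BH => hgrad u x 0 j) = fun x => 'D_(Xfield j x) u x.
  by apply/funext => x; rewrite mxE.
rewrite -(setUv Cauchy_quot); apply/measurable_funU; first exact: measurable_Cauchy_quot.
  by apply: measurableC; exact: measurable_Cauchy_quot.
split.
  apply: (@measurable_fun_cvg _ BH R _ (fun m (x : BH) => quot m.+1%:R^-1 x)).
    by move=> m; apply: measurable_funTS; apply: continuous_borelH; exact: quot_continuous.
  move=> x /Cauchy_quotP dx.
  have /cvgrPdist_lt cx : quot s x @[s --> 0^'] --> 'D_(Xfield j x) u x by exact: dx.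
  apply/cvgrPdist_lt => e e0; have := cx e e0; rewrite near_withinE => /nbhs_ballP[d /= d0 dP].
  have [m mP] := ltr_add_invr d0; rewrite add0r in mP.
  exists m => // k /= mk; apply: dP; last by rewrite invr_eq0 pnatr_eq0.
  rewrite /ball /= sub0r normrN gtr0_norm ?invr_gt0 ?ltr0n//; apply: le_lt_trans mP.
  by rewrite lef_pV2 ?posrE ?ltr0n// ler_nat.
apply: (@eq_measurable_fun _ _ _ _ _ (cst point)); last exact: measurable_cst.
move=> x /set_mem /= Cx; apply/esym; apply: dvgP => dx; apply: Cx; exact/Cauchy_quotP.
Qed.

End DifferenceQuotient.

Lemma continuous_dotp (a : 'rV[R]_(n + n)) x : continuous (fun w : H => dotp a (hor w - hor x)).
Proof.
apply: continuous_sum => i; apply: contM; first exact: cont_cst.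
rewrite (_ : (fun t => _) = fun t : H => hor t 0 i - hor x 0 i).
  by apply: contB; [exact: hor_coord_continuous|exact: cont_cst].
by apply/funext => t; rewrite !mxE.
Qed.

(** The expansion [taylor2] tested at rational points only, hence Borel in [x]; both sides are
    continuous in the test point. *)
Definition taylor_set : set BH :=
  \bigcup_k \bigcap_i [set x | rd x (qseq _ i) < k.+1%:R^-1 ->
    0 <= k.+1%:R * rd x (qseq _ i) ^+ 2
         - `|u (qseq _ i) - u x - dotp (hgrad u x) (hor (qseq _ i) - hor x)|].

Lemma measurable_rdr z : measurable_fun setT (fun x : BH => rd x z).
Proof. by apply: continuous_borelH; exact: rd_continuousl. Qed.

Lemma measurable_hor i : measurable_fun setT (fun x : BH => hor x 0 i).
Proof. by apply: continuous_borelH; exact: hor_coord_continuous. Qed.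

Lemma measurable_taylor_set : measurable taylor_set.
Proof.
apply: bigcupT_measurable => k; apply: bigcapT_measurable => i.
set B := [set x : BH | 0 <= k.+1%:R * rd x (qseq _ i) ^+ 2
         - `|u (qseq _ i) - u x - dotp (hgrad u x) (hor (qseq _ i) - hor x)|].
have mB : measurable B.
  apply: measurable_fun_ge0; apply: measurable_funB.
    by apply: measurable_funM => //; apply: measurable_funX; exact: measurable_rdr.
  apply: (measurableT_comp (@normr_measurable _ _)); apply: measurable_funB.
    by apply: measurable_funB => //; exact: continuous_borelH.
  rewrite /dotp; apply: measurable_sum => l; apply: measurable_funM; first exact: measurable_hgrad_coord.
  rewrite (_ : (fun x => _) = fun x : BH => hor (qseq (n + n).+1 i) 0 l - hor x 0 l); last by apply/funext => x; rewrite !mxE.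
  by apply: measurable_funB => //; exact: measurable_hor.
have mA : measurable [set x : BH | 0 <= rd x (qseq _ i) - k.+1%:R^-1].
  by apply: measurable_fun_ge0; apply: measurable_funB => //; exact: measurable_rdr.
rewrite (_ : [set x | _] = [set x : BH | 0 <= rd x (qseq _ i) - k.+1%:R^-1] `|` B); first exact: measurableU.
apply/seteqP; split=> x /=; rewrite subr_ge0.
  by have [h|h] := leP k.+1%:R^-1 (rd x (qseq _ i)); [by left; rewrite subr_ge0|move=> hB; right; rewrite /B /= subr_ge0; exact: hB].
by case=> [+ h|//]; rewrite leNgt h.
Qed.

Lemma taylor_setP x : taylor_set x <-> exists k : nat, taylor2 u x k.+1%:R.
Proof.
split=> [[k _ xk]|[k xk]]; exists k => //; last first.
  by move=> i _ /= /xk; rewrite subr_ge0.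
move=> w xw; rewrite leNgt; apply/negP => bad.
pose F (z : H) := `|u z - u x - dotp (hgrad u x) (hor z - hor x)| - k.+1%:R * rd z x ^+ 2.
have cF : continuous F.
  apply: contB; last first.
    by apply: contM; [exact: cont_cst|apply: contM; exact: rd_continuousl].
  apply: cont_norm; apply: contB; last exact: continuous_dotp.
  by apply: contB; [exact: cu|exact: cont_cst].
pose V := [set z | 0 < F z] `&` [set z | rd z x < k.+1%:R^-1].
have oV : open V.
  apply: openI.
    by move/continuousP: cF => /(_ _ (@open_gt _ 0)).
  by have /continuousP := rd_continuousl n_gt0 (z := x); move=> /(_ _ (@open_lt _ k.+1%:R^-1)).
have wV : V w by rewrite /V /F /= subr_gt0 (rdC w x).
have [i [/= h1 h2]] : exists i, V (qseq _ i).
  by apply: (@qseq_near _ _ w); exact: open_nbhs_nbhs.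
have := xk i I; rewrite /= (rdC x) => /(_ h2); move: h1; rewrite /F; clear; lra.
Qed.

End BorelGradient.

(** * Kantorovich duality *)

Section PlanPerturbation.
Context {d1 d2 : measure_display} {T1 : measurableType d1} {T2 : measurableType d2} {R : realType}.
Local Open Scope ereal_scope.

(** The proofs [mf] and [f0] are arguments so that the measure structure declared below can be
    inferred from the term. *)
Definition density_measure {d : measure_display} {T : measurableType d}
    (m : {measure set T -> \bar R}) (f : T -> R)
    (mf : measurable_fun setT f) (f0 : forall x, (0 <= f x)%R) (A : set T) : \bar R :=
  \int[m]_(x in A) (f x)%:E.

Section Density.
Context {d : measure_display} {T : measurableType d}.
Variables (m : {measure set T -> \bar R}) (f : T -> R).
Hypotheses (mf : measurable_fun setT f) (f0 : forall x, (0 <= f x)%R).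

Local Notation nu := (density_measure m mf f0).

Let density0 : nu set0 = 0.
Proof. exact: integral_set0. Qed.

Let density_ge0 A : 0 <= nu A.
Proof. by apply: integral_ge0 => x _; rewrite lee_fin. Qed.

Let density_sigma_additive : semi_sigma_additive nu.
Proof.
move=> F mF tF mUF; rewrite /density_measure ge0_integral_bigcup//.
- by apply: is_cvg_ereal_nneg_natsum => k _; exact: density_ge0.
- by apply/measurable_EFinP; exact: measurable_funTS.
- by move=> x _; rewrite lee_fin.
Qed.

HB.instance Definition _ := isMeasure.Build _ _ _ nu
  density0 density_ge0 density_sigma_additive.

End Density.

Variable gamma : probability (T1 * T2)%type R.

Definition cond_prob (V : set (T1 * T2)) (mV : measurable V) : probability (T1 * T2)%type R :=
  mnormalize (mrestr gamma mV) gamma.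

HB.instance Definition _ := isMeasurableFun.Build _ _ (T1 * T2)%type T1 fst measurable_fst.
HB.instance Definition _ := isMeasurableFun.Build _ _ (T1 * T2)%type T2 snd measurable_snd.

Definition cond_fst V (mV : measurable V) : probability T1 R :=
  distribution (cond_prob mV) (fst : {mfun (T1 * T2)%type >-> T1}).

Definition cond_snd V (mV : measurable V) : probability T2 R :=
  distribution (cond_prob mV) (snd : {mfun (T1 * T2)%type >-> T2}).

Lemma cond_probE V (mV : measurable V) A : 0 < gamma V ->
  cond_prob mV A = gamma (A `&` V) * ((fine (gamma V))^-1)%:E.
Proof.
move=> V0; rewrite /cond_prob /= /mnormalize.
have h : mrestr gamma mV [set: _] = gamma V by rewrite /mrestr setTI.
case: ifPn => [/orP[/eqP e|/eqP e]|_].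
- by move: V0; rewrite -(etrans (esym e) h) ltxx.
- have : gamma V < +oo by rewrite ltey_eq fin_num_measure.
  by rewrite -h e ltxx.
- by congr (_ * ((fine _)^-1)%:E).
Qed.

(* gamma' = gamma - k sum_i gamma(. | V_(i+1)) + k sum_i alpha_i x beta_(i+1), where
   alpha_i and beta_i are the marginals of gamma(. | V_i). *)
Lemma exists_perturbation (N : nat) (V : nat -> set (T1 * T2)) (mV : forall i, measurable (V i)) :
  (forall i, 0 < gamma (V i)) -> V 0%N = V N ->
  exists2 k : R, (0 < k)%R & exists gamma' : probability (T1 * T2)%type R,
  [/\ forall A, measurable A -> gamma' (A `*` setT) = gamma (A `*` setT),
      forall B, measurable B -> gamma' (setT `*` B) = gamma (setT `*` B) &
      forall c : T1 * T2 -> \bar R, measurable_fun setT c -> (forall p, 0 <= c p) ->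
      \int[gamma']_p c p + k%:E * \sum_(i < N) \int[cond_prob (mV i.+1)]_p c p =
      \int[gamma]_p c p + k%:E * \sum_(i < N) \int[(cond_fst (mV i) \x cond_snd (mV i.+1))]_p c p].
Proof.
move=> V0 VN; pose r i : R := ((fine (gamma (V i)))^-1)%R.
have r0 i : (0 < r i)%R.
  by rewrite invr_gt0 fine_gt0// V0 /= ltey_eq fin_num_measure.
(* This size keeps the removed density [g] at most 1, so the remaining part of the plan is
   nonnegative. *)
pose k : R := ((1 + \sum_(i < N) r i.+1)^-1)%R.
have s0 : (0 <= \sum_(i < N) r i.+1)%R by apply: sumr_ge0 => i _; exact: ltW.
have k0 : (0 < k)%R by rewrite invr_gt0 ltr_pwDl.
exists k => //.
pose g (p : T1 * T2) : R := (k * \sum_(i < N) r i.+1 * \1_(V i.+1) p)%R.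
have mg : measurable_fun setT g.
  apply: measurable_funM => //; apply: measurable_sum => i; apply: measurable_funM.
    exact: measurable_cst.
  exact: (measurable_indic (mV i.+1)).
have g0 p : (0 <= g p)%R.
  by rewrite mulr_ge0 ?(ltW k0)//; apply: sumr_ge0 => i _; rewrite mulr_ge0 ?(ltW (r0 _)).
have g1 p : (g p <= 1)%R.
  rewrite /g /k ler_pdivrMl ?mulr1 ?ltr_pwDl//; apply: (@le_trans _ _ (\sum_(i < N) r i.+1)%R); last by rewrite lerDr.
  apply: ler_sum => i _; rewrite ler_piMr ?(ltW (r0 _))// indicE; by case: (_ \in _).
pose f (p : T1 * T2) : R := (1 - g p)%R.
have mf : measurable_fun setT f by apply: measurable_funB.
have f0 p : (0 <= f p)%R by rewrite subr_ge0.
pose gamma0 : {measure set (T1 * T2)%type -> \bar R} := density_measure gamma mf f0.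
pose K : {nonneg R} := NngNum (ltW k0).
pose rho : nat -> {measure set (T1 * T2)%type -> \bar R} := fun i => cond_prob (mV i.+1).
pose ab : nat -> {measure set (T1 * T2)%type -> \bar R} := fun i => (cond_fst (mV i) \x cond_snd (mV i.+1)).
pose gamma1 : {measure set (T1 * T2)%type -> \bar R} := measure_add gamma0 (mscale K (msum ab N)).
have gamma0E A : measurable A -> gamma0 A + k%:E * \sum_(i < N) rho i A = gamma A.
  move=> mA; have -> : k%:E * \sum_(i < N) rho i A = \int[gamma]_(p in A) (g p)%:E.
    rewrite /g; under eq_integral do rewrite EFinM.
    rewrite ge0_integralZl//; last 3 first.
    - apply/measurable_EFinP; apply: measurable_funTS; apply: measurable_sum => i; apply: measurable_funM => //.
    - by move=> p _; rewrite lee_fin sumr_ge0// => i _; rewrite mulr_ge0 ?(ltW (r0 _)).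
    - by rewrite lee_fin ltW.
    congr (_ * _).
    under [RHS]eq_integral do rewrite -sumEFin.
    rewrite ge0_integral_sum//; last 2 first.
    - by move=> i; apply/measurable_EFinP; apply: measurable_funTS; apply: measurable_funM.
    - by move=> i p _; rewrite lee_fin mulr_ge0 ?(ltW (r0 _)).
    apply: eq_bigr => i _; have -> : rho i A = gamma (A `&` V i.+1) * (r i.+1)%:E by exact: cond_probE.
    under eq_integral do rewrite EFinM.
    rewrite ge0_integralZl//; last 2 first.
    - by apply/measurable_EFinP; exact: measurable_funTS.
    - by rewrite lee_fin ltW.
    by rewrite integral_indic// setIC muleC setIC.
  rewrite [gamma0 A]/(\int[gamma]_(p in A) (f p)%:E) -ge0_integralD//; last 4 first.
  - by move=> p _; rewrite lee_fin.
  - by apply/measurable_EFinP; exact: measurable_funTS.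
  - by move=> p _; rewrite lee_fin.
  - by apply/measurable_EFinP; exact: measurable_funTS.
  under eq_integral do rewrite -EFinD /f subrK.
  by rewrite integral_cst// mul1e.
(* The balance is stated with both masses added instead of subtracted, since extended reals only
   allow cancellation of finite terms. *)
have gamma1E A : measurable A ->
  gamma1 A + k%:E * \sum_(i < N) rho i A = gamma A + k%:E * \sum_(i < N) ab i A.
  move=> mA; have -> : gamma1 A = gamma0 A + k%:E * \sum_(i < N) ab i A.
    exact: (measure_addE gamma0 (mscale K (msum ab N)) A).
  by rewrite addeAC gamma0E.
have cancel (x y z : \bar R) : z \is a fin_num -> x + z = y + z -> x = y.
  by move=> fz xy; rewrite -[x](@addeK _ z)// xy addeK.
have finS (h : nat -> probability (T1 * T2)%type R) A : measurable A -> k%:E * \sum_(i < N) h i A \is a fin_num.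
  by move=> mA; rewrite fin_numM// sum_fin_num; apply/allP => _ /mapP[i _ ->]; exact: (fin_num_measure (h i)).
have fstE A : measurable A -> gamma1 (A `*` setT) = gamma (A `*` setT).
  move=> mA; have mAT : measurable (A `*` [set: T2]) by exact: measurableX.
  apply: (cancel _ _ (k%:E * \sum_(i < N) rho i (A `*` setT))); first exact: (finS (fun i => cond_prob (mV i.+1))).
  rewrite gamma1E//; congr (_ + _ * _).
  have -> : \sum_(i < N) ab i (A `*` setT) = \sum_(i < N) cond_fst (mV i) A.
    apply: eq_bigr => i _; have -> : ab i (A `*` setT) = cond_fst (mV i) A * cond_snd (mV i.+1) setT.
      exact: product_measure1E.
    by rewrite probability_setT mule1.
  have -> : \sum_(i < N) rho i (A `*` setT) = \sum_(i < N) cond_fst (mV i.+1) A.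
    by apply: eq_bigr => i _; rewrite /rho /cond_fst /distribution /pushforward; congr (cond_prob _ _); apply/seteqP; split => [[x y] []|[x y]].
  (* The added first marginals have indices 0 to N-1 and the removed ones 1 to N; the cycle closes,
     so the sums agree. The second marginals match term by term. *)
  have f1N : cond_fst (mV 0%N) A = cond_fst (mV N) A.
    have fE i : cond_fst (mV i) A = gamma ((fst @^-1` A) `&` V i) * ((fine (gamma (V i)))^-1)%:E.
      exact: cond_probE.
    by rewrite !fE VN.
  pose f1 i := cond_fst (mV i) A.
  have e1 : \sum_(i < N.+1) f1 i = f1 0%N + \sum_(i < N) f1 i.+1 by rewrite big_ord_recl.
  have e2 : \sum_(i < N.+1) f1 i = \sum_(i < N) f1 i + f1 N by rewrite big_ord_recr.
  apply: (cancel _ _ (f1 0%N)); first exact: fin_num_measure.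
  rewrite -[RHS]/(\sum_(i < N) f1 i.+1 + f1 0%N) [RHS]addeC -e1 e2.
  by congr (_ + _); exact: f1N.
have sndE B : measurable B -> gamma1 (setT `*` B) = gamma (setT `*` B).
  move=> mB; have mTB : measurable ([set: T1] `*` B) by exact: measurableX.
  apply: (cancel _ _ (k%:E * \sum_(i < N) rho i (setT `*` B))); first exact: (finS (fun i => cond_prob (mV i.+1))).
  rewrite gamma1E//; congr (_ + _ * _); apply: eq_bigr => i _.
  have -> : ab i (setT `*` B) = cond_fst (mV i) setT * cond_snd (mV i.+1) B.
    exact: product_measure1E.
  rewrite probability_setT mul1e /rho /cond_snd /distribution /pushforward.
  by congr (cond_prob _ _); apply/seteqP; split => [[x y]|[x y] []].
have gamma1T : gamma1 setT = 1.
  by rewrite -[setT]setXTT fstE// setXTT probability_setT.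
(* The total mass is already 1: normalization only supplies the probability structure. *)
pose gamma2 : probability (T1 * T2)%type R := mnormalize gamma1 gamma.
have gamma2E A : gamma2 A = gamma1 A.
  by rewrite /gamma2 /= /mnormalize gamma1T onee_eq0 /= invr1 mule1.
exists gamma2; split => [A mA|B mB|c mc c0].
- by rewrite gamma2E fstE.
- by rewrite gamma2E sndE.
transitivity (\int[measure_add gamma2 (mscale K (msum rho N))]_p c p).
  by rewrite ge0_integral_measure_add// ge0_integral_mscale// ge0_integral_measure_sum.
transitivity (\int[measure_add gamma (mscale K (msum ab N))]_p c p); last first.
  by rewrite ge0_integral_measure_add// ge0_integral_mscale// ge0_integral_measure_sum.
apply: eq_measure_integral => A mA _; 
have h := gamma1E A mA; rewrite -gamma2E in h.
apply: (etrans (measure_addE _ _ A)); apply: etrans (esym (measure_addE _ _ A)).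
by first [exact: h|exact: esym h].
Qed.

End PlanPerturbation.

Section MeanBounds.
Context {d : measure_display} {T : measurableType d} {R : realType}.
Variables (m : {measure set T -> \bar R}) (D : set T) (f : T -> R) (r : R).
Hypotheses (mD : measurable D) (D1 : m D = 1%E) (T1 : m setT = 1%E).
Hypotheses (mf : measurable_fun setT f) (f0 : forall x, 0 <= f x).

Lemma ae_full_set : {ae m, forall x, D x}.
Proof.
exists (~` D); split; [exact: measurableC| |by []].
have : m (D `|` ~` D) = (m D + m (~` D))%E.
  by rewrite measureU//; [exact: measurableC|exact: setICr].
rewrite setUv T1 D1; move: (m (~` D)) (measure_ge0 m (~` D)) => [x||]//= _.
by rewrite -EFinD => -[] /eqP; rewrite addrC -subr_eq subrr => /eqP <-.
Qed.

Lemma mean_ge : (forall x, D x -> r <= f x) -> (r%:E <= \int[m]_x (f x)%:E)%E.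
Proof.
move=> rf; have -> : r%:E = (r%:E * m setT)%E by rewrite T1 mule1.
apply: (@le_trans _ _ ((Num.max r 0)%:E * m setT)%E).
  by rewrite T1 !mule1 lee_fin le_max lexx.
rewrite -integral_cst//; apply: ae_ge0_le_integral => //.
- by move=> x _; rewrite lee_fin le_max lexx orbT.
- by move=> x _; rewrite lee_fin.
- exact/measurable_EFinP.
- apply: filterS ae_full_set => x Dx _ /=.
  by rewrite lee_fin ge_max rf//=.
Qed.

Lemma mean_le : (forall x, D x -> f x <= r) -> (\int[m]_x (f x)%:E <= r%:E)%E.
Proof.
move=> fr; have [x0 Dx0] : D !=set0.
  apply/set0P/eqP => D0; move: D1; rewrite D0 measure0 => /eqP.
  by rewrite eq_sym onee_eq0.
have r0 : 0 <= r := le_trans (f0 x0) (fr _ Dx0).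
have -> : r%:E = (r%:E * m setT)%E by rewrite T1 mule1.
rewrite -integral_cst//; apply: ae_ge0_le_integral => //.
- by move=> x _; rewrite lee_fin.
- exact/measurable_EFinP.
- by apply: filterS ae_full_set => x Dx _ /=; rewrite lee_fin fr.
Qed.

End MeanBounds.

(** * Cyclical monotonicity of optimal plans *)

Section CyclicMonotonicity.
Context {R : realType} {n : nat}.
Local Notation H := (heis R n).
Local Notation BH := (borelH R n).
Hypothesis n_gt0 : (0 < n)%N.
Variable gamma : probability (BH * BH)%type R.
Implicit Types (x y : H) (p : H * H).

Definition rball x (e : R) : set BH := [set y | rd y x < e].

Lemma measurable_rball x e : measurable (rball x e).
Proof.
have := continuous_borelH (@rd_continuousl R n n_gt0 x) measurableT (measurable_itv `]-oo, e[).
by rewrite setTI; congr measurable; apply/seteqP; split => y; rewrite /preimage /= in_itv.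
Qed.

Definition rball2 p (e : R) : set (BH * BH) := rball p.1 e `*` rball p.2 e.

Lemma measurable_rball2 p e : measurable (rball2 p e).
Proof. by apply: measurableX; exact: measurable_rball. Qed.

Definition plan_support : set (BH * BH) := [set p | forall e : R, 0 < e -> (0 < gamma (rball2 p e))%E].

(** A point outside the support lies in a null product of balls with rational centres and radius
    [l.+1%:R^-1], and there are countably many of these. *)
Lemma plan_support_ae : {ae gamma, forall p, plan_support p}.
Proof.
pose W k k' l := rball2 (qseq _ k, qseq _ k') l.+1%:R^-1.
pose N := \bigcup_k \bigcup_k' \bigcup_l (if gamma (W k k' l) == 0%E then W k k' l else set0).
have mW k k' l : measurable (if gamma (W k k' l) == 0%E then W k k' l else set0).
  by case: ifP => // _; exact: measurable_rball2.
have mN3 k k' : measurable (\bigcup_l (if gamma (W k k' l) == 0%E then W k k' l else set0)).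
  exact: bigcupT_measurable.
have mN2 k : measurable (\bigcup_k' \bigcup_l (if gamma (W k k' l) == 0%E then W k k' l else set0)).
  exact: bigcupT_measurable.
have N0 : gamma.-negligible N.
  apply: negligible_bigcup => k; apply: negligible_bigcup => k'; apply: negligible_bigcup => l.
  case: ifP => [/eqP W0|_]; last exact: negligible_set0.
  by exists (W k k' l); split => //; exact: measurable_rball2.
apply: negligibleS N0 => -[x y] /=; apply: contra_notP => Nxy e e0.
have e2 : 0 < e / 2 by rewrite divr_gt0.
have [l] := ltr_add_invr e2; rewrite add0r => le.
have l0 : 0 < l.+1%:R^-1 :> R by rewrite invr_gt0 ltr0n.
have [k kx] := qseq_rd n_gt0 x l0; have [k' ky] := qseq_rd n_gt0 y l0.
have [W0|W0] := eqVneq (gamma (W k k' l)) 0%E.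
  have Wl : (if gamma (W k k' l) == 0%E then W k k' l else set0) (x, y) by move/eqP: W0 => ->; split; [exact: kx|exact: ky].
  by exfalso; apply: Nxy; exists k; [|exists k'; [|exists l]].
apply: (@lt_le_trans _ _ (gamma (W k k' l))); first by rewrite lt0e W0 measure_ge0.
apply: le_measure; rewrite ?inE; [exact: measurable_rball2|exact: measurable_rball2|].
move=> [x' y'] [/= hx hy]; split; rewrite /= /rball /=.
  have := rd_triangle n_gt0 (qseq _ k) x' x; rewrite (rdC (qseq _ k) x).
  by move: kx hx le; rewrite /rball /=; move: (l.+1%:R^-1) => r; clear; lra.
have := rd_triangle n_gt0 (qseq _ k') y' y; rewrite (rdC (qseq _ k') y).
by move: ky hy le; rewrite /rball /=; move: (l.+1%:R^-1) => r; clear; lra.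
Qed.

Hypothesis finite_cost : (\int[gamma]_p (rd p.1 p.2)%:E < +oo)%E.
Hypothesis optimal_cost : forall gamma' : probability (BH * BH)%type R,
  (forall A : set BH, measurable A -> gamma' (A `*` setT) = gamma (A `*` setT)) ->
  (forall B : set BH, measurable B -> gamma' (setT `*` B) = gamma (setT `*` B)) ->
  (\int[gamma]_p (rd p.1 p.2)%:E <= \int[gamma']_p (rd p.1 p.2)%:E)%E.

(** On products of balls of radius [e] the cost varies by at most [2 * e]. Hence the means in
    [exists_perturbation] are within [2 * e] of the costs at the points of the cycle, optimality
    compares their sums, and [e] is arbitrary. *)
Lemma cyclical_monotonicity (N : nat) (Q : nat -> H * H) :
  (forall i, plan_support (Q i)) -> Q 0%N = Q N ->
  \sum_(i < N) rd (Q i.+1).1 (Q i.+1).2 <= \sum_(i < N) rd (Q i).1 (Q i.+1).2.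
Proof.
move=> sQ QN.
suff key (e : R) : 0 < e ->
    \sum_(i < N) (rd (Q i.+1).1 (Q i.+1).2 - 2 * e) <= \sum_(i < N) (rd (Q i).1 (Q i.+1).2 + 2 * e).
  apply/ler_addgt0Pr => e e0.
  (* At this radius each of the two sums of N errors [2 * e] is at most half of the allowed error;
     [N.+1] avoids dividing by 0. *)
  have e1 : 0 < e / (4 * N.+1%:R) by rewrite divr_gt0// mulr_gt0.
  have := key _ e1; rewrite !big_split /= !sumr_const !card_ord => h.
  have eN : (2 * (e / (4 * N.+1%:R))) *+ N <= e / 2.
    rewrite -mulr_natr (_ : _ * N%:R = (e / 2) * (N%:R / N.+1%:R)).
      by rewrite ler_piMr ?divr_ge0 ?(ltW e0)// ler_pdivrMr ?ltr0n// mul1r ler_nat.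
    have : N.+1%:R != 0 :> R by rewrite pnatr_eq0.
    by move: (N.+1%:R : R) => M M0; field.
  move: h eN; rewrite mulNrn; move: (_ *+ N) => r.
  by move: (\sum_(i < N) _) (\sum_(i < N) _) => A B; clear; lra.
move=> e0.
pose V i := rball2 (Q i) e.
have mV i : measurable (V i) by exact: measurable_rball2.
have V0 i : (0 < gamma (V i))%E by exact: sQ.
have [|k k0 [gamma' [g1 g2 gint]]] := exists_perturbation mV V0 (N := N); first by rewrite /V QN.
have := gint (fun p => (rd p.1 p.2)%:E) _ _.
have c0 (p : BH * BH) : (0 <= (rd p.1 p.2)%:E)%E by rewrite lee_fin rd_ge0.
have mc : measurable_fun setT (fun p : BH * BH => (rd p.1 p.2)%:E) by apply/measurable_EFinP; exact: measurable_rd.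
move=> /(_ mc c0) E.
have cV i A : V i `<=` A -> cond_prob gamma (mV i) A = 1%E.
  move=> VA; rewrite cond_probE// (setIidr VA) -{1}(@fineK _ (gamma (V i))) ?fin_num_measure//.
  by rewrite -EFinM divff// gt_eqF// fine_gt0// V0 /= ltey_eq fin_num_measure.
have c1 i : cond_fst gamma (mV i) (rball (Q i).1 e) = 1%E.
  by apply: cV => -[x y] [].
have c2 i : cond_snd gamma (mV i) (rball (Q i).2 e) = 1%E.
  by apply: cV => -[x y] [].
have A i : ((rd (Q i.+1).1 (Q i.+1).2 - 2 * e)%:E <= \int[cond_prob gamma (mV i.+1)]_p (rd p.1 p.2)%:E)%E.
  apply: (@mean_ge _ _ _ _ (V i.+1)).
  - exact: mV.
  - exact: cV.
  - exact: probability_setT.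
  - exact: measurable_rd.
  - by move=> p; exact: rd_ge0.
  move=> [x y] [/=]; rewrite /rball /= => hx hy.
  have h1 := rd_triangle n_gt0 x (Q i.+1).1 (Q i.+1).2.
  have h2 := rd_triangle n_gt0 y x (Q i.+1).2.
  by move: h1 h2 hx hy; rewrite (rdC _ x); clear; lra.
have B i : (\int[(cond_fst gamma (mV i) \x cond_snd gamma (mV i.+1))]_p (rd p.1 p.2)%:E <= (rd (Q i).1 (Q i.+1).2 + 2 * e)%:E)%E.
  apply: (@mean_le _ _ _ _ (rball (Q i).1 e `*` rball (Q i.+1).2 e)).
  - by apply: measurableX; exact: measurable_rball.
  - rewrite [LHS](product_measure1E (cond_fst gamma (mV i)) (cond_snd gamma (mV i.+1))); [|exact: measurable_rball..].
    exact: (etrans (congr2 mule (c1 i) (c2 i.+1)) (mule1 _)).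
  - rewrite -setXTT [LHS](product_measure1E (cond_fst gamma (mV i)) (cond_snd gamma (mV i.+1)))//.
    exact: (etrans (congr2 mule (probability_setT _) (probability_setT _)) (mule1 _)).
  - exact: measurable_rd.
  - by move=> p; exact: rd_ge0.
  move=> [x y] [/=]; rewrite /rball /= => hx hy.
  have h1 := rd_triangle n_gt0 (Q i).1 x y.
  have h2 := rd_triangle n_gt0 (Q i.+1).2 (Q i).1 y.
  by move: h1 h2 hx hy; rewrite (rdC (Q i.+1).2 y); clear; lra.
rewrite -lee_fin -!sumEFin.
apply: (@le_trans _ _ (\sum_(i < N) \int[cond_prob gamma (mV i.+1)]_p (rd p.1 p.2)%:E)%E).
  by apply: lee_sum => i _; exact: A.
apply: (@le_trans _ _ (\sum_(i < N) \int[(cond_fst gamma (mV i) \x cond_snd gamma (mV i.+1))]_p (rd p.1 p.2)%:E)%E); last first.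
  by apply: lee_sum => i _; exact: B.
have opt := optimal_cost g1 g2.
have fc : (\int[gamma]_p (rd p.1 p.2)%:E)%E \is a fin_num.
  by rewrite ge0_fin_numE//; apply: integral_ge0.
rewrite -(@lee_pmul2l _ k%:E)// -(leeD2lE _ _ fc) -E.
by rewrite leeD2r.
Qed.

End CyclicMonotonicity.

Lemma ae_bounded_integrable {d : measure_display} {T : measurableType d} {R : realType}
    (P : {measure set T -> \bar R}) (f : T -> R) (C : R) :
  P setT = 1%E -> measurable_fun setT f -> {ae P, forall x, `|f x| <= C} -> P.-integrable setT (EFin \o f).
Proof.
move=> P1 mf fC; apply/integrableP; split; first exact/measurable_EFinP.
apply: (@le_lt_trans _ _ (\int[P]_x (cst (Num.max C 0)%:E x))%E); last first.
  by rewrite integral_cst// P1 mule1 ltry.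
apply: ae_ge0_le_integral => //.
- by apply: measurableT_comp => //; exact/measurable_EFinP.
- by move=> p _; rewrite lee_fin le_max lexx orbT.
by apply: aeS fC => p /= h _; rewrite lee_fin le_max h.
Qed.

(** * The shortest-path potential *)

Section ChainPotential.
Context {R : realType} {n : nat}.
Local Notation H := (heis R n).
Hypothesis n_gt0 : (0 < n)%N.
Variables (G : set (H * H)) (p0 : H * H).
Hypothesis Gp0 : G p0.
Hypothesis cyclical : forall (N : nat) (Q : nat -> H * H), (forall i, G (Q i)) -> Q 0%N = Q N ->
  \sum_(i < N) rd (Q i.+1).1 (Q i.+1).2 <= \sum_(i < N) rd (Q i).1 (Q i.+1).2.
Implicit Types (z x : H) (p : H * H) (s : seq (H * H)).

(* Telescopic costs along chains from [z] back to the base point [p0]; their infimum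
   is Rueschendorf's potential. *)
Fixpoint chain_cost z s : R :=
  if s is p :: s' then rd z p.2 - rd p.1 p.2 + chain_cost p.1 s'
  else rd z p0.2 - rd p0.1 p0.2.

Lemma chain_cost_lip z z' s : chain_cost z s <= chain_cost z' s + rd z z'.
Proof.
by case: s => [|p s] /=; [have := rd_triangle n_gt0 z' z p0.2|have := rd_triangle n_gt0 z' z p.2]; lra.
Qed.

(** The default value [p0] of [nth] supplies the last link back to the base point, so a chain from
    [p0] becomes a cycle. *)
Lemma chain_cost_sum p s : chain_cost p.1 s =
  \sum_(i < (size s).+1) (rd (nth p0 (p :: s) i).1 (nth p0 (p :: s) i.+1).2
                         - rd (nth p0 (p :: s) i.+1).1 (nth p0 (p :: s) i.+1).2).
Proof.
elim: s p => [|q s IH] p; first by rewrite big_ord_recl big_ord0 addr0.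
by rewrite big_ord_recl [LHS]/= IH.
Qed.

Lemma chain_cost_ge0 s : (forall p, p \in s -> G p) -> 0 <= chain_cost p0.1 s.
Proof.
move=> Gs; rewrite chain_cost_sum sumrB subr_ge0.
apply: (@cyclical (size s).+1 (nth p0 (p0 :: s))); last by rewrite /= nth_default.
move=> i; have [si|si] := leqP (size (p0 :: s)) i; first by rewrite nth_default.
by have := mem_nth p0 si; rewrite inE => /orP[/eqP ->|/Gs].
Qed.

Definition chain_potential z : R :=
  inf [set chain_cost z s | s in [set s : seq (H * H) | forall p, p \in s -> G p]].

Lemma chain_potential_le z s : (forall p, p \in s -> G p) -> chain_potential z <= chain_cost z s.
Proof.
move=> Gs; apply: ge_inf; last by exists s.
(* Chains starting at [p0.1] have nonnegative cost by cyclical monotonicity, and moving the start to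
   [z] costs at most the distance; so the infimum is finite. *)
exists (- rd p0.1 z) => _ [t /= Gt <-].
by have := chain_cost_ge0 Gt; have := chain_cost_lip p0.1 z t; lra.
Qed.

Lemma chain_potential_ge z (r : R) :
  (forall s, (forall p, p \in s -> G p) -> r <= chain_cost z s) -> r <= chain_potential z.
Proof.
by move=> h; apply: lb_le_inf; [exists (chain_cost z [::]), [::]|move=> _ [s /= Gs <-]; exact: h].
Qed.

Lemma chain_potential_lip z z' : `|chain_potential z - chain_potential z'| <= rd z z'.
Proof.
have h a b : chain_potential a - rd a b <= chain_potential b.
  apply: chain_potential_ge => s Gs.
  by have := chain_potential_le a Gs; have := chain_cost_lip a b s; lra.
by have := h z z'; have := h z' z; rewrite (rdC z' z) ler_norml; lra.
Qed.

(** Prepending [p] to a chain from [p.1] gives a chain from [p.2] that is cheaper by exactly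
    [rd p.1 p.2]. The other inequality is the Lipschitz bound. *)
Lemma chain_potential_eq p : G p -> chain_potential p.1 - chain_potential p.2 = rd p.1 p.2.
Proof.
move=> Gp; apply/le_anti/andP; split.
  by apply: le_trans (chain_potential_lip _ _); exact: ler_norm.
have h : chain_potential p.2 + rd p.1 p.2 <= chain_potential p.1.
  apply: chain_potential_ge => s Gs.
  have /(@chain_potential_le p.2) /= : forall q, q \in p :: s -> G q.
    by move=> q; rewrite inE => /orP[/eqP ->|/Gs].
  by rewrite rd_xx//; lra.
by move: h; lra.
Qed.

End ChainPotential.

(** * Saturation of Kantorovich potentials *)

Section KantorovichDuality.
Context {R : realType} {n : nat}.
Local Notation H := (heis R n).
Local Notation BH := (borelH R n).
Hypothesis n_gt0 : (0 < n)%N.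
Variables (mu nu : probability BH R) (gamma : probability (BH * BH)%type R).
Hypotheses (mu_c : compactly_supported mu) (nu_c : compactly_supported nu).
Hypothesis plan : transport_plan mu nu gamma.

Lemma rd_bounded_compact (K : set H) : compact K -> exists C : R, forall x, K x -> rd x 0 <= C.
Proof.
move=> cK; have [->|/set0P K0] := eqVneq K set0; first by exists 0.
have [|c _ cP] := @compact_EVT_max _ _ (fun x : H => rd x 0) K K0 cK.
  by apply: continuous_subspaceT; exact: rd_continuousl.
by exists (rd c 0) => x Kx; apply: cP; rewrite inE.
Qed.

Lemma compact_borelH (K : set H) : compact K -> measurable (K : set BH).
Proof.
move=> /(compact_closed (@norm_hausdorff _ _)) cK; rewrite -[K]setCK.
by apply: measurableC; apply: open_borelH; exact: closed_openC.
Qed.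

Lemma plan_ae_compact : exists C : R, {ae gamma, forall p, rd p.1 0 <= C /\ rd p.2 0 <= C}.
Proof.
have [K1 [cK1 K11]] := mu_c; have [K2 [cK2 K21]] := nu_c.
have [C1 C1P] := rd_bounded_compact cK1; have [C2 C2P] := rd_bounded_compact cK2.
have mK1 := compact_borelH cK1; have mK2 := compact_borelH cK2.
exists (Num.max C1 C2).
have h1 : {ae gamma, forall p, (K1 `*` setT) p}.
  apply: ae_full_set; [exact: measurableX| |exact: probability_setT].
  exact: etrans (plan mK1).1 K11.
have h2 : {ae gamma, forall p, (setT `*` K2) p}.
  apply: ae_full_set; [exact: measurableX| |exact: probability_setT].
  exact: etrans (plan mK2).2 K21.
apply: aeS (aeI h1 h2) => -[x y] [[/= /C1P x1 _] [/= _ /C2P y1]].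
by rewrite !le_max x1 y1 orbT.
Qed.

Lemma plan_cost_integrable : gamma.-integrable setT (fun p => (rd p.1 p.2)%:E).
Proof.
have [C CP] := plan_ae_compact.
apply: (@ae_bounded_integrable _ _ _ gamma (fun p => rd p.1 p.2) (C + C)).
- exact: probability_setT.
- exact: measurable_rd.
apply: aeS CP => -[x y] /= [h1 h2]; rewrite ger0_norm ?rd_ge0//.
by apply: le_trans (rd_triangle n_gt0 0 x y) _; rewrite (rdC 0 y) lerD.
Qed.

Section LipschitzIntegrals.
Variable v : H -> R.
Hypothesis Lv : forall x y, `|v x - v y| <= rd x y.

Let mv : measurable_fun setT (v : BH -> R).
Proof. by apply: continuous_borelH; exact: continuous_rd_lip. Qed.

Let v_bound x (C : R) : rd x 0 <= C -> `|v x| <= `|v 0| + C.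
Proof.
move=> xC; have -> : v x = v 0 + (v x - v 0) by ring.
by apply: le_trans (ler_normD _ _) _; rewrite lerD2l; exact: le_trans (Lv _ _) xC.
Qed.

Lemma lip_fst_integrable : gamma.-integrable setT (fun p => (v p.1)%:E).
Proof.
have [C CP] := plan_ae_compact.
apply: (@ae_bounded_integrable _ _ _ gamma (fun p => v p.1) (`|v 0| + C)).
- exact: probability_setT.
  by apply: (measurableT_comp mv); exact: measurable_fst.
by apply: aeS CP => p [h _]; exact: v_bound.
Qed.

Lemma lip_snd_integrable : gamma.-integrable setT (fun p => (v p.2)%:E).
Proof.
have [C CP] := plan_ae_compact.
apply: (@ae_bounded_integrable _ _ _ gamma (fun p => v p.2) (`|v 0| + C)).
- exact: probability_setT.
  by apply: (measurableT_comp mv); exact: measurable_snd.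
by apply: aeS CP => p [_ h]; exact: v_bound.
Qed.

Lemma plan_lip_integral :
  (\int[mu]_x (v x)%:E - \int[nu]_x (v x)%:E = \int[gamma]_p (v p.1 - v p.2)%:E)%E.
Proof.
have mfst : measurable_fun setT (fst : BH * BH -> BH) := measurable_fst.
have msnd : measurable_fun setT (snd : BH * BH -> BH) := measurable_snd.
pose m1 : {mfun (BH * BH)%type >-> BH} := fst.
pose m2 : {mfun (BH * BH)%type >-> BH} := snd.
transitivity (\int[distribution gamma m1]_x (v x)%:E - \int[distribution gamma m2]_x (v x)%:E)%E.
  congr (_ - _)%E; apply: eq_measure_integral => A mA _.
    apply: (etrans (esym (plan mA).1)); congr (gamma _).
    by apply/seteqP; split => [[x y] []|[x y]].
  apply: (etrans (esym (plan mA).2)); congr (gamma _).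
  by apply/seteqP; split => [[x y] []|[x y]].
rewrite !integral_distribution; [|exact/measurable_EFinP|exact: lip_snd_integrable|exact/measurable_EFinP|exact: lip_fst_integrable].
by under [RHS]eq_integral do rewrite EFinB; rewrite integralB//; [exact: lip_fst_integrable|exact: lip_snd_integrable].
Qed.

Lemma lip_diff_integrable : gamma.-integrable setT (fun p => (v p.1 - v p.2)%:E).
Proof.
apply: (@eq_integrable _ _ _ gamma _ measurableT (fun p => (v p.1)%:E - (v p.2)%:E)%E).
  by move=> p _; rewrite EFinB.
by apply: integrableB => //; [exact: lip_fst_integrable|exact: lip_snd_integrable].
Qed.

End LipschitzIntegrals.

(** The chain potential [v] attains the transport cost, and u does at least as well by maximality.
    So the nonnegative gap [rd p.1 p.2 - (u p.1 - u p.2)] has integral at most 0 and vanishes almost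
    everywhere. *)
Lemma potential_saturated (u : H -> R) :
  kantorovich_potential mu nu u -> optimal_plan mu nu gamma ->
  {ae gamma, forall p, u p.1 - u p.2 = rd p.1 p.2}.
Proof.
move=> [Lu umax] [_ opt].
have Lu' : forall x y, `|u x - u y| <= rd x y by move=> x y; exact: (Lip1_rd n_gt0 x y Lu).
have sup := plan_support_ae n_gt0 gamma.
have [p0 Gp0] : exists p0, plan_support gamma p0.
  apply: contrapT => /forallNP h.
  have : gamma.-negligible setT by apply: negligibleS sup => p _ /=; exact: h.
  move=> /(negligibleP gamma measurableT) /(etrans (esym (probability_setT gamma))) /eqP.
  by rewrite onee_eq0.
have fc : (\int[gamma]_p (rd p.1 p.2)%:E < +oo)%E.
  exact: integrable_lty plan_cost_integrable.
have cyc := @cyclical_monotonicity R n n_gt0 gamma fc _.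
have {}cyc N (Q : nat -> H * H) (GQ : forall i, plan_support gamma (Q i)) (QN : Q 0%N = Q N) :
    \sum_(i < N) rd (Q i.+1).1 (Q i.+1).2 <= \sum_(i < N) rd (Q i).1 (Q i.+1).2.
  apply: cyc => // gamma' h1 h2.
  have := opt gamma' (fun A mA => conj (etrans (h1 A mA) (plan mA).1) (etrans (h2 A mA) (plan mA).2)).
  rewrite /transport_cost => h.
  under eq_integral do rewrite -dSRE//.
  by under [leRHS]eq_integral do rewrite -dSRE//.
pose v := chain_potential (plan_support gamma) p0.
have Lv : forall x y, `|v x - v y| <= rd x y by exact: chain_potential_lip.
have vmax := umax v.
have Lv1 : Lip1 v by move=> x y; rewrite dSRE// lee_fin.
have {vmax} := vmax Lv1.
rewrite !plan_lip_integral// => vmax.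
have vE : (\int[gamma]_p (v p.1 - v p.2)%:E = \int[gamma]_p (rd p.1 p.2)%:E)%E.
  apply: ae_eq_integral => //.
  - exact: measurable_int (lip_diff_integrable Lv).
  - exact: measurable_int plan_cost_integrable.
  by apply: aeS sup => p Gp _; congr EFin; exact: chain_potential_eq.
pose g p := rd p.1 p.2 - (u p.1 - u p.2).
have g0 p : 0 <= g p by rewrite subr_ge0; apply: le_trans (Lu' _ _); exact: ler_norm.
have gi : (\int[gamma]_p (g p)%:E <= 0)%E.
  under eq_integral do rewrite EFinB.
  rewrite integralB//; [|exact: plan_cost_integrable|exact: lip_diff_integrable].
  rewrite -vE sube_le0//.
have mg : measurable_fun setT (fun p : BH * BH => (g p)%:E).
  apply/measurable_EFinP; apply: measurable_funB; first exact: measurable_rd.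
  by apply/measurable_EFinP; exact: measurable_int (lip_diff_integrable Lu').
have /(ae_eq_integral_abs gamma measurableT mg) : (\int[gamma]_p `|(g p)%:E| = 0)%E.
  under eq_integral do rewrite gee0_abs ?lee_fin//.
  by apply/eqP; rewrite eq_le gi/=; apply: integral_ge0 => p _; rewrite lee_fin.
by apply: aeS => p /(_ I) [] /eqP; rewrite subr_eq0 => /eqP.
Qed.

End KantorovichDuality.

(** * Transport densities *)

Section DensityIntegral.
Context {d : measure_display} {T : measurableType d} {R : realType}.
Variables (m : {measure set T -> \bar R}) (h : T -> R).
Hypotheses (mh : measurable_fun setT h) (h0 : forall x, 0 <= h x).
Local Open Scope ereal_scope.
Import HBNNSimple.

Local Notation nu := (density_measure m mh h0).

Lemma density_measure_indic (A : set T) : measurable A -> nu A = \int[m]_x ((\1_A x)%:E * (h x)%:E).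
Proof.
move=> mA; rewrite /density_measure integral_mkcond; apply: eq_integral => x _.
by rewrite patchE indicE; case: (x \in A); rewrite ?mul1e ?mul0e.
Qed.

Lemma integral_density_nnsfun (s : {nnsfun T >-> R}) :
  \int[nu]_x (s x)%:E = \int[m]_x ((s x)%:E * (h x)%:E).
Proof.
rewrite integralT_nnsfun sintegralE.
under [RHS]eq_integral.
  move=> x _; rewrite fimfunE -fsumEFin// muleC ge0_mule_fsumr; last first.
    by move=> r; rewrite EFinM nnfun_muleindic_ge0.
  over.
have mr (r : R) : measurable (s @^-1` [set r]) by [].
rewrite ge0_integral_fsum//; last 2 first.
- move=> r; apply: emeasurable_funM; first exact/measurable_EFinP.
  by apply/measurable_EFinP; apply: measurable_funM.
- by move=> r x _; apply: mule_ge0; [rewrite lee_fin|rewrite EFinM nnfun_muleindic_ge0].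
apply: eq_fsbigr => r rs; have r0 : (0 <= r)%R by move: rs => /set_mem [x _ <-].
transitivity (r%:E * \int[m]_x ((\1_(s @^-1` [set r]) x)%:E * (h x)%:E)).
  by congr (_ * _); exact: density_measure_indic.
rewrite -ge0_integralZl//; last 2 first.
- by apply: emeasurable_funM; apply/measurable_EFinP.
- by move=> x _; rewrite mule_ge0 ?lee_fin.
by apply: eq_integral => x _; rewrite EFinM muleA muleC.
Qed.

Lemma ge0_integral_density (f : T -> R) : measurable_fun setT f -> (forall x, (0 <= f x)%R) ->
  \int[nu]_x (f x)%:E = \int[m]_x ((f x)%:E * (h x)%:E).
Proof.
move=> mf f0; have mEf : measurable_fun setT (EFin \o f) by exact/measurable_EFinP.
pose f_ := nnsfun_approx measurableT mEf.
have fcvg x : EFin \o f_^~ x @ \oo --> (f x)%:E.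
  by apply: (@cvg_nnsfun_approx _ _ _ _ measurableT (EFin \o f) mEf) => // y _; rewrite lee_fin.
transitivity (limn (fun k => \int[nu]_x (f_ k x)%:E)).
  rewrite -monotone_convergence//=.
  - by apply: eq_integral => x _; apply/esym/cvg_lim => //; exact: fcvg.
  - by move=> k; exact/measurable_EFinP/measurable_funTS.
  - by move=> k x _; rewrite lee_fin.
  - by move=> x _ a b ab; rewrite lee_fin//; exact/lefP/nd_nnsfun_approx.
under [X in limn X]eq_fun do rewrite integral_density_nnsfun.
rewrite -monotone_convergence//=.
- apply: eq_integral => x _; apply/cvg_lim => //; apply: cvgeZr => //; exact: fcvg.
- by move=> k; apply: emeasurable_funM; apply/measurable_EFinP.
- by move=> k x _; rewrite mule_ge0 ?lee_fin.
- move=> x _ a b ab; rewrite lee_wpmul2r ?lee_fin//; exact/lefP/nd_nnsfun_approx.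
Qed.

End DensityIntegral.

(** * Continuous test functions determine finite measures *)

Section TestFunctions.
Context {R : realType} {n : nat}.
Local Notation H := (heis R n).
Local Notation BH := (borelH R n).
Hypothesis n_gt0 : (0 < n)%N.
Implicit Types (x y : H) (V : set H).

(** The distance to the complement of [V], truncated at 1. The element 1 also keeps the set nonempty
    when [V] is the whole space. *)
Definition depth V x : R := inf ([set rd x y | y in ~` V] `|` [set 1]).

Lemma depth_le1 V x : depth V x <= 1.
Proof. by apply: ge_inf; [exists 0 => _ [[y _ <-]|->] //; exact: rd_ge0|right]. Qed.

Lemma depth_le V x y : ~ V y -> depth V x <= rd x y.
Proof.
by move=> Vy; apply: ge_inf; [exists 0 => _ [[z _ <-]|->] //; exact: rd_ge0|left; exists y].
Qed.

Lemma depth_ge V x (r : R) : r <= 1 -> (forall y, ~ V y -> r <= rd x y) -> r <= depth V x.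
Proof.
by move=> r1 rV; apply: lb_le_inf; [exists 1; right|move=> _ [[y Vy <-]|->]//; exact: rV].
Qed.

Lemma depth_ge0 V x : 0 <= depth V x.
Proof. by apply: depth_ge => // y _; exact: rd_ge0. Qed.

Lemma depth_out V x : ~ V x -> depth V x = 0.
Proof. by move=> Vx; apply/le_anti; rewrite depth_ge0 -(rd_xx n_gt0 x) depth_le. Qed.

Lemma depth_gt0 V x : open V -> V x -> 0 < depth V x.
Proof.
move=> oV Vx; have [e e0 eV] : exists2 e : R, 0 < e & forall y, rd x y < e -> V y.
  by apply: nbhs_rd => //; exact: open_nbhs_nbhs.
have m0 : 0 < Num.min e 1 by rewrite lt_min e0 ltr01.
apply: lt_le_trans m0 _; apply: depth_ge; first by rewrite ge_min lexx orbT.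
by move=> y; apply: contra_notP => /negP; rewrite -ltNge lt_min => /andP[/eV].
Qed.

Lemma depth_continuous V : continuous (depth V).
Proof.
apply: continuous_rd_lip => // x y.
have h a b : depth V a - rd a b <= depth V b.
  apply: depth_ge => [|z Vz].
    by have := depth_le1 V a; have := rd_ge0 a b; clear; lra.
  by have := depth_le a Vz; have := rd_triangle n_gt0 b a z; clear; lra.
by have := h x y; have := h y x; rewrite (rdC y x) ler_norml; clear; lra.
Qed.

Definition bump V (k : nat) x : R := Num.min 1 (k%:R * depth V x).

Lemma bump_ge0 V k x : 0 <= bump V k x.
Proof. by rewrite le_min ler01 mulr_ge0// depth_ge0. Qed.

Lemma bump_le1 V k x : bump V k x <= 1.
Proof. by rewrite ge_min lexx. Qed.

Lemma bump_continuous V k : continuous (bump V k).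
Proof.
move=> x; apply: (@continuous_comp _ _ _ (fun x => k%:R * depth V x) (fun r : R => Num.min 1 r)).
  by apply: contM; [exact: cont_cst|exact: depth_continuous].
by apply: continuous_min; [exact: cvg_cst|exact: cvg_id].
Qed.

Lemma bump_nondecreasing V x : {homo (fun k => bump V k x) : k l / (k <= l)%N >-> k <= l}.
Proof.
move=> k l kl; rewrite le_min bump_le1/= ge_min; apply/orP; right.
by rewrite ler_wpM2r ?depth_ge0// ler_nat.
Qed.

Lemma bump_cvg V x : open V -> bump V k x @[k --> \oo] --> (\1_V x : R).
Proof.
move=> oV; rewrite indicE; have [/set_mem Vx|/negP Vx] := boolP (x \in V).
  have d0 := depth_gt0 oV Vx; apply: cvg_near_cst.
  have [k0 k0P] := ltr_add_invr d0; rewrite add0r in k0P.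
  exists k0.+1 => // k /= kk0; apply/min_idPl.
  rewrite -ler_pdivrMr// mul1r -[k%:R]invrK lef_pV2 ?posrE ?invr_gt0 ?ltr0n//; last exact: leq_trans kk0.
  by apply: ltW; apply: le_lt_trans k0P; rewrite lef_pV2 ?posrE ?ltr0n ?ler_nat//; exact: leq_trans kk0.
apply: cvg_near_cst; exists 0%N => // k _; rewrite /bump depth_out.
  by rewrite mulr0; apply/min_idPr.
by move=> Vx'; apply: Vx; rewrite inE.
Qed.

(** Bumps increase to indicators of open sets, so the measures agree on open sets by monotone
    convergence; these are stable under intersection and generate the Borel sets. *)
Lemma continuous_test_unique (m1 m2 : {measure set BH -> \bar R}) :
  (m1 setT < +oo)%E ->
  (forall phi : H -> R, continuous phi -> (forall x, 0 <= phi x <= 1) ->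
     (\int[m1]_x (phi x)%:E = \int[m2]_x (phi x)%:E)%E) ->
  forall A : set BH, measurable A -> m1 A = m2 A.
Proof.
move=> fm1 E.
have Eo (V : set H) : open V -> m1 V = m2 V.
  move=> oV; have mV := open_borelH oV.
  have lim (m : {measure set BH -> \bar R}) :
      (\int[m]_x (bump V k x)%:E)%E @[k --> \oo] --> m V.
    have -> : m V = (\int[m]_x limn (fun k => (bump V k x)%:E))%E.
      transitivity (\int[m]_x (\1_V x)%:E)%E; first by rewrite integral_indic// setIT.
      apply: eq_integral => x _.
      apply/esym/cvg_lim => //; apply: cvg_EFin; last exact: bump_cvg.
      by apply: nearW => k.
    apply: cvg_monotone_convergence => //.
    - by move=> k; apply/measurable_EFinP; apply: continuous_borelH; exact: bump_continuous.
    - by move=> k x _; rewrite lee_fin bump_ge0.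
    - by move=> x _ k l kl; rewrite lee_fin bump_nondecreasing.
  have : (\int[m1]_x (bump V k x)%:E)%E @[k --> \oo] --> m2 V.
    rewrite (_ : (fun k => _) = fun k => \int[m2]_x (bump V k x)%:E)%E; first exact: lim.
    by apply/funext => k; apply: E; [exact: bump_continuous|move=> x; rewrite bump_ge0 bump_le1].
  by apply: cvg_unique (lim m1) => //.
apply: (@measure_unique _ R BH (@open H) (fun=> setT)) => //.
- by move=> A B; exact: openI.
- by move=> _; exact: openT.
- by rewrite bigcup_const.
Qed.

End TestFunctions.

(** * Borel modification of the selection *)

Section CaratheodoryModification.
Context {d : measure_display} {T : measurableType d} {R : realType}.
Variable m : {measure set T -> \bar R}.
Hypothesis fm : (m setT < +oo)%E.
Local Open Scope ereal_scope.

Lemma mu_ext_fin (A : set T) : mu_ext m A \is a fin_num.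
Proof.
rewrite ge0_fin_numE; last exact: mu_ext_ge0.
apply: le_lt_trans fm; rewrite -measurable_mu_extE//.
by apply: le_mu_ext.
Qed.

Lemma measurable_hull (A : set T) : exists G, [/\ measurable G, A `<=` G & m G = mu_ext m A].
Proof.
have h k : exists F, [/\ measurable F, A `<=` F & m F < mu_ext m A + (k.+1%:R^-1)%:E].
  have k0 : (0 < k.+1%:R^-1 :> R)%R by rewrite invr_gt0 ltr0n.
  have [_ [F [mF AF] <-] lF] := lb_ereal_inf_adherent k0 (mu_ext_fin A).
  exists (\bigcup_i F i); split => //; first exact: bigcupT_measurable.
  apply: le_lt_trans lF; apply: measure_sigma_subadditive => //; exact: bigcupT_measurable.
have /choice[F FP] := h; exists (\bigcap_k F k); have mG : measurable (\bigcap_k F k).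
  by apply: bigcapT_measurable => k; case: (FP k).
split => //; first by move=> x Ax k _; case: (FP k) => _ + _; exact.
apply/eqP; rewrite eq_le; apply/andP; split; last first.
  rewrite -measurable_mu_extE//; apply: le_mu_ext => x Ax k _; case: (FP k) => _ + _; exact.
apply/lee_addgt0Pr => e e0; have [k] := ltr_add_invr e0; rewrite add0r => ke.
have [mF _ /ltW lF] := FP k.
apply: (@le_trans _ _ (m (F k))).
  by apply: le_measure; rewrite ?inE//; apply: bigcap_inf.
apply: le_trans lF _; rewrite leeD2l// lee_fin; exact: ltW.
Qed.

(** Splitting a measurable hull of [A] along [A] shows that the difference has outer measure 0; a
    hull of this difference is the null set [N]. *)
Lemma caratheodory_modification (A : set T) : (mu_ext m).-caratheodory A ->
  exists B N, [/\ measurable B, measurable N, m N = 0 & forall x, ~ N x -> (A x <-> B x)].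
Proof.
move=> cA; have [G [mG AG GA]] := measurable_hull A.
have [N [mN GN Nm]] := measurable_hull (G `&` ~` A).
have N0 : mu_ext m (G `&` ~` A) = 0.
  have := cA G; rewrite measurable_mu_extE// GA (setIidr AG).
  move: (mu_ext_fin A) (mu_ext_fin (G `&` ~` A)).
  case: (mu_ext m A) => // a _; case: (mu_ext m _) => // b _ /eqP.
  by rewrite -EFinD eqe addrC -subr_eq subrr => /eqP <-.
exists G, N; split => //; first by rewrite Nm.
by move=> x Nx; split => [/AG//|Gx]; apply: contra_notP Nx => Ax; apply: GN.
Qed.

End CaratheodoryModification.

Section SelectionModification.
Context {R : realType} {n : nat}.
Local Notation H := (heis R n).
Local Notation BH := (borelH R n).
Hypothesis n_gt0 : (0 < n)%N.
Variables (S : H * H -> R -> H) (gamma : probability (BH * BH)%type R).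
Hypothesis HS : geodesic_selection S.
Implicit Types (x y : H) (V : set H) (p : H * H) (t : R).

Lemma open_eval t V : t \in `[0%R, 1%R] -> open V ->
  open [set f : {uniform` (`[0%R, 1%R]%classic : set R) -> H} | V (f t)].
Proof.
move=> t01 oV; rewrite openE => f /= Vf; apply/uniform_nbhs.
have : nbhs (f t : H) V by exact: open_nbhs_nbhs.
rewrite -nbhs_entourageE => -[E entE EV]; exists E; split => // h hE.
by apply: EV; apply/xsectionP; exact: hE.
Qed.

Let tau (K i : nat) : R := i%:R / K.+1%:R.

Let tau01 K i : (i <= K)%N -> tau K i \in `[0%R, 1%R].
Proof.
move=> iK; rewrite in_itv /= divr_ge0//= ler_pdivrMr ?ltr0n// mul1r ler_nat.
exact: leqW.
Qed.

(** Countably many sample times and rational balls produce countably many null sets, united into one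
    [N]. A general open set is the union of the rational balls inside it. *)
Lemma selection_modification : exists N : set (BH * BH),
  [/\ measurable N, gamma N = 0%E &
   forall K i V, (i <= K)%N -> open V -> measurable ([set p | V (S p (tau K i))] `\` N : set (BH * BH))].
Proof.
pose W k l : set H := rball (qseq _ k) l.+1%:R^-1.
have oW k l : open (W k l).
  have c := @rd_continuousl R n n_gt0 (qseq (n + n).+1 k); move/continuousP: c => c.
  exact: (c _ (@open_lt _ l.+1%:R^-1)).
have /choice[BN BNP] (a : (nat * nat) * (nat * nat)) : exists BN : set (BH * BH) * set (BH * BH),
    [/\ measurable BN.1, measurable BN.2, gamma BN.2 = 0%E &
        (a.1.2 <= a.1.1)%N -> forall p, ~ BN.2 p -> (W a.2.1 a.2.2 (S p (tau a.1.1 a.1.2)) <-> BN.1 p)].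
  have [ia|ia] := leqP a.1.2 a.1.1; last first.
    by exists (set0, set0); split => //=; rewrite leqNgt ia.
  have fg : (gamma setT < +oo)%E by rewrite [gamma _]probability_setT ltry.
  have [B [N [mB mN N0 BN]]] := caratheodory_modification fg (HS.2 gamma _ (open_eval (tau01 ia) (oW a.2.1 a.2.2))).
  by exists (B, N).
pose N : set (BH * BH) := \bigcup_K \bigcup_i \bigcup_k \bigcup_l (BN ((K, i), (k, l))).2.
have mN : measurable N.
  have mBN a : measurable (BN a).2 by case: (BNP a).
  by do 4 (apply: bigcupT_measurable => ?); exact: mBN.
have N0 : gamma.-negligible N.
  have nBN a : gamma.-negligible (BN a).2 by case: (BNP a) => _ m2 z _; apply/negligibleP.
  by do 4 (apply: negligible_bigcup => ?); exact: nBN.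
exists N; split => //; first exact/negligibleP.
move=> K i V iK oV.
rewrite (_ : _ `\` N = (\bigcup_k \bigcup_(l in [set l | W k l `<=` V]) (BN ((K, i), (k, l))).1) `\` N).
  apply: measurableD => //; apply: bigcupT_measurable => k; apply: bigcup_measurable => l _.
  by case: (BNP (K, i, (k, l))).
have BNE k l p : ~ N p -> (W k l (S p (tau K i)) <-> (BN ((K, i), (k, l))).1 p).
  move=> Np; have [_ _ _ h] := BNP ((K, i), (k, l)); apply: h => // Np'; apply: Np.
  by exists K => //; exists i => //; exists k => //; exists l.
apply/seteqP; split => p [Vp Np]; split => //; last first.
  by case: Vp => k _ [l /= WV] /(BNE _ _ _ Np) /WV.
have [e e0 eV] : exists2 e : R, 0 < e & forall y, rd (S p (tau K i)) y < e -> V y.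
  by apply: nbhs_rd => //; exact: open_nbhs_nbhs.
have e2 : 0 < e / 2 by rewrite divr_gt0.
have [l] := ltr_add_invr e2; rewrite add0r => le.
have l0 : 0 < l.+1%:R^-1 :> R by rewrite invr_gt0 ltr0n.
have [k kx] := qseq_rd n_gt0 (S p (tau K i)) l0.
exists k => //; exists l; last by apply/BNE.
move=> y; rewrite /W /rball /= => yk; apply: eV.
have := rd_triangle n_gt0 (qseq _ k) (S p (tau K i)) y; rewrite (rdC (qseq _ k) y).
by move: kx yk le; move: (l.+1%:R^-1) => r; clear; lra.
Qed.

Lemma selection_continuous p : continuous (fun t => S p (clamp01 t)).
Proof.
apply: continuous_rV => i; have [gS _ _] := HS.1 p.1 p.2.
rewrite -surjective_pairing in gS.
have [c hc _] := geodesic_hcurve n_gt0 gS.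
exact: (ac01_clamp_continuous (hcurve_coord_ac i hc)).
Qed.

(* [E] is a limit of maps that are piecewise constant in time and sample S at the
   rational times [tau K i], each of which is Borel off a null set. *)
Lemma selection_joint_measurable : exists (N : set (BH * BH))
    (E : BH * BH * measurableTypeR R -> BH),
  [/\ measurable N, gamma N = 0%E, measurable_fun setT E &
      forall p t, ~ N p -> t \in `[0, 1[ -> E (p, t) = S p t].
Proof.
have [N [mN N0 NV]] := selection_modification.
pose D : set (BH * BH * measurableTypeR R) := (~` N) `*` `[0, 1[%classic.
have mD : measurable D by apply: measurableX; [exact: measurableC|exact: measurable_itv].
pose E (q : BH * BH * measurableTypeR R) : BH := if q \in D then S q.1 q.2 else 0.
exists N, E; split => //; last first.
  move=> p t Np t01; rewrite /E ifT// inE; split => //=.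
apply: (@measurability _ _ _ BH setT E (@open H) erefl) => _ [V oV <-]; rewrite setTI.
(* Membership in [V] is positivity of [psi], so limits of real functions can be used to prove a map
   into the group measurable. *)
pose psi : H -> R := depth V.
pose L (q : BH * BH * measurableTypeR R) : R := if q \in D then psi (S q.1 q.2) else 0.
suff mL : measurable_fun setT L.
  have -> : E @^-1` V = ([set q | 0 < L q] `&` D) `|` (if 0 \in V then ~` D else set0).
    apply/seteqP; split => q; rewrite /preimage /= /E /L; have [qD|qD] := boolP (q \in D).
    - by move=> Vq; left; split; [exact: depth_gt0|exact: set_mem].
    - move=> V0; right; rewrite mem_set//= => qD'; move: qD; by rewrite mem_set.
    - case=> [[q0 _]|]; first by apply: contrapT => /(depth_out n_gt0) q00; move: q0; rewrite /psi q00 ltxx.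
      by case: ifP => // _ /= []; exact: set_mem.
    - case=> [[]|]; first by rewrite ltxx.
      by case: ifP => // /set_mem.
  apply: measurableU; first apply: measurableI => //.
    have := mL measurableT `]0, +oo[%classic (measurable_itv _).
    rewrite setTI; congr measurable; apply/seteqP; split => q; rewrite /preimage /= in_itv /= andbT//.
  by case: ifP => _ //; exact: measurableC.
(* The half-open cells tile exactly [[0, 1[], which is why [E] follows [S] only there and the time 1
   is left to a null set. *)
pose h K (q : BH * BH * measurableTypeR R) : R :=
  \sum_(i < K.+1) \1_(`[tau K i, tau K i.+1[%classic) q.2 * (\1_(~` N) q.1 * psi (S q.1 (tau K i))).
apply: (@measurable_fun_cvg _ _ _ setT h).
  move=> K; apply: measurable_sum => i; apply: measurable_funM.
    apply: (@measurableT_comp _ _ _ _ _ _ (\1_(`[tau K i, tau K i.+1[%classic) : measurableTypeR R -> R)); last exact: measurable_snd.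
    exact: measurable_indic.
  apply: (@measurableT_comp _ _ _ _ _ _ (fun p : BH * BH => \1_(~` N) p * psi (S p (tau K i)))); last exact: measurable_fst.
  apply: (measurability _ (RGenOInfty.measurableE R)) => _ [_ [c ->] <-]; rewrite setTI.
  have [c0|c0] := ltP c 0.
    rewrite (_ : _ @^-1` _ = setT)//; apply/seteqP; split => p //= _; rewrite in_itv /= andbT.
    by apply: lt_le_trans c0 _; rewrite mulr_ge0// depth_ge0.
  have cpsi := @depth_continuous R n n_gt0 V; move/continuousP: cpsi => cpsi.
  rewrite (_ : _ @^-1` _ = [set p | (psi @^-1` [set r | c < r]) (S p (tau K i))] `\` N).
    by apply: NV; [rewrite -ltnS|apply: cpsi; exact: open_gt].
  apply/seteqP; split => p; rewrite /preimage /= in_itv /= andbT indicE; have [/set_mem Np|/negP Np] := boolP (p \in ~` N).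
  - by rewrite mul1r.
  - by rewrite mul0r ltNge c0.
  - by rewrite mul1r => -[].
  - by case=> _ Np'; exfalso; apply: Np; rewrite inE.
move=> [p t] _; rewrite /L; have [/set_mem [/= Np t01]|/negP qD] := boolP ((p, t) \in D); last first.
  rewrite (_ : (fun k => _) = cst 0); first exact: cvg_cst.
  apply/funext => K; rewrite /h big1// => i _ /=; rewrite !indicE.
  have [/set_mem /= ti|] := boolP (t \in _); last by rewrite mul0r.
  have [/set_mem Np|] := boolP (p \in _); last by rewrite mul0r mulr0.
  exfalso; apply: qD; rewrite inE; split => //=.
  have /andP[t0 t1] : 0 <= t < 1.
    move: ti; rewrite in_itv /= => /andP[h1 h2]; apply/andP; split.
      by apply: le_trans h1; rewrite divr_ge0.
    by apply: lt_le_trans h2 _; rewrite ler_pdivrMr ?ltr0n// mul1r ler_nat.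
  by rewrite in_itv /= t0.
have /andP[t0 t1] : 0 <= t < 1 by move: t01; rewrite in_itv.
pose i K := Num.truncn (K.+1%:R * t).
have iP K : (i K)%:R <= K.+1%:R * t < (i K).+1%:R by apply: trunc_itv; rewrite mulr_ge0.
have iK K : (i K < K.+1)%N.
  have /andP[h1 _] := iP K; rewrite -(ltr_nat R); apply: le_lt_trans h1 _.
  by rewrite gtr_pMr// ltr0n.
have hE K : h K (p, t) = psi (S p (tau K (i K))).
  rewrite /h (bigD1 (Ordinal (iK K)))//= big1 ?addr0.
    rewrite !indicE !mem_set//= ?mul1r//.
    have /andP[h1 h2] := iP K.
    rewrite in_itv /= /tau; apply/andP; split.
      by rewrite ler_pdivrMr ?ltr0n// mulrC.
    by rewrite ltr_pdivlMr ?ltr0n// mulrC.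
  move=> j /negP jK; rewrite indicE; have [/set_mem /=|] := boolP (t \in _); last by rewrite mul0r.
  rewrite in_itv /= ler_pdivrMr ?ltr0n// ltr_pdivlMr ?ltr0n// mulrC => /andP[h1 h2].
  exfalso; apply: jK; apply/eqP/val_inj => /=.
  have /andP[h3 h4] := iP K.
  have := le_lt_trans h1 h4; have := le_lt_trans h3 h2; rewrite !ltr_nat !ltnS => ij ji.
  by apply/eqP; rewrite eqn_leq ij ji.
have tauc : tau K (i K) @[K --> \oo] --> t.
  apply/cvgrPdist_lt => e e0; have [k] := ltr_add_invr e0; rewrite add0r => ke.
  exists k => // K /= kK; have /andP[h1 h2] := iP K.
  have K0 : 0 < K.+1%:R :> R by rewrite ltr0n.
  apply: le_lt_trans ke; apply: (@le_trans _ _ K.+1%:R^-1); last first.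
    by rewrite lef_pV2 ?posrE ?ltr0n// ler_nat.
  rewrite ger0_norm; last by rewrite subr_ge0 ler_pdivrMr// mulrC.
  rewrite lerBlDr -[X in X + _]mul1r -mulrDl ler_pdivlMr// mulrC.
  by apply: ltW; apply: lt_le_trans h2 _; rewrite -natr1 addrC.
have tcl : clamp01 t = t by apply: clamp01_id; rewrite in_itv /= t0 ltW.
have -> : (fun K => h K (p, t)) = (fun K => psi (S p (clamp01 (tau K (i K))))).
  by apply/funext => K; rewrite hE clamp01_id//; apply: tau01; rewrite -ltnS.
rewrite -[X in psi (S _ X)]tcl.
apply: (@continuous_cvg _ _ _ _ _ (fun K => tau K (i K)) (fun s => psi (S p (clamp01 s))) t) => //.
apply: (@continuous_comp _ _ _ (fun s => S p (clamp01 s)) psi); first exact: selection_continuous.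
exact: depth_continuous.
Qed.

End SelectionModification.

Section GradientBound.
Context {R : realType} {n : nat}.
Local Notation H := (heis R n).
Hypothesis n_gt0 : (0 < n)%N.

(** Quotients along [Xfield j] are bounded by 1, and where the derivative does not exist its default
    value is 0; so the bound holds at every point. *)
Lemma hgrad_le1 (u : H -> R) (x : H) j : (forall x y, `|u x - u y| <= rd x y) -> `|hgrad u x 0 j| <= 1.
Proof.
move=> Lu; rewrite mxE.
have q1 (s : R) : s != 0 -> `|quot u j s x| <= 1.
  move=> s0; rewrite /quot XfieldE normrM normfV mulrC ler_pdivrMr ?normr_gt0// mul1r.
  apply: le_trans (Lu _ _) _; rewrite rdC -[leRHS](enorm_delta s j); exact: rd_hstep.
have [dx|dx] := pselect (derivable u x (Xfield j x)); last first.
  by rewrite /derive dvgP// /point/= normr0 ler01.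
have /cvgrPdist_lt cx : quot u j s x @[s --> 0^'] --> 'D_(Xfield j x) u x by exact: dx.
rewrite leNgt; apply/negP => bad; have e0 : 0 < `|'D_(Xfield j x) u x| - 1 by rewrite subr_gt0.
have := cx _ e0; rewrite near_withinE => /nbhs_ballP[d /= d0 dP].
have d2 : d / 2 != 0 by rewrite mulf_neq0 ?invr_eq0 ?pnatr_eq0// gt_eqF.
have : `|'D_(Xfield j x) u x - quot u j (d / 2) x| < `|'D_(Xfield j x) u x| - 1.
  apply: dP => //; rewrite /ball /= sub0r normrN gtr0_norm ?divr_gt0//.
  by rewrite ltr_pdivrMr// ltr_pMr// ltr1n.
have := q1 _ d2; have := lerB_dist ('D_(Xfield j x) u x) (quot u j (d / 2) x).
by move: (quot _ _ _ _) ('D_(_) u x : R) => a b; clear; lra.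
Qed.

End GradientBound.

(** * The transport density as a push-forward *)

Section TransportDensity.
Context {R : realType} {n : nat}.
Local Notation H := (heis R n).
Local Notation BH := (borelH R n).
Hypothesis n_gt0 : (0 < n)%N.
Variables (S : H * H -> R -> H) (gamma : probability (BH * BH)%type R).
Hypothesis HS : geodesic_selection S.
Variable u : H -> R.
Hypothesis Lu : Lip1 u.
Hypothesis sat : {ae gamma, forall p, u p.1 - u p.2 = rd p.1 p.2}.
Hypothesis cost_integrable : gamma.-integrable setT (fun p => (rd p.1 p.2)%:E).
Variable a : {measure set BH -> \bar R}.
Hypothesis Ha : transport_density S gamma a.
Variables (N : set (BH * BH)) (E : BH * BH * measurableTypeR R -> BH).
Hypotheses (mN : measurable N) (N0 : gamma N = 0%E) (mE : measurable_fun setT E).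
Hypothesis ES : forall p t, ~ N p -> t \in `[0, 1[ -> E (p, t) = S p t.

Local Notation I01 := (`[0%R, 1%R]%classic : set (measurableTypeR R)).
Local Notation L := (@lebesgue_measure R).
Local Notation M := (gamma \x L)%E.

Let Lu' x y : `|u x - u y| <= rd x y.
Proof. exact: Lip1_rd. Qed.

Let cu : continuous u.
Proof. exact: continuous_rd_lip. Qed.

Lemma notN_ae : {ae gamma, forall p, ~ N p}.
Proof. by exists N; split => // p /= /contrapT. Qed.

Lemma selection_curve p : exists2 c : R -> 'rV[R]_(n + n),
  hcurve (S p) c & [/\ forall t, enorm (c t) = rd p.1 p.2, S p 0 = p.1 & S p 1 = p.2].
Proof.
have [gS S0 S1] := HS.1 p.1 p.2; rewrite -surjective_pairing in gS S0 S1.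
have [c hc ec] := geodesic_hcurve n_gt0 gS.
by exists c => //; rewrite S0 S1 in ec; split.
Qed.

Lemma selection_speed p : ~ N p ->
  {ae L, forall t : R, t \in `[0, 1] -> E (p, t) = S p t /\ speed (S p) t = rd p.1 p.2}.
Proof.
move=> Np; have [c [_ _ hv] [ec _ _]] := selection_curve p.
apply: ae_itv_oo_cc; apply: aeS hv => t h t01; split.
  by apply: ES => //; move: t01; rewrite !in_itv /= => /andP[/ltW -> ->].
by rewrite (has_vel_speed (h t01)).
Qed.

Lemma selection_velocity p : ~ N p -> u p.1 - u p.2 = rd p.1 p.2 ->
  {ae L, forall t : R, t \in `[0, 1] -> E (p, t) = S p t /\
     hcoord (S p t) (derive1 (S p) t) = - (rd p.1 p.2 *: hgrad u (E (p, t)))}.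
Proof.
move=> Np up; have [c hc [ec S0 S1]] := selection_curve p; have [_ _ hv] := hc.
have vel : {ae L, forall t : R, t \in `]0, 1[ -> c t = - (rd p.1 p.2 *: hgrad u (S p t))}.
  have [r0|r0] := eqVneq (rd p.1 p.2) 0.
    apply: aeW => t _; rewrite r0 scale0r oppr0; apply/rowP => j; rewrite mxE.
    by apply/eqP; rewrite -normr_le0 -r0 -(ec t) coord_le_enorm.
  apply: ray_velocity => //; first by rewrite lt_neqAle eq_sym r0 rd_ge0.
  by rewrite S0 S1.
apply: ae_itv_oo_cc; apply: aeS (aeI hv vel) => t [h1 h2] t01.
have EE : E (p, t) = S p t.
  by apply: ES => //; move: t01; rewrite !in_itv /= => /andP[/ltW -> ->].
by rewrite EE (has_vel_hcoord (h1 t01)) h2.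
Qed.

Lemma selection_taylor p : ~ N p -> u p.1 - u p.2 = rd p.1 p.2 -> 0 < rd p.1 p.2 ->
  {ae L, forall t : R, t \in `[0, 1] -> taylor_set u (E (p, t))}.
Proof.
move=> Np up r0; have [c hc [ec S0 S1]] := selection_curve p.
apply: ae_itv_oo_cc; apply: aeW => t t01.
have -> : E (p, t) = S p t.
  by apply: ES => //; move: t01; rewrite !in_itv /= => /andP[/ltW -> ->].
apply/taylor_setP => //; apply: (ray_taylor2 n_gt0 Lu hc r0 ec) => //.
by rewrite S0 S1.
Qed.

(** The constant speed of the selected geodesic, cut off to [0,1]: the density with respect to
    [gamma \x L] of the measure whose image under [E] is the transport density. *)
Definition time_weight (q : BH * BH * measurableTypeR R) : R := rd q.1.1 q.1.2 * \1_I01 q.2.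

Lemma measurable_time_weight : measurable_fun setT time_weight.
Proof.
apply: measurable_funM.
  apply: (@measurableT_comp _ _ _ _ _ _ (fun p : BH * BH => rd p.1 p.2)); last exact: measurable_fst.
  exact: measurable_rd.
apply: (@measurableT_comp _ _ _ _ _ _ (\1_I01 : measurableTypeR R -> R)); last exact: measurable_snd.
by apply: measurable_indic; exact: measurable_itv.
Qed.

Lemma time_weight_ge0 q : 0 <= time_weight q.
Proof. by rewrite mulr_ge0 ?rd_ge0// indicE. Qed.

Lemma inner_integral (f : H -> R) p :
  (\int[L]_t (f (E (p, t)) * time_weight (p, t))%:E =
   \int[L]_(t in I01) (f (E (p, t)) * rd p.1 p.2)%:E)%E.
Proof.
rewrite [RHS]integral_mkcond; apply: eq_integral => t _.
rewrite patchE /time_weight indicE /=; case: ifP => _; first by rewrite mulr1.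
by rewrite mulr0 mulr0.
Qed.

Lemma ray_measure : exists b : {measure set BH -> \bar R}, forall f : BH -> R,
  measurable_fun setT f -> (forall x, 0 <= f x) ->
  (\int[b]_x (f x)%:E = \int[M]_q (f (E q) * time_weight q)%:E)%E.
Proof.
pose m0 : {measure set (BH * BH * measurableTypeR R)%type -> \bar R} :=
  density_measure M measurable_time_weight time_weight_ge0.
pose b0 : {measure set BH -> \bar R} := pushforward m0 E.
pose b := b0 mE.
exists b => f mf f0.
have mEf : measurable_fun setT (EFin \o f) by exact/measurable_EFinP.
have := @ge0_integral_pushforward _ _ _ _ R E mE m0 setT (EFin \o f) measurableT mEf.
move=> h; apply: (etrans (h _)); first by move=> x _; rewrite lee_fin.
have mfE : measurable_fun setT (f \o E) by exact: measurableT_comp.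
rewrite preimage_setT [LHS](ge0_integral_density _ _ _ mfE (fun q => f0 (E q))).
by apply: eq_integral => q _; rewrite EFinM.
Qed.

(** The integrals in the definition of [a] involve [S] and its speed; they are replaced by Borel
    expressions in [E], in time along almost every ray and then over almost every pair. *)
Lemma test_integral (phi : H -> R) : continuous phi ->
  (\int[a]_x (phi x)%:E = \int[gamma]_p \int[L]_t (phi (E (p, t)) * time_weight (p, t))%:E)%E.
Proof.
move=> cphi; rewrite (Ha cphi); apply: ae_eq_nmintegral.
apply: aeS notN_ae => p Np _.
rewrite inner_integral; apply: ae_eq_nmintegral.
by apply: aeS (selection_speed Np) => t h /h [-> ->].
Qed.

Lemma weight_integral : (\int[M]_q (time_weight q)%:E = \int[gamma]_p (rd p.1 p.2)%:E)%E.
Proof.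
rewrite fubini_tonelli1//; last 2 first.
- by apply/measurable_EFinP; exact: measurable_time_weight.
- by move=> q; rewrite lee_fin time_weight_ge0.
apply: eq_integral => p _; rewrite /fubini_F.
transitivity (\int[L]_t (1 * time_weight (p, t))%:E)%E.
  by apply: eq_integral => t _; rewrite mul1r.
rewrite (inner_integral (fun=> 1)).
transitivity (\int[L]_(t in I01) (cst (rd p.1 p.2)%:E t))%E.
  by apply: eq_integral => t _; rewrite mul1r.
by rewrite integral_cst//= lebesgue_measure_itv/= lte_fin ltr01 oppr0 adde0 mule1.
Qed.

Lemma transport_density_fin : (a setT < +oo)%E.
Proof.
have -> : a setT = (\int[a]_x (1 : R)%:E)%E by rewrite integral_cst// mul1e.
rewrite (test_integral (phi := fun=> 1)); last exact: cont_cst.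
have := weight_integral.
rewrite fubini_tonelli1//; last 2 first.
- by apply/measurable_EFinP; exact: measurable_time_weight.
- by move=> q; rewrite lee_fin time_weight_ge0.
rewrite /fubini_F => E1.
under eq_integral do (under eq_integral do rewrite mul1r).
rewrite E1; exact: integrable_lty.
Qed.

(** [a] and the push-forward measure have the same integrals on continuous test functions, hence
    coincide; this carries the formula from continuous to Borel functions. *)
Lemma transport_density_integral (f : BH -> R) : measurable_fun setT f -> (forall x, 0 <= f x) ->
  (\int[a]_x (f x)%:E = \int[M]_q (f (E q) * time_weight q)%:E)%E.
Proof.
have [b bE] := ray_measure.
move=> mf f0; rewrite -bE//; apply: eq_measure_integral => A mA _.
apply: continuous_test_unique => //; first exact: transport_density_fin.
move=> phi cphi phi01; have phi0 x : 0 <= phi x by case/andP: (phi01 x).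
rewrite test_integral// bE//; last exact: continuous_borelH.
rewrite fubini_tonelli1//.
  apply/measurable_EFinP; apply: measurable_funM; last exact: measurable_time_weight.
  by apply: (measurableT_comp _ mE); exact: continuous_borelH.
by move=> q; rewrite lee_fin mulr_ge0// time_weight_ge0.
Qed.

(** Rays of length 0 carry no mass, and on the other saturated rays every interior point admits the
    expansion. *)
Lemma taylor_ae : {ae a, forall x, taylor_set u x}.
Proof.
have mG := measurable_taylor_set n_gt0 cu.
exists (~` taylor_set u); split; [exact: measurableC| |by []].
have : (\int[a]_x (\1_(~` taylor_set u) x)%:E = 0)%E.
  rewrite transport_density_integral//; last exact/measurable_indic/measurableC.
  rewrite fubini_tonelli1//; last 2 first.
  - apply/measurable_EFinP; apply: measurable_funM; last exact: measurable_time_weight.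
    by apply: (measurableT_comp _ mE); exact/measurable_indic/measurableC.
  - by move=> q; rewrite lee_fin mulr_ge0// ?time_weight_ge0// indicE.
  rewrite -(integral0 gamma setT); apply: ae_eq_nmintegral.
  apply: aeS (aeI notN_ae sat) => p [Np up] _; rewrite /fubini_F.
  rewrite (inner_integral (\1_(~` taylor_set u))) -(integral0 L I01); apply: ae_eq_nmintegral.
  have [r0|r0] := eqVneq (rd p.1 p.2) 0; first by apply: aeW => t _; rewrite r0 mulr0.
  have r1 : 0 < rd p.1 p.2 by rewrite lt_neqAle eq_sym r0 rd_ge0.
  apply: aeS (selection_taylor Np up r1) => t h /h Gt.
  by rewrite indicE memNset ?mul0r//=; apply: contrapT.
by rewrite integral_indic ?setIT//; exact: measurableC.
Qed.

Lemma transport_density_signed (g : BH -> R) : measurable_fun setT g -> (forall x, `|g x| <= 1) ->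
  (\int[a]_x (g x)%:E = \int[gamma]_p \int[L]_(t in I01) (g (E (p, t)) * rd p.1 p.2)%:E)%E.
Proof.
move=> mg g1.
pose gp x := Num.max (g x) 0; pose gm x := Num.max (- g x) 0.
have mgp : measurable_fun setT (gp : BH -> R) by apply: measurable_maxr.
have mgm : measurable_fun setT (gm : BH -> R) by apply: measurable_maxr => //; exact: measurableT_comp.
have gp0 x : 0 <= gp x by rewrite le_max lexx orbT.
have gm0 x : 0 <= gm x by rewrite le_max lexx orbT.
have gE x : g x = gp x - gm x.
  by rewrite /gp /gm; have [h|h] := leP (g x) 0; [rewrite max_l ?oppr_ge0// sub0r opprK|rewrite max_r ?oppr_le0 ?ltW// subr0].
have gp1 x : `|gp x| <= 1.
  by rewrite ger0_norm// ge_max ler01 andbT; apply: le_trans (ler_norm _) (g1 x).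
have gm1 x : `|gm x| <= 1.
  by rewrite ger0_norm// ge_max ler01 andbT; apply: le_trans (ler_norm _) _; rewrite normrN.
have ia (f : BH -> R) : measurable_fun setT f -> (forall x, `|f x| <= 1) -> a.-integrable setT (EFin \o f).
  move=> mf f1; apply: measurable_bounded_integrable => //; first exact: transport_density_fin.
  by exists 1; split => // r /ltW r1 x _; exact: le_trans (f1 x) r1.
have iM (f : BH -> R) : measurable_fun setT f -> (forall x, `|f x| <= 1) ->
    M.-integrable setT (fun q => (f (E q) * time_weight q)%:E).
  move=> mf f1; apply: (@le_integrable _ _ _ _ _ measurableT _ (fun q => (time_weight q)%:E)).
  - apply/measurable_EFinP; apply: measurable_funM; last exact: measurable_time_weight.
    exact: (measurableT_comp mf mE).
  - move=> q _; rewrite lee_fin normrM ler_piMl//.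
  apply/integrableP; split; first by apply/measurable_EFinP; exact: measurable_time_weight.
  under eq_integral do rewrite gee0_abs ?lee_fin ?time_weight_ge0//.
  by rewrite weight_integral; exact: integrable_lty.
transitivity (\int[M]_q (g (E q) * time_weight q)%:E)%E.
  under eq_integral do rewrite gE EFinB.
  rewrite integralB//; [|exact: ia|exact: ia].
  rewrite !transport_density_integral// -integralB//; [|exact: iM|exact: iM].
  by apply: eq_integral => q _; rewrite [in RHS]gE mulrBl EFinB.
rewrite -integral12_prod_meas1; last exact: iM.
by apply: eq_integral => p _; rewrite /fubini_F inner_integral.
Qed.

End TransportDensity.

(** * Densities of signed measures *)

Section ChargeDensity.
Context {R : realType} {n : nat}.
Local Notation H := (heis R n).
Local Notation BH := (borelH R n).
Hypothesis n_gt0 : (0 < n)%N.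
Local Open Scope ereal_scope.

Lemma charge_integral_jordan (nu : {charge set BH -> \bar R}) :
  exists P N (PN : hahn_decomposition nu P N), forall f : H -> R,
    charge_integral nu f = \int[jordan_pos PN]_x (f x)%:E - \int[jordan_neg PN]_x (f x)%:E.
Proof. by exists (projT1 (cid (Hahn_decomposition nu))); do 2 eexists. Qed.

Lemma charge_integral0 (nu : {charge set BH -> \bar R}) : charge_integral nu (fun=> 0%R) = 0.
Proof. by rewrite /charge_integral !integral0 sube0. Qed.

Lemma bounded_integrable (m : {measure set BH -> \bar R}) (f : BH -> R) (A : set BH) : m setT < +oo ->
  measurable A -> measurable_fun setT f -> (forall x, (`|f x| <= 1)%R) -> m.-integrable A (EFin \o f).
Proof.
move=> fm mA mf f1; apply: (@integrableS _ _ _ m setT) => //.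
apply: measurable_bounded_integrable => //.
by exists 1%R; split => // r /ltW r1 x _; exact: le_trans (f1 x) r1.
Qed.

(* Moving the negative parts of [nu] and of [g] to the other side reduces the claim to
   the equality of two finite positive measures. *)
Lemma charge_density (nu : {charge set BH -> \bar R}) (a : {measure set BH -> \bar R}) (g : BH -> R) :
  a setT < +oo -> measurable_fun setT g -> (forall x, (`|g x| <= 1)%R) ->
  (forall psi : H -> R, continuous psi -> (forall x, (0 <= psi x <= 1)%R) ->
    charge_integral nu psi = \int[a]_x (psi x * g x)%:E) ->
  forall A : set BH, measurable A -> nu A = \int[a]_(x in A) (g x)%:E.
Proof.
move=> fa mg g1 test A mA.
have [P [N [PN nuE]]] := charge_integral_jordan nu.
pose gp x : R := Num.max (g x) 0%R; pose gm x : R := Num.max (- g x)%R 0%R.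
have mgp : measurable_fun setT (gp : BH -> R) by apply: measurable_maxr.
have mgm : measurable_fun setT (gm : BH -> R) by apply: measurable_maxr => //; exact: measurableT_comp.
have gp0 x : (0 <= gp x)%R by rewrite le_max lexx orbT.
have gm0 x : (0 <= gm x)%R by rewrite le_max lexx orbT.
have gE x : g x = (gp x - gm x)%R.
  by rewrite /gp /gm; have [h|h] := leP (g x) 0%R; [rewrite max_l ?oppr_ge0// sub0r opprK|rewrite max_r ?oppr_le0 ?ltW// subr0].
have gp1 x : (`|gp x| <= 1)%R.
  by rewrite ger0_norm// ge_max ler01 andbT; apply: le_trans (ler_norm _) (g1 x).
have gm1 x : (`|gm x| <= 1)%R.
  by rewrite ger0_norm// ge_max ler01 andbT; apply: le_trans (ler_norm _) _; rewrite normrN.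
pose dp : {measure set BH -> \bar R} := density_measure a mgp gp0.
pose dm : {measure set BH -> \bar R} := density_measure a mgm gm0.
pose jp : {measure set BH -> \bar R} := jordan_pos PN.
pose jn : {measure set BH -> \bar R} := jordan_neg PN.
have fjp B : measurable B -> jp B \is a fin_num by move=> mB; exact: (fin_num_measure (jordan_pos PN)).
have fjn B : measurable B -> jn B \is a fin_num by move=> mB; exact: (fin_num_measure (jordan_neg PN)).
have jpT : jp setT < +oo by rewrite ltey_eq fjp.
have jnT : jn setT < +oo by rewrite ltey_eq fjn.
have fdp B : measurable B -> dp B \is a fin_num.
  by move=> mB; exact: integrable_fin_num (bounded_integrable fa mB mgp gp1).
have fdm B : measurable B -> dm B \is a fin_num.
  by move=> mB; exact: integrable_fin_num (bounded_integrable fa mB mgm gm1).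
have key B : measurable B -> jp B + dm B = jn B + dp B.
  move=> mB; rewrite -[LHS](measure_addE jp dm) -[RHS](measure_addE jn dp).
  apply: (continuous_test_unique n_gt0) => //.
    have fT : jp setT + dm setT < +oo by rewrite ltey_eq fin_numD fjp// fdm.
    by rewrite -(measure_addE jp dm) in fT.
  move=> psi cpsi psi01; have psi0 x : (0 <= psi x)%R by case/andP: (psi01 x).
  have psi1 x : (`|psi x| <= 1)%R by rewrite ger0_norm//; case/andP: (psi01 x).
  have mpsi : measurable_fun setT (psi : BH -> R) by exact: continuous_borelH.
  have e0 (x : BH) : setT x -> 0 <= (psi x)%:E by rewrite lee_fin.
  have me : measurable_fun setT (EFin \o (psi : BH -> R)) by exact/measurable_EFinP.
  rewrite (@ge0_integral_measure_add _ _ _ jp dm _ measurableT _ e0 me).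
  rewrite (@ge0_integral_measure_add _ _ _ jn dp _ measurableT _ e0 me).
  have idp : a.-integrable setT (fun x => (psi x * gp x)%:E).
    apply: bounded_integrable => //; first exact: measurable_funM.
    by move=> x; rewrite normrM mulr_ile1.
  have idm : a.-integrable setT (fun x => (psi x * gm x)%:E).
    apply: bounded_integrable => //; first exact: measurable_funM.
    by move=> x; rewrite normrM mulr_ile1.
  have dpE : \int[dp]_x (psi x)%:E = \int[a]_x (psi x * gp x)%:E.
    by rewrite ge0_integral_density//; apply: eq_integral => x _; rewrite EFinM.
  have dmE : \int[dm]_x (psi x)%:E = \int[a]_x (psi x * gm x)%:E.
    by rewrite ge0_integral_density//; apply: eq_integral => x _; rewrite EFinM.
  rewrite dpE dmE.
  have := test _ cpsi psi01; rewrite nuE.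
  have -> : \int[a]_x (psi x * g x)%:E = \int[a]_x (psi x * gp x)%:E - \int[a]_x (psi x * gm x)%:E.
    by rewrite -integralB//; apply: eq_integral => x _; rewrite gE mulrBr EFinB.
  have f1 := integrable_fin_num measurableT (bounded_integrable jpT measurableT mpsi psi1).
  have f2 := integrable_fin_num measurableT (bounded_integrable jnT measurableT mpsi psi1).
  have f3 := integrable_fin_num measurableT idp.
  have f4 := integrable_fin_num measurableT idm.
  rewrite -/jp -/jn; move: f1 f2 f3 f4; rewrite /comp.
  case: (\int[jp]_x _) => // r1 _; case: (\int[jn]_x _) => // r2 _.
  case: (\int[a]_x _) => // r3 _; case: (\int[a]_x _) => // r4 _.
  rewrite -!EFinB -!EFinD => -[h]; congr EFin; move: h; clear; lra.
have -> : nu A = jp A - jn A by rewrite (jordan_decomp PN mA) /cadd /= cscaleN1.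
have -> : \int[a]_(x in A) (g x)%:E = dp A - dm A.
  rewrite -[dp A]/(\int[a]_(x in A) (gp x)%:E) -[dm A]/(\int[a]_(x in A) (gm x)%:E).
  rewrite -integralB//; [|exact: bounded_integrable|exact: bounded_integrable].
  by apply: eq_integral => x _; rewrite gE EFinB.
have := key A mA; move: (fjp A mA) (fjn A mA) (fdp A mA) (fdm A mA).
case: (jp A) => // r1 _; case: (jn A) => // r2 _; case: (dp A) => // r3 _; case: (dm A) => // r4 _.
by rewrite -!EFinB -!EFinD => -[h]; congr EFin; move: h; clear; lra.
Qed.

End ChargeDensity.

(** The first conclusion gives the pointwise gradient its meaning: [a] is concentrated on points of
    Pansu differentiability of u. *)
Theorem proposition4p2 (R : realType) (n : nat) (n_ge1 : (1 <= n)%N)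
  (S : heis R n * heis R n -> R -> heis R n) (HS : geodesic_selection S)
  (mu nu : probability (borelH R n) R)
  (mu_c : compactly_supported mu) (nu_c : compactly_supported nu)
  (u : heis R n -> R) (Hu : kantorovich_potential mu nu u)
  (gamma : probability (borelH R n * borelH R n)%type R)
  (Hgamma : optimal_plan mu nu gamma)
  (a : {measure set (borelH R n) -> \bar R})
  (Ha : transport_density S gamma a)
  (w : 'I_(n + n) -> {charge set (borelH R n) -> \bar R})
  (Hw : vector_transport_density S gamma w) :
  [/\ {ae a, forall x, pansu_differentiable u x},
      forall j, w j `<< a &
      has_density w a (fun x => - hgrad u x)].
Proof.
have Lu : Lip1 u by case: Hu.
have plan : transport_plan mu nu gamma by case: Hgamma.
have Lu' x y : `|u x - u y| <= rd x y by exact: Lip1_rd.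
have cu : continuous u by exact: continuous_rd_lip.
have sat := potential_saturated n_ge1 mu_c nu_c plan Hu Hgamma.
have ci := plan_cost_integrable n_ge1 mu_c nu_c plan.
have [N [E [mN N0 mE ES]]] := selection_joint_measurable n_ge1 gamma HS.
have fa := transport_density_fin n_ge1 HS ci Ha mN N0 ES.
have mg j : measurable_fun setT (fun x : borelH R n => - hgrad u x 0 j).
  by apply: measurableT_comp => //; exact: measurable_hgrad_coord.
have g1 j (x : borelH R n) : `|- hgrad u x 0 j| <= 1 by rewrite normrN; exact: hgrad_le1.
have gi j (A : set (borelH R n)) : measurable A -> a.-integrable A (fun x => ((- hgrad u x) 0 j)%:E).
  move=> mA; have -> : (fun x : borelH R n => ((- hgrad u x) 0 j)%:E) = EFin \o (fun x => - hgrad u x 0 j).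
    by apply/funext => x /=; rewrite mxE.
  exact: bounded_integrable.
have dens j (A : set (borelH R n)) : measurable A -> w j A = (\int[a]_(x in A) ((- hgrad u x) 0%R j)%:E)%E.
  move=> mA; under eq_integral do rewrite mxE.
  apply: (charge_density n_ge1 fa (mg j) (g1 j)) => // psi cpsi psi01.
  have psi1 x : `|psi x| <= 1 by case/andP: (psi01 x) => h1 h2; rewrite ger0_norm.
  rewrite (transport_density_signed n_ge1 HS ci Ha mN N0 mE ES); last 2 first.
  - by apply: measurable_funM; [exact: continuous_borelH|exact: mg].
  - by move=> x; rewrite normrM mulr_ile1.
  (* A field along the j-th frame vector isolates the component [w j], and reduces the inner product
     with the velocity to one coordinate of the gradient. *)
  pose phi (x : heis R n) : 'rV[R]_(n + n) := psi x *: delta_mx 0 j.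
  have cphi : continuous phi.
    apply: continuous_rV => i; rewrite (_ : (fun t => _) = fun t => psi t * (delta_mx 0 j : 'rV[R]_(n + n)) 0 i).
      by apply: contM => //; exact: cont_cst.
    by apply/funext => t; rewrite !mxE.
  have phiE x i : phi x 0 i = psi x * (i == j)%:R by rewrite !mxE.
  transitivity (\sum_(i < n + n) charge_integral (w i) (fun x => phi x 0%R i))%E.
    rewrite (bigD1 j)//= big1 => [|i ij].
      by rewrite adde0; congr charge_integral; apply/funext => x; rewrite phiE eqxx mulr1.
    rewrite (_ : (fun x => _) = fun=> 0) ?charge_integral0//.
    by apply/funext => x; rewrite phiE (negPf ij) mulr0.
  rewrite (Hw phi cphi); apply: ae_eq_nmintegral.
  apply: aeS (aeI (notN_ae mN N0) sat) => p [Np up] _; apply: ae_eq_nmintegral.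
  apply: aeS (selection_velocity n_ge1 HS Lu ES Np up) => t h /h [-> vt].
  rewrite /hinner; congr EFin; rewrite (bigD1 j)//= big1 => [|i ij].
    rewrite hcoord_frame phiE eqxx mulr1 vt addr0 mulrAC -mulrA mxE [X in - X]mxE; ring.
  by rewrite hcoord_frame phiE (negPf ij) mulr0 mul0r.
split.
- apply: aeS (taylor_ae n_ge1 HS Lu sat ci Ha mN N0 mE ES) => x /(taylor_setP n_ge1 cu)[k].
  exact: taylor2_pansu.
- move=> j; apply/null_content_dominatesP => A mA A0.
  by rewrite dens//; apply: null_set_integral => //; exact: measurable_int (gi j A mA).
- by move=> j; split; [exact: gi|exact: dens].
Qed.
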